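(* Let $f\in\mathcal{C}$. (a) For every $\theta_0\in\mathbb{R}$, if $\pi\sim\mathbb{Q}_{n,f,\theta_0}$ then, as $n\to\infty$, $$\frac1n\sum_{i=1}^n f(i/n,\pi(i)/n)\xrightarrow{P}Z'(f,\theta_0)=\mu_{f,\theta_0}[f].$$ (b) For every $\theta_0\in\mathbb{R}$, if $\pi\sim\mathbb{Q}_{n,f,\theta_0}$, then each of the expressions (as functions of $\theta\in\mathbb{R}$) $$ML_n(\pi,\theta):=\frac1n\sum_{i=1}^n f(i/n,\pi(i)/n)-\frac1n Z_n'(f,\theta),\qquad LD_n(\pi,\theta):=\frac1n\sum_{i=1}^n f(i/n,\pi(i)/n)-Z'(f,\theta)$$ has, with probability tending to $1$ as $n\to\infty$, a unique root, denoted $\hat\theta_{ML}$ and $\hat\theta_{LD}$ respectively, and these are consistent, i.e. $\hat\theta_{ML}\to\theta_0$ and $\hat\theta_{LD}\to\theta_0$ in probability. (c) Consider testing $\theta=\theta_0$ versus $\theta=\theta_1$ with $\theta_1>\theta_0$. The test $\phi_n:=1\{\hat\theta_{LD}>(\theta_0+\theta_1)/2\}$ is consistent, i.e. $$\lim_{n\to\infty}\mathbb{E}_{\mathbb{Q}_{n,f,\theta_0}}\phi_n=0,\qquad \lim_{n\to\infty}\mathbb{E}_{\mathbb{Q}_{n,f,\theta_1}}\phi_n=1.$$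
   Context: $S_n$ is the set of permutations of $\{1,\dots,n\}$. $\mathcal{C}$ is the set of all continuous functions $f:[0,1]^2\to\mathbb{R}$, not identically $0$, with $\int_0^1 f(x,z)\,dz=0$ for all $x\in[0,1]$ and $\int_0^1 f(z,y)\,dz=0$ for all $y\in[0,1]$. For $\theta\in\mathbb{R}$, $\mathbb{Q}_{n,f,\theta}$ is the probability mass function on $S_n$ given by $\mathbb{Q}_{n,f,\theta}(\pi)=e^{\theta\sum_{i=1}^n f(i/n,\pi(i)/n)-Z_n(f,\theta)}$, where $Z_n(f,\theta)=\log\sum_{\pi\in S_n}e^{\theta\sum_{i=1}^n f(i/n,\pi(i)/n)}$. $\mathcal{M}$ is the set of all Borel probability measures on $[0,1]^2$ with both marginals uniform on $[0,1]$; $u$ is the uniform distribution on $[0,1]^2$; $\mu[f]:=\int f\,d\mu$; $D(\cdot\|\cdot)$ is the Kullback-Leibler divergence. $Z(f,\theta):=\sup_{\mu\in\mathcal{M}}\{\theta\mu[f]-D(\mu\|u)\}$, and $\mu_{f,\theta}\in\mathcal{M}$ is the unique measure attaining this supremum; $Z(f,\cdot)$ is differentiable. Primes denote derivatives with respect to $\theta$. On the event (of vanishing probability) where a unique root does not exist, the estimator is defined arbitrarily. *)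

(* Defs.v *)
From HB Require Import structures.
From mathcomp Require Import all_boot all_order all_algebra all_fingroup.
From mathcomp Require Import all_classical all_reals all_analysis.

Set Implicit Arguments.
Unset Strict Implicit.
Unset Printing Implicit Defensive.

Import Order.TTheory GRing.Theory Num.Theory.
Import numFieldNormedType.Exports.

Local Open Scope classical_set_scope.
Local Open Scope ring_scope.
Local Open Scope charge_scope.

Definition unit_square (R : realType) : set (R * R) :=
  `[0, 1]%classic `*` `[0, 1]%classic.
Arguments unit_square : clear implicits.

(* Functions on [0,1]^2 are represented by total functions on R * R whose
   values outside the square are never used. *)
Definition class_C (R : realType) (f : R * R -> R) : Prop :=
  [/\ {within unit_square R, continuous f},
      exists2 z, unit_square R z & f z != 0,
      forall x : R, x \in `[0, 1] ->
        (\int[@lebesgue_measure R]_(z in `[0, 1]) f (x, z))%R = 0 &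
      forall y : R, y \in `[0, 1] ->
        (\int[@lebesgue_measure R]_(z in `[0, 1]) f (z, y))%R = 0].

(* The index i : 'I_n stands for i.+1 in {1, ..., n}. *)
Definition perm_stat (R : realType) (f : R * R -> R) (n : nat) (pi : 'S_n) : R :=
  \sum_(i < n) f (i.+1%:R / n%:R, (pi i).+1%:R / n%:R).

Definition log_partition (R : realType) (f : R * R -> R) (n : nat) (theta : R) : R :=
  ln (\sum_(pi : 'S_n) expR (theta * perm_stat f pi)).

Definition Q_pmf (R : realType) (f : R * R -> R) (theta : R) (n : nat)
    (pi : 'S_n) : R :=
  expR (theta * perm_stat f pi - log_partition f n theta).

Definition pmf_prob (R : realType) (n : nat) (q : 'S_n -> R) (A : set 'S_n) : R :=
  \sum_(pi : 'S_n | pi \in A) q pi.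

Definition pmf_expect (R : realType) (n : nat) (q : 'S_n -> R) (X : 'S_n -> R) : R :=
  \sum_(pi : 'S_n) q pi * X pi.

Definition cvg_in_prob (R : realType) (q X : forall n, 'S_n -> R) (c : R) : Prop :=
  forall eps : R, 0 < eps ->
    pmf_prob (q n) [set pi | eps < `|X n pi - c|] @[n --> \oo] --> (0 : R).

(* When mu `<< nu, the integrand is mu-almost everywhere the logarithm of a
   positive real density and its negative part is mu-integrable, so the integral
   is well defined in [0, +oo]. *)
Definition KL_div d (T : measurableType d) (R : realType)
    (mu nu : probability T R) : \bar R :=
  if `[< mu `<< nu >] then
    (\int[mu]_x (ln (fine ('d (charge_of_finite_measure mu) '/d nu x)))%:E)%E
  else +oo%E.

Definition unif01 (R : realType) : probability (measurableTypeR R) R :=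
  uniform_prob (@ltr01 R).

Notation plane R := (measurableTypeR R * measurableTypeR R)%type.

Definition unif_square (R : realType) : set (plane R) -> \bar R :=
  (unif01 R \x unif01 R)%E.

HB.instance Definition _ (R : realType) := Measure.on (@unif_square R).

Lemma unif_square_setT (R : realType) : @unif_square R setT = 1%E.
Proof.
have u1 : unif01 R setT = 1%E by exact: probability_setT.
rewrite /unif_square -setXTT product_measure1E// -[RHS]mule1.
by congr (_ * _)%E; exact: u1.
Qed.

HB.instance Definition _ (R : realType) :=
  Measure_isProbability.Build _ _ R (@unif_square R) (@unif_square_setT R).

(* Measures on [0,1]^2 with uniform marginals are represented by measures on
   R * R: the marginal conditions force them to be concentrated on the square. *)
Definition permuton (R : realType) :
    set (probability (plane R) R) :=
  [set mu | forall A : set (measurableTypeR R), measurable A ->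
     mu (A `*` setT) = unif01 R A /\ mu (setT `*` A) = unif01 R A].
Arguments permuton : clear implicits.

Definition mean (R : realType) (f : R * R -> R)
    (mu : probability (plane R) R) : R :=
  (\int[mu]_(z in unit_square R) f z)%R.

Definition gibbs_objective (R : realType) (f : R * R -> R) (theta : R)
    (mu : probability (plane R) R) : \bar R :=
  ((theta * mean f mu)%:E - KL_div mu (@unif_square R))%E.

Definition Z_ereal (R : realType) (f : R * R -> R) (theta : R) : \bar R :=
  ereal_sup [set gibbs_objective f theta mu | mu in permuton R].

(* For f in class_C the supremum is finite: the objective is at least 0 at the
   uniform measure and at most `|theta| times the maximum of `|f|. *)
Definition Z_lim (R : realType) (f : R * R -> R) (theta : R) : R :=
  fine (Z_ereal f theta).

(* The measure attaining the supremum. It exists and is unique for f in class_C;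
   get returns a default measure when there is none. *)
Definition mu_gibbs (R : realType) (f : R * R -> R) (theta : R) :
    probability (plane R) R :=
  get [set mu | permuton R mu /\ gibbs_objective f theta mu = Z_ereal f theta].

Definition ML (R : realType) (f : R * R -> R) (n : nat) (pi : 'S_n) (theta : R) : R :=
  n%:R^-1 * perm_stat f pi - n%:R^-1 * derive1 (log_partition f n) theta.

Definition LD (R : realType) (f : R * R -> R) (n : nat) (pi : 'S_n) (theta : R) : R :=
  n%:R^-1 * perm_stat f pi - derive1 (Z_lim f) theta.

Definition has_unique_root (R : realType) (F : R -> R) : Prop :=
  exists! theta : R, F theta = 0.

(* An estimator equal to the root of F n pi whenever that root exists and is
   unique, and arbitrary otherwise. *)
Definition root_estimator (R : realType) (F : forall n, 'S_n -> R -> R)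
    (hat : forall n, 'S_n -> R) : Prop :=
  forall n (pi : 'S_n), has_unique_root (F n pi) -> F n pi (hat n pi) = 0.

(* Main.v *)
Require Import Defs.
From HB Require Import structures.
From mathcomp Require Import all_boot all_order all_algebra all_fingroup.
From mathcomp Require Import all_classical all_reals all_analysis.
From mathcomp Require Import measurable_realfun.
From mathcomp Require Import zify ring lra.

Set Implicit Arguments.
Unset Strict Implicit.
Unset Printing Implicit Defensive.

Import Order.TTheory GRing.Theory Num.Theory.
Import numFieldNormedType.Exports.

Local Open Scope classical_set_scope.
Local Open Scope ring_scope.

(** The sum over permutations that defines the partition function is the permanent
of the matrix with entries [expR (theta * f (i / n, j / n))], and everything follows
from its exponential growth rate and from convexity.

_Potentials._ For every [theta] there are functions [a] and [b] of one variable such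
that [expR (theta * f (x, y) + a x + b y)] is a density with uniform marginals
([schroedinger_potentials]). They are found by alternately scaling rows and columns:
one scaling contracts Hilbert's projective metric ([row_scale_contracts]), so the
iterates converge geometrically. For a permuton [mu], Gibbs' inequality relative to
this density reads [theta * mu[f] - D(mu || u) <= - (avg a + avg b)], because [a] and
[b] integrate to the same constants under all permutons; equality holds for the
density itself. Hence [Z(theta) = - (avg a + avg b)] and the supremum is attained
([Z_erealE], [mu_gibbsP]).

_The partition function._ The potentials multiply all terms of the permanent by the
same factor, so it remains to see that the permanent of a sampled density with
uniform marginals grows like [n!] up to a factor [expR (o(n))]
([grid_permanent_limit]). The columns are grouped in [k] blocks. For an
assignment of a block to every row, the permutations that realise it form a coset of
the group of permutations preserving the blocks, or the empty set. Summing over all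
assignments bounds the permanent from above by the order of this group times the
product of the row sums. For the lower bound, rows choose their blocks independently;
after the removal of a small proportion of the rows no block is overfull with
probability at least one half, by an exponential Markov inequality, and an assignment
that overfills no block is realised by at least as many permutations as the group
has elements. The order of the group cancels against the one that comes from the
constant density, whose permanent is [n!].

_Convexity._ A maximiser at [theta] competes at all other parameters, so its mean
is a subgradient of [Z]. Let [w] and [w'] be the optimal densities at [theta] and
[theta'], and [m], [m'] the corresponding means of [f]. Since [w] and [w'] have the
same marginals,
[(theta' - theta) * (m' - m)] is the integral of [(w' - w) * (ln w' - ln w)]. This
quantity dominates the integral of [(w' - w) ^ 2], which makes the mean locally
Lipschitz ([tilt_mean_lipschitz]) and [Z] differentiable; it also dominates
[(theta' - theta) ^ 2] times the integral of [f ^ 2], since [f] is orthogonal to the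
functions of one variable, which makes the mean strictly increasing
([tilt_mean_strict]).

_Statistics._ The exponential Markov inequality and the differentiability of the
limit of the log-partition functions give the concentration of the statistic around
[Z'(theta0)] ([concentration]). The derivatives of the convex functions [Z_n / n]
converge to [Z'] as well ([mean_n_cvg]). Both estimating equations therefore ask for
the point where a continuous increasing function, close to [Z'], takes a value close
to [Z'(theta0)]; the strict monotonicity of [Z'] localises this point
([root_event]). For finite [n] the mean function is injective as soon as it is not
constant ([emean_inj]). The test is consistent because the estimator is. *)

(** * Bounded uniformly continuous functions *)

(** Bounded uniformly continuous functions: a class that is stable under averaging
over one variable and under uniform limits, and that gives at once measurability,
integrability and uniform control of Riemann sums. *)
Definition buc (R : realType) (T : pseudoMetricType R) (h : T -> R) : Prop :=
  (exists M : R, forall p, `|h p| <= M) /\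
  (forall e : R, 0 < e -> exists2 d : R, 0 < d &
     forall p q, ball p d q -> `|h p - h q| <= e).

Lemma min_lel (R : realType) (x y : R) : Num.min x y <= x.
Proof. by rewrite ge_min lexx. Qed.

Lemma min_ler (R : realType) (x y : R) : Num.min x y <= y.
Proof. by rewrite ge_min lexx orbT. Qed.

Section BoundedUniformlyContinuous.
Context {R : realType} {T : pseudoMetricType R}.
Implicit Types g h : T -> R.

Lemma buc_bound h : buc h -> exists2 M : R, 0 < M & forall p, `|h p| <= M.
Proof.
case=> -[M hM] _; exists (Num.max M 1); first by rewrite lt_max ltr01 orbT.
by move=> p; rewrite le_max hM.
Qed.

Lemma buc_cst (c : R) : buc (fun _ : T => c).
Proof.
split; first by exists `|c|.
by move=> e e0; exists 1 => // p q _; rewrite subrr normr0 ltW.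
Qed.

Lemma bucD g h : buc g -> buc h -> buc (fun p => g p + h p).
Proof.
move=> [[M gM] gc] [[N hN] hc]; split.
  by exists (M + N) => p; rewrite (le_trans (ler_normD _ _))// lerD.
move=> e e0; have e2 : 0 < e / 2 by lra.
have [d d0 dg] := gc _ e2; have [d' d'0 dh] := hc _ e2.
exists (Num.min d d'); first by rewrite lt_min d0.
move=> p q pq.
have {}dg := dg p q (le_ball (min_lel d d') pq).
have {}dh := dh p q (le_ball (min_ler d d') pq).
have -> : g p + h p - (g q + h q) = (g p - g q) + (h p - h q) by ring.
by rewrite (le_trans (ler_normD _ _))//; lra.
Qed.

Lemma bucM g h : buc g -> buc h -> buc (fun p => g p * h p).
Proof.
move=> bg bh; have [M M0 gM] := buc_bound bg; have [N N0 hN] := buc_bound bh.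
move: bg bh => [_ gc] [_ hc]; split.
  by exists (M * N) => p; rewrite normrM ler_pM.
move=> e e0.
have eN : 0 < e / (2 * N) by rewrite divr_gt0// mulr_gt0.
have eM : 0 < e / (2 * M) by rewrite divr_gt0// mulr_gt0.
have [d d0 dg] := gc _ eN; have [d' d'0 dh] := hc _ eM.
exists (Num.min d d'); first by rewrite lt_min d0.
move=> p q pq.
have {}dg := dg p q (le_ball (min_lel d d') pq).
have {}dh := dh p q (le_ball (min_ler d d') pq).
have -> : g p * h p - g q * h q = (g p - g q) * h p + g q * (h p - h q) by ring.
rewrite (le_trans (ler_normD _ _))// !normrM.
have -> : e = e / (2 * N) * N + M * (e / (2 * M)) by field; lra.
by rewrite lerD// ler_pM.
Qed.

Lemma bucZ c h : buc h -> buc (fun p => c * h p).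
Proof. by move=> bh; apply: bucM => //; exact: buc_cst. Qed.

Lemma bucN h : buc h -> buc (fun p => - h p).
Proof.
move=> /(bucZ (-1)); rewrite (_ : (fun p => -1 * h p) = (fun p => - h p))//.
by apply/funext => p; rewrite mulN1r.
Qed.

Lemma bucB g h : buc g -> buc h -> buc (fun p => g p - h p).
Proof. by move=> bg bh; apply: bucD => //; exact: bucN. Qed.

Lemma buc_expR h : buc h -> buc (fun p => expR (h p)).
Proof.
move=> bh; have [M M0 hM] := buc_bound bh; case: bh => _ hc; split.
  exists (expR M) => p; rewrite ger0_norm ?expR_ge0// ler_expR.
  by rewrite (le_trans (ler_norm _)).
move=> e e0; have eM : 0 < e / expR M by rewrite divr_gt0// expR_gt0.
have [d d0 dh] := hc _ eM; exists d => //.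
have one_sided p q : ball p d q -> expR (h p) - expR (h q) <= e.
  move=> pq; have {}dh := dh _ _ pq.
  have -> : expR (h p) - expR (h q) = expR (h p) * (1 - expR (h q - h p)).
    by rewrite mulrBr mulr1 -expRD addrCA subrr addr0.
  have H1 : 1 - expR (h q - h p) <= `|h p - h q|.
    have := expR_ge1Dx (h q - h p); have := ler_norm (h p - h q); lra.
  have -> : e = expR M * (e / expR M) by rewrite mulrCA mulfV ?mulr1 ?gt_eqF ?expR_gt0.
  rewrite (@le_trans _ _ (expR (h p) * (e / expR M)))//.
    by rewrite ler_wpM2l ?expR_ge0//; lra.
  rewrite ler_wpM2r ?ler_expR//; first exact: ltW.
  by rewrite (le_trans (ler_norm _)).
move=> p q pq; rewrite ler_norml one_sided// andbT.
by rewrite lerNl opprB one_sided//; exact: ball_sym.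
Qed.

End BoundedUniformlyContinuous.

Section TwoVariables.
Context {R : realType}.
Implicit Types (g : R -> R) (h : R * R -> R) (e c d x y : R).

Lemma buc_fst g : buc g -> buc (fun p : R * R => g p.1).
Proof.
move=> [[M gM] gc]; split; first by exists M => p.
by move=> e /gc[d d0 dg]; exists d => // p q [pq _]; exact: dg.
Qed.

Lemma buc_snd g : buc g -> buc (fun p : R * R => g p.2).
Proof.
move=> [[M gM] gc]; split; first by exists M => p.
by move=> e /gc[d d0 dg]; exists d => // p q [_ pq]; exact: dg.
Qed.

Lemma buc_slice1 h x : buc h -> buc (fun y => h (x, y)).
Proof.
move=> [[M hM] hc]; split; first by exists M => p.
move=> e /hc[d d0 dh]; exists d => // p q pq; apply: dh.
by split => //=; exact: ballxx.
Qed.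

Lemma buc_swap h : buc h -> buc (fun p : R * R => h (p.2, p.1)).
Proof.
move=> [[M hM] hc]; split; first by exists M => p.
by move=> e /hc[d d0 dh]; exists d => // -[p p'] [q q'] [/= pq pq']; apply: dh.
Qed.

Lemma buc_slice2 h y : buc h -> buc (fun x => h (x, y)).
Proof. by move=> /buc_swap/(buc_slice1 y). Qed.

Lemma buc_continuous (T : pseudoMetricType R) (h : T -> R) :
  buc h -> continuous h.
Proof.
move=> [_ hc] p; apply/cvgrPdist_le => e /hc[d d0 dh].
by apply/nbhs_ballP; exists d => //= q /dh.
Qed.

Lemma buc_measurable g : buc g -> measurable_fun setT (g : measurableTypeR R -> R).
Proof. by move=> /buc_continuous; exact: continuous_measurable_fun. Qed.

(** The topology of the plane has a countable base of rectangles with rational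
centres, so its open sets belong to the product sigma-algebra. *)
Lemma open_measurable_plane (A : set (R * R)) : open A ->
  measurable (A : set (measurableTypeR R * measurableTypeR R)).
Proof.
move=> oA.
pose r (n : nat) : R := n.+1%:R^-1.
have r0 n : 0 < r n by rewrite invr_gt0 ltr0n.
pose B (i : rat * rat * nat) : set (R * R) :=
  ball (ratr i.1.1 : R) (r i.2) `*` ball (ratr i.1.2 : R) (r i.2).
pose C i := if `[< B i `<=` A >] then B i else set0.
have -> : A = \bigcup_i C i.
  apply/seteqP; split => [[x y] Axy|[x y] [i _]]; last first.
    by rewrite /C; case: asboolP => // BA /BA.
  have /nbhs_ballP[e /= e0 eA] : nbhs (x, y) A by move: oA; rewrite openE; apply.
  have [n ne] : exists n, r n < e / 2.
    have /(@ltr_add_invr R 0)[n] : 0 < e / 2 by lra.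
    by rewrite add0r => ?; exists n.
  have rat_near z : exists a : rat, ball (ratr a : R) (r n) z.
    have [a] : exists a : rat, ratr a \in `]z - r n, z + r n[.
      by apply: rat_in_itvoo; have := r0 n; lra.
    rewrite in_itv/= => /andP[a1 a2]; exists a.
    by rewrite /ball/= ltr_distlC; apply/andP; split; lra.
  have [a ax] := rat_near x; have [b bY] := rat_near y.
  exists (a, b, n) => //; rewrite /C; case: asboolP => [_ //|]; case.
  move=> [x' y'] [/= ax' by']; apply: eA.
  by split => /=; apply: (@le_ball _ _ _ (r n + r n));
     rewrite ?(ltW (_ : r n + r n < e))//; try lra;
     [apply: ball_triangle (ball_sym ax) ax'|apply: ball_triangle (ball_sym bY) by'].
apply: countable_bigcupT_measurable => [|i]; first exact: countableP.
rewrite /C; case: asboolP => _ //; apply: measurableX;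
  apply: open_measurable; exact: ball_open.
Qed.

Lemma buc_measurable2 h : buc h ->
  measurable_fun setT (h : measurableTypeR R * measurableTypeR R -> R).
Proof.
move=> /buc_continuous/continuousP ch.
apply: (measurability _ (RGenOpens.measurableE R)).
move=> _ [_ [a [b ->] <-]]; rewrite setTI; apply: open_measurable_plane.
exact/ch/interval_open.
Qed.

End TwoVariables.

(** * Averages over the unit interval *)

(** Bounded measurable functions, a class that also contains the indicators of
cells. *)
Definition bm (R : realType) (g : R -> R) : Prop :=
  measurable_fun setT (g : measurableTypeR R -> R) /\ exists M : R, forall x, `|g x| <= M.

(** The average over [0, 1] is taken with respect to the uniform law on the whole
line, so that no domain of integration has to be carried along. *)
Definition avg (R : realType) (g : R -> R) : R := (\int[unif01 R]_x g x)%R.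

Section Averages.
Context {R : realType}.
Implicit Types (g h : R -> R) (c : R).

Lemma buc_bm g : buc g -> bm g.
Proof. by move=> bg; split; [exact: buc_measurable|case: bg]. Qed.

Lemma bm_integrable g : bm g -> (unif01 R).-integrable setT (EFin \o g).
Proof.
move=> [mg [M gM]]; apply: measurable_bounded_integrable => //.
  by rewrite [X in (X < _)%E](_ : _ = 1%E) ?ltry//; exact: probability_setT.
by exists M; split; [exact: num_real|move=> x Mx y _ /=; rewrite (le_trans (gM y))// ltW].
Qed.

Lemma bm_cst c : bm (fun=> c : R).
Proof. by split; [exact: measurable_cst|exists `|c|]. Qed.

Lemma bmD g h : bm g -> bm h -> bm (fun x => g x + h x).
Proof.
move=> [mg [M gM]] [mh [N hN]]; split; first exact: measurable_funD.
by exists (M + N) => x; rewrite (le_trans (ler_normD _ _))// lerD.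
Qed.

Lemma bmM g h : bm g -> bm h -> bm (fun x => g x * h x).
Proof.
move=> [mg [M gM]] [mh [N hN]]; split; first exact: measurable_funM.
by exists (M * N) => x; rewrite normrM ler_pM.
Qed.

Lemma bmZ c g : bm g -> bm (fun x => c * g x).
Proof. by move=> bg; apply: bmM => //; exact: bm_cst. Qed.

Lemma bm_sum (I : Type) (s : seq I) (h : I -> R -> R) :
  (forall i, bm (h i)) -> bm (fun x => \sum_(i <- s) h i x).
Proof.
move=> bh; elim: s => [|i s IH].
  by under eq_fun do rewrite big_nil; exact: bm_cst.
by under eq_fun do rewrite big_cons; exact: bmD.
Qed.

Lemma avgD g h : bm g -> bm h -> avg (fun x => g x + h x) = avg g + avg h.
Proof. by move=> bg bh; rewrite /avg RintegralD//; exact: bm_integrable. Qed.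

Lemma avgZ c g : bm g -> avg (fun x => c * g x) = c * avg g.
Proof. by move=> bg; rewrite /avg RintegralZl//; exact: bm_integrable. Qed.

Lemma avg_cst c : avg (fun=> c) = c.
Proof.
rewrite /avg Rintegral_cst// [X in fine X](_ : _ = 1%E) ?mulr1//.
exact: probability_setT.
Qed.

Lemma le_avg g h : bm g -> bm h -> (forall x, g x <= h x) -> avg g <= avg h.
Proof. by move=> bg bh gh; apply: le_Rintegral => //; exact: bm_integrable. Qed.

Lemma eq_avg g h : g =1 h -> avg g = avg h.
Proof. by move=> /funext ->. Qed.

Lemma avgB g h : bm g -> bm h -> avg (fun x => g x - h x) = avg g - avg h.
Proof.
move=> bg bh; rewrite (@eq_avg _ (fun x => g x + -1 * h x)); last by move=> x; rewrite mulN1r.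
by rewrite avgD ?avgZ ?mulN1r//; exact: bmZ.
Qed.

Lemma avg_ge0 g : (forall x, 0 <= g x) -> 0 <= avg g.
Proof. by move=> g0; apply: Rintegral_ge0 => x _. Qed.

Lemma avg_sum (I : Type) (s : seq I) (h : I -> R -> R) : (forall i, bm (h i)) ->
  avg (fun x => \sum_(i <- s) h i x) = \sum_(i <- s) avg (h i).
Proof.
move=> bh; elim: s => [|i s IH].
  by rewrite big_nil; under eq_avg do rewrite big_nil; rewrite avg_cst.
rewrite big_cons -IH -avgD//; last exact: bm_sum.
by apply: eq_avg => x; rewrite big_cons.
Qed.

Lemma norm_avg_le g c : bm g -> (forall x, `|g x| <= c) -> `|avg g| <= c.
Proof.
move=> bg gc; rewrite ler_norml -{1}(avg_cst (-c)) -{2}(avg_cst c).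
by apply/andP; split; apply: le_avg => //; try exact: bm_cst;
  move=> x; have := gc x; rewrite ler_norml => /andP[].
Qed.

Lemma avg_lebesgue g : bm g ->
  (\int[@lebesgue_measure R]_(z in `[0%R, 1%R]) g z)%R = avg g.
Proof.
move=> bg; have [mg [M gM]] := bg.
have bgM : bm (fun x => g x + M) by apply: bmD => //; exact: bm_cst.
have E : avg (fun x => g x + M) =
  (\int[@lebesgue_measure R]_(z in `[0%R, 1%R]) (g z + M))%R.
  rewrite /avg /Rintegral (@integral_uniform R 0 1 ltr01); first 1 last.
  - by apply/measurable_EFinP; case: bgM.
  - by move=> x; rewrite lee_fin; have := gM x; rewrite ler_norml; lra.
  by rewrite subr0 invr1 mul1e.
have l01 : @lebesgue_measure R `[0%R, 1%R]%classic = 1%E.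
  by rewrite lebesgue_measure_itv/= lte_fin ltr01 -EFinB subr0.
have ig h : bm h -> (@lebesgue_measure R).-integrable `[0%R, 1%R] (EFin \o h).
  move=> [mh [N hN]]; apply: measurable_bounded_integrable => //.
  - by rewrite [X in (X < _)%E]l01 ltry.
  - exact: measurable_funTS.
  - by exists N; split; [exact: num_real|move=> x Nx y _ /=; rewrite (le_trans (hN y))// ltW].
move: E; rewrite avgD ?avg_cst//; last exact: bm_cst.
rewrite RintegralD//; [|exact: ig|exact: (ig (fun=> M) (bm_cst M))].
rewrite Rintegral_cst// [X in fine X]l01 mulr1.
by move=> /addIr.
Qed.

Definition cell (k b : nat) (x : R) : R := (b%:R / k%:R <= x < b.+1%:R / k%:R)%R%:R.

Lemma cell_indic k b : cell k b = \1_(`[(b%:R / k%:R)%R, (b.+1%:R / k%:R)%R[%classic).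
Proof.
apply/funext => x; by rewrite /cell indicE mem_setE in_itv.
Qed.

Lemma measurable_indic_itv (i : interval R) :
  measurable_fun setT (\1_([set` i] : set (measurableTypeR R)) : measurableTypeR R -> R).
Proof. by apply: measurable_indic; exact: measurable_itv. Qed.

Lemma bm_cell k b : bm (cell k b).
Proof.
split; first by rewrite cell_indic; exact: measurable_indic_itv.
by exists 1 => x; rewrite /cell; case: (_ <= x < _); rewrite ?normr1// normr0.
Qed.

Lemma avg_itv (a b : R) : 0 <= a -> a <= b -> b <= 1 ->
  avg (\1_(`[a, b[%classic)) = b - a.
Proof.
move=> a0 ab b1; rewrite -avg_lebesgue; last first.
  split; first exact: measurable_indic_itv.
  by exists 1 => x; rewrite indicE; case: (_ \in _); rewrite ?normr1// normr0.
rewrite /Rintegral integral_indic//= setIidl; last first.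
  move=> x /=; rewrite !in_itv/= => /andP[? ?]; apply/andP; split; lra.
rewrite lebesgue_measure_itv/= lte_fin; case: ltP => //= ba.
lra.
Qed.

Lemma avg_cell k b : (b < k)%N -> avg (cell k b) = k%:R^-1.
Proof.
move=> bk; have k0 : (0 : R) < k%:R by rewrite ltr0n (leq_ltn_trans _ bk).
rewrite cell_indic avg_itv.
- by rewrite -mulrBl -natrB// subSnn mul1r.
- by rewrite divr_ge0 ?ler0n.
- by rewrite ler_wpM2r ?invr_ge0 ?(ltW k0)// ler_nat.
- by rewrite ler_pdivrMr// mul1r ler_nat.
Qed.

Lemma sum_cell k x : (0 < k)%N ->
  \sum_(b < k) cell k b x = (0 <= x < 1)%R%:R.
Proof.
move=> k0; have k0' : (0 : R) < k%:R by rewrite ltr0n.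
have E b : cell k b x = (x < b.+1%:R / k%:R)%R%:R - (x < b%:R / k%:R)%R%:R.
  rewrite /cell; have : b%:R / k%:R <= b.+1%:R / k%:R :> R.
    by rewrite ler_wpM2r ?invr_ge0 ?(ltW k0')// ler_nat.
  case: (leP (b%:R / k%:R)) => H; case: (ltP x (b.+1%:R / k%:R)) => H' HH /=; rewrite ?subr0 ?subrr//; lra.
under eq_bigr do rewrite E.
rewrite -(big_mkord xpredT (fun b => (x < b.+1%:R / k%:R)%R%:R - (x < b%:R / k%:R)%R%:R)).
rewrite telescope_sumr// mul0r divff ?gt_eqF//.
by case: (leP 0 x) => H; case: (ltP x 1) => H' /=; rewrite ?subr0 ?subrr//; lra.
Qed.

(** The cells cover [0, 1[ once; the rest of the line is null. *)
Lemma avg_cells k g : (0 < k)%N -> bm g ->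
  avg g = \sum_(b < k) avg (fun x => g x * cell k b x).
Proof.
move=> k0 bg; rewrite -avg_sum; last by move=> b; apply: bmM => //; exact: bm_cell.
have [_ [M gM]] := bg.
pose s x := \sum_(b < k) cell k b x.
have bs : bm s by apply: bm_sum => b; exact: bm_cell.
have as1 : avg s = 1.
  rewrite avg_sum => [|b]; last exact: bm_cell.
  under eq_bigr => b _ do rewrite avg_cell//.
  by rewrite sumr_const card_ord -[LHS]mulr_natl divff ?pnatr_eq0 -?lt0n.
rewrite (@eq_avg (fun x => \sum_(b < k) _) (fun x => g x * s x)); last first.
  by move=> x; rewrite mulr_sumr.
apply/eqP; rewrite -subr_eq0 -avgB//; last exact: bmM.
have b1s : bm (fun x => 1 - s x).
  rewrite (_ : (fun x => 1 - s x) = fun x => 1 + -1 * s x).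
    by apply: bmD; [exact: bm_cst|exact: bmZ].
  by apply/funext => x; rewrite mulN1r.
have s1 x : s x <= 1 by rewrite /s sum_cell//; case: (_ && _).
have bgs : bm (fun x => g x * (1 - s x)) by exact: bmM.
have H : avg (fun x => M * (1 - s x)) = 0.
  by rewrite avgZ// avgB ?avg_cst ?as1 ?subrr ?mulr0//; exact: bm_cst.
have H' : avg (fun x => - M * (1 - s x)) = 0.
  by rewrite avgZ// avgB ?avg_cst ?as1 ?subrr ?mulr0//; exact: bm_cst.
rewrite (@eq_avg _ (fun x => g x * (1 - s x))); last by move=> x; rewrite mulrBr mulr1.
rewrite eq_le -{1}H -H'; apply/andP; split; apply: le_avg => //; try exact: bmZ.
  by move=> x; rewrite ler_wpM2r ?subr_ge0//; have := gM x; rewrite ler_norml => /andP[].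
by move=> x; rewrite ler_wpM2r ?subr_ge0//; have := gM x; rewrite ler_norml => /andP[].
Qed.

End Averages.

(** * Double averages and Riemann sums *)

Lemma norm_avgB_le (R : realType) (g h : R -> R) e : bm g -> bm h ->
  (forall x, `|g x - h x| <= e) -> `|avg g - avg h| <= e.
Proof.
move=> bg bh gh; rewrite -avgB//; apply: norm_avg_le => //.
rewrite (_ : (fun x => g x - h x) = fun x => g x + -1 * h x).
  by apply: bmD => //; exact: bmZ.
by apply/funext => x; rewrite mulN1r.
Qed.

Section DoubleAverages.
Context {R : realType}.
Implicit Types (g : R -> R) (h : R * R -> R) (e c d x y : R).

Lemma buc_avg h : buc h -> buc (fun x => avg (fun y => h (x, y))).
Proof.
move=> bh; have [M M0 hM] := buc_bound bh; split.
  exists M => x; apply: norm_avg_le => //.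
  by apply: buc_bm; exact: buc_slice1.
move=> e e0; have [_ /(_ _ e0)[d d0 hd]] := bh; exists d => // x x' xx'.
apply: norm_avgB_le => [||y]; [by apply: buc_bm; exact: buc_slice1..|].
by apply: hd; split => //=; exact: ballxx.
Qed.

Lemma buc_avg2 h : buc h -> buc (fun y => avg (fun x => h (x, y))).
Proof. by move=> /buc_swap/buc_avg. Qed.

Lemma buc_integrable h (mu : probability (measurableTypeR R * measurableTypeR R)%type R) :
  buc h -> mu.-integrable setT (EFin \o h).
Proof.
move=> bh; apply: measurable_bounded_integrable => //.
- by rewrite [X in (X < _)%E](_ : _ = 1%E) ?ltry//; exact: probability_setT.
- exact: buc_measurable2.
have [M M0 hM] := buc_bound bh.
by exists M; split; [exact: num_real|move=> x Mx y _ /=; rewrite (le_trans (hM y))// ltW].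
Qed.

Lemma integral_unif_square12 h : buc h ->
  (\int[@unif_square R]_z (h z)%:E = (avg (fun x => avg (fun y => h (x, y))))%:E)%E.
Proof.
move=> bh; have ih := buc_integrable (@unif_square R) bh.
rewrite -(@integral12_prod_meas1 _ _ _ _ R (unif01 R) (unif01 R) (EFin \o h) ih).
have E x : fubini_F (unif01 R) (EFin \o h) x = (avg (fun y => h (x, y)))%:E.
  rewrite /fubini_F /= /avg /Rintegral fineK//.
  apply: integrable_fin_num => //.
  by apply: bm_integrable; apply: buc_bm; exact: buc_slice1.
transitivity (\int[unif01 R]_x (avg (fun y => h (x, y)))%:E)%E.
  by apply: eq_integral => x _; exact: E.
rewrite [in RHS]/avg /Rintegral fineK//; apply: integrable_fin_num => //.
by apply: bm_integrable; apply: buc_bm; exact: buc_avg.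
Qed.

Lemma integral_unif_square21 h : buc h ->
  (\int[@unif_square R]_z (h z)%:E = (avg (fun y => avg (fun x => h (x, y))))%:E)%E.
Proof.
move=> bh; have ih := buc_integrable (@unif_square R) bh.
rewrite -(@integral21_prod_meas1 _ _ _ _ R (unif01 R) (unif01 R) (EFin \o h) ih).
have E y : fubini_G (unif01 R) (EFin \o h) y = (avg (fun x => h (x, y)))%:E.
  rewrite /fubini_G /= /avg /Rintegral fineK//.
  apply: integrable_fin_num => //.
  by apply: bm_integrable; apply: buc_bm; exact: buc_slice2.
transitivity (\int[unif01 R]_y (avg (fun x => h (x, y)))%:E)%E.
  by apply: eq_integral => y _; exact: E.
rewrite [in RHS]/avg /Rintegral fineK//; apply: integrable_fin_num => //.
by apply: bm_integrable; apply: buc_bm; exact: buc_avg2.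
Qed.

Lemma avg_swap h : buc h ->
  avg (fun x => avg (fun y => h (x, y))) = avg (fun y => avg (fun x => h (x, y))).
Proof.
move=> bh; apply: EFin_inj.
exact: etrans (esym (integral_unif_square12 bh)) (integral_unif_square21 bh).
Qed.

End DoubleAverages.

Section RiemannSums.
Context {R : realType}.
Implicit Types (g : R -> R) (h : R * R -> R) (e c d x y : R).

Lemma avg_cell_le g (c : R) k b : bm g -> (b < k)%N ->
  (forall x, b%:R / k%:R <= x < b.+1%:R / k%:R -> g x <= c) ->
  avg (fun x => g x * cell k b x) <= c / k%:R.
Proof.
move=> bg bk gc; rewrite -(avg_cell bk) -avgZ; last exact: bm_cell.
apply: le_avg => [||x]; [by apply: bmM => //; exact: bm_cell|by apply: bmZ; exact: bm_cell|].
rewrite /cell; case: (boolP (_ <= x < _)) => [/gc|_]; first by rewrite !mulr1.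
by rewrite !mulr0.
Qed.

Lemma avg_cell_ge g (c : R) k b : bm g -> (b < k)%N ->
  (forall x, b%:R / k%:R <= x < b.+1%:R / k%:R -> c <= g x) ->
  c / k%:R <= avg (fun x => g x * cell k b x).
Proof.
move=> bg bk gc; rewrite -(avg_cell bk) -avgZ; last exact: bm_cell.
apply: le_avg => [||x]; [by apply: bmZ; exact: bm_cell|by apply: bmM => //; exact: bm_cell|].
rewrite /cell; case: (boolP (_ <= x < _)) => [/gc|_]; first by rewrite !mulr1.
by rewrite !mulr0.
Qed.

Lemma riemann_sum g e k : bm g -> (0 < k)%N ->
  (forall x x', `|x - x'| <= k%:R^-1 -> `|g x - g x'| <= e) ->
  `|k%:R^-1 * (\sum_(b < k) g (b.+1%:R / k%:R)) - avg g| <= e.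
Proof.
move=> bg k0 ge; rewrite (avg_cells k0 bg).
have k0' : (0 : R) < k%:R by rewrite ltr0n.
have kne : k%:R != 0 :> R by rewrite gt_eqF.
have cellx b (x : R) : b%:R / k%:R <= x < b.+1%:R / k%:R -> `|b.+1%:R / k%:R - x| <= k%:R^-1.
  rewrite -natr1 mulrDl mul1r => /andP[H1 H2].
  by rewrite ler_norml; apply/andP; split; lra.
have bnd (b : 'I_k) :
    (g (b.+1%:R / k%:R) - e) / k%:R <= avg (fun x => g x * cell k b x) <=
    (g (b.+1%:R / k%:R) + e) / k%:R.
  apply/andP; split; [apply: avg_cell_ge => // x /cellx/ge|apply: avg_cell_le => // x /cellx/ge];
    rewrite ler_norml => /andP[]; lra.
have L : \sum_(b < k) (g (b.+1%:R / k%:R) - e) / k%:R <=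
         \sum_(b < k) avg (fun x => g x * cell k b x).
  by apply: ler_sum => b _; have /andP[] := bnd b.
have U : \sum_(b < k) avg (fun x => g x * cell k b x) <=
         \sum_(b < k) (g (b.+1%:R / k%:R) + e) / k%:R.
  by apply: ler_sum => b _; have /andP[] := bnd b.
have E c : \sum_(b < k) (g (b.+1%:R / k%:R) + c) / k%:R =
    k%:R^-1 * (\sum_(b < k) g (b.+1%:R / k%:R)) + c.
  rewrite -mulr_suml big_split/= sumr_const card_ord -[X in _ + X]mulr_natl.
  by field.
rewrite E in U; rewrite (E (-e)) in L.
by rewrite ler_norml; apply/andP; split; lra.
Qed.

(** The modulus of continuity, hence [N], does not depend on the second variable. *)
Lemma riemann_sum_unif h e : buc h -> 0 < e ->
  exists N : nat, forall n, (N <= n)%N -> forall y,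
    `|n%:R^-1 * (\sum_(b < n) h (b.+1%:R / n%:R, y)) - avg (fun x => h (x, y))| <= e.
Proof.
move=> bh e0; have [_ /(_ _ e0)[d d0 hd]] := bh.
have [N Nd] : exists N, N.+1%:R^-1 < d.
  by have [N] := @ltr_add_invr R 0 _ d0; rewrite add0r => ?; exists N.
exists N.+1 => n Nn y; apply: (@riemann_sum (fun x => h (x, y))).
- by apply: buc_bm; exact: buc_slice2.
- by rewrite (leq_trans _ Nn).
- move=> x x' xx'; apply: hd; split => /=; last exact: ballxx.
  rewrite /ball/= (le_lt_trans xx')// (le_lt_trans _ Nd)//.
  by rewrite lef_pV2 ?posrE ?ltr0n ?ler_nat// (leq_trans _ Nn).
Qed.

Lemma riemann_sum_cvg g : buc g ->
  n%:R^-1 * (\sum_(b < n) g (b.+1%:R / n%:R)) @[n --> \oo] --> avg g.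
Proof.
move=> bg; apply/cvgrPdist_le => e e0.
have [N NE] := riemann_sum_unif (buc_fst bg) e0.
by exists N => // n /NE/(_ 0)/=; rewrite distrC.
Qed.

(** Uniform continuity spreads a positive value over a whole cell, which has
positive mass. *)
Lemma avg_eq0 g x : buc g -> (forall x, 0 <= g x) -> avg g = 0 -> 0 <= x <= 1 -> g x = 0.
Proof.
move=> bg g0 ag /andP[x0 x1].
apply/eqP; rewrite eq_le g0 andbT leNgt; apply/negP => gx0.
have e0 : 0 < g x / 2 by lra.
have [_ /(_ _ e0)[d d0 gd]] := bg.
have [k kd] : exists k, k.+1%:R^-1 < d.
  by have [k] := @ltr_add_invr R 0 _ d0; rewrite add0r => ?; exists k.
have k0 : (0 : R) < k.+1%:R by rewrite ltr0n.
have [b bk bx] : exists2 b, (b < k.+1)%N & b%:R / k.+1%:R <= x <= b.+1%:R / k.+1%:R.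
  have [x1'|x1'] := ltP x 1; last first.
    exists k => //; rewrite divff ?gt_eqF// x1 (le_trans _ x1')//.
    by rewrite ler_pdivrMr// mul1r ler_nat.
  exists (Num.truncn (x * k.+1%:R)); last first.
    have /andP[t1 t2] := truncn_itv (mulr_ge0 x0 (ltW k0)).
    by rewrite ler_pdivrMr// t1/= ler_pdivlMr// ltW.
  rewrite -(ltr_nat R) (le_lt_trans (_ : _ <= x * k.+1%:R))//.
    by have /andP[] := truncn_itv (mulr_ge0 x0 (ltW k0)).
  by rewrite gtr_pMl.
have : (g x / 2) / k.+1%:R <= avg (fun y => g y * cell k.+1 b y).
  apply: avg_cell_ge => // [|y /andP[y1 y2]]; first exact: buc_bm.
  have : ball x d y.
    move: bx y2; rewrite -[b.+1%:R]natr1 mulrDl mul1r => /andP[bx1 bx2] y2.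
    move: bx1 bx2 y1 y2 kd; set u := b%:R / _; set v := _^-1 => *.
    by rewrite /ball/= (@le_lt_trans _ _ v)// ler_norml; apply/andP; split; lra.
  by move=> /gd; rewrite ler_norml => /andP[]; lra.
have : avg (fun y => g y * cell k.+1 b y) <= avg g.
  apply: le_avg => [||y]; [by apply: bmM; [exact: buc_bm|exact: bm_cell]|exact: buc_bm|].
  by rewrite -[leRHS]mulr1 ler_wpM2l// /cell; case: (_ <= y < _).
have : 0 < (g x / 2) / k.+1%:R by rewrite divr_gt0.
by rewrite ag => H1 H2 H3; move: (lt_le_trans H1 (le_trans H3 H2)); rewrite ltxx.
Qed.

End RiemannSums.

(** * Permanents of matrices with coloured columns *)

Section ColouredPermutations.
Variables (n k : nat) (col : 'I_n -> 'I_k).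
Implicit Types (S : {set 'I_n}) (be : 'I_n -> 'I_k) (p : 'S_n).

Definition follows S be : {set 'S_n} :=
  [set p : 'S_n | [forall i, (i \in S) ==> (col (p i) == be i)]].

Definition col_stab : {set 'S_n} := follows [set: 'I_n] col.

Definition class_size (b : 'I_k) : nat := #|[set j | col j == b]%SET|.

Definition fits S be : bool :=
  [forall b, #|[set i in S | be i == b]| <= class_size b]%N.

Lemma followsP S be p :
  reflect (forall i, i \in S -> col (p i) = be i) (p \in follows S be).
Proof.
rewrite inE; apply: (iffP forallP) => H i; first by move=> iS; have := H i; rewrite iS => /eqP.
by apply/implyP => /H ->.
Qed.

(** The permutations with a full colour pattern form an empty set or a coset of
the colour stabiliser. *)
Lemma card_follows_le be : (#|follows [set: 'I_n] be| <= #|col_stab|)%N.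
Proof.
have [->|[p0 /followsP p0P]] := set_0Vmem (follows [set: 'I_n] be); first by rewrite cards0.
rewrite -(card_imset _ (mulgI p0^-1)%g); apply: subset_leq_card; apply/fintype.subsetP => _ /imsetP[p /followsP pP ->].
apply/followsP => j _; rewrite permM pP ?inE// -p0P ?inE//.
by rewrite -permM mulVg perm1.
Qed.

Lemma card_follows_ge S be p0 : p0 \in follows S be ->
  (#|col_stab| <= #|follows S be|)%N.
Proof.
move=> /followsP p0P; rewrite -(card_imset _ (mulgI p0)).
apply: subset_leq_card; apply/fintype.subsetP => _ /imsetP[p /followsP pP ->].
by apply/followsP => j jS; rewrite permM pP ?inE// p0P.
Qed.

(** The sites are treated one at a time: the image of a new site is exchanged
with a free element of the right class. *)
Lemma fits_follows S be : fits S be -> exists p, p \in follows S be.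
Proof.
move: {2}#|S| (erefl #|S|) => m; elim: m S => [S /eqP|m IH S cS fS].
  by rewrite cards_eq0 => /eqP -> _; exists 1%g; apply/followsP => i; rewrite inE.
have [i0 i0S] : exists i0, i0 \in S by apply/card_gt0P; rewrite cS.
have cS0 : #|S :\ i0| = m by move: cS; rewrite (cardsD1 i0) i0S => -[].
have sub b : [set i in S :\ i0 | be i == b] \subset [set i in S | be i == b].
  by apply/fintype.subsetP => i; rewrite !inE => /andP[/andP[_ ->] ->].
have fS0 : fits (S :\ i0) be.
  by apply/forallP => b; rewrite (leq_trans (subset_leq_card (sub b)))//; exact: (forallP fS).
have [p /followsP pP] := IH _ cS0 fS0.
pose b := be i0.
have lt_b : (#|[set i in S :\ i0 | be i == b]| < class_size b)%N.
  apply: leq_trans (forallP fS b); apply: proper_card; apply/properP; split => //.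
  by exists i0; rewrite !inE ?i0S ?eqxx.
have [j /andP[/eqP jb jN]] : exists j, (col j == b) && (j \notin p @: (S :\ i0)).
  apply/existsP; apply: contraLR lt_b; rewrite negb_exists -leqNgt => /forallP H.
  rewrite /class_size -(card_imset [set i in S :\ i0 | be i == b] (@perm_inj _ p)).
  apply: subset_leq_card; apply/fintype.subsetP => j; rewrite inE => jb.
  have := H j; rewrite jb/= negbK => /imsetP[i iS ji].
  apply/imsetP; exists i => //; rewrite inE iS /=; move: jb; rewrite ji pP//.
exists (tperm i0 ((p^-1)%g j) * p)%g; apply/followsP => i iS; rewrite permM.
case: tpermP => [->|ij|/eqP i0i /eqP ij]; first by rewrite permKV.
  have [ii0|ii0] := eqVneq i i0; first by rewrite -ii0 ij permKV jb /b -ii0 ij.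
  case/negP: jN; apply/imsetP; exists i; first by rewrite !inE ii0.
  by rewrite ij permKV.
by apply: pP; rewrite !inE i0i.
Qed.

Context {R : realType}.
Variable W : 'I_n -> 'I_k -> R.
Hypothesis W_ge0 : forall i b, 0 <= W i b.

(** The product of the row sums enumerates the colour patterns, and each pattern
is met by at most [#|col_stab|] permutations. *)
Lemma coloured_permanent_le :
  \sum_(p : 'S_n) \prod_i W i (col (p i)) <=
  #|col_stab|%:R * \prod_i \sum_b W i b.
Proof.
rewrite bigA_distr_bigA/= (partition_big (fun p : 'S_n => [ffun i => col (p i)]) xpredT)//=.
rewrite mulr_sumr; apply: ler_sum => be _.
rewrite (eq_bigr (fun=> \prod_i W i (be i))); last first.
  by move=> p /eqP <-; apply: eq_bigr => i _; rewrite ffunE.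
rewrite sumr_const -[leLHS]mulr_natl; apply: ler_wpM2r; first exact: prodr_ge0.
rewrite ler_nat; apply: leq_trans (card_follows_le be).
apply: subset_leq_card; apply/fintype.subsetP => p; move=> pbe.
have {}pbe : [ffun i => col (p i)] = be by apply/eqP; exact: pbe.
by apply/followsP => i _; rewrite -pbe ffunE.
Qed.

Variables (S : {set 'I_n}) (c K h : R) (b0 : 'I_k).
Hypothesis K_gt0 : 0 < K.
Hypothesis W_row : forall i, \sum_b W i b = K.

(* Patterns are normalised to b0 outside S, so that each partial pattern is
   counted once. *)
Let patterns : pred {ffun 'I_n -> 'I_k} := [in pfamily b0 (mem S) (fun=> predT)].

Lemma sum_patterns (V : 'I_n -> 'I_k -> R) :
  \sum_(be | patterns be) \prod_(i in S) V i (be i) = \prod_(i in S) \sum_b V i b.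
Proof.
rewrite (big_distr_big_dep b0 (mem S) (fun=> predT) V); apply: eq_big => // be.
Qed.

(** A pattern prescribed on [S] only is met by at least [#|col_stab|] permutations
as soon as it fits, whatever happens at the other sites. *)
Lemma coloured_permanent_ge_fits :
  #|col_stab|%:R * (\sum_(be | patterns be && fits S be) \prod_(i in S) W i (be i)) <=
  \sum_(p : 'S_n) \prod_(i in S) W i (col (p i)).
Proof.
pose proj (p : 'S_n) : {ffun 'I_n -> 'I_k} := [ffun i => if i \in S then col (p i) else b0].
have projP p : patterns (proj p).
  apply/pfamilyP; split => //; apply/fintype.subsetP => i; rewrite !inE ffunE.
  by case: ifP => //; rewrite eqxx.
rewrite [leRHS](partition_big proj patterns)//= big_mkcondr/= mulr_sumr.
apply: ler_sum => be Pbe; case: ifP => [fbe|_]; last first.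
  by rewrite mulr0; apply: sumr_ge0 => p _; exact: prodr_ge0.
rewrite [leRHS](eq_bigr (fun=> \prod_(i in S) W i (be i))); last first.
  by move=> p /eqP <-; apply: eq_bigr => i iS; rewrite ffunE iS.
rewrite sumr_const -[leRHS]mulr_natl; apply: ler_wpM2r; first exact: prodr_ge0.
have [p0 p0P] := fits_follows fbe.
rewrite ler_nat (leq_trans (card_follows_ge p0P))//.
apply: subset_leq_card; apply/fintype.subsetP => p /followsP pP.
suff pbe : proj p = be by rewrite unfold_in pbe; exact: (eqxx be).
apply/ffunP => i; rewrite ffunE; case: ifPn => [/pP//|iS].
move/pfamilyP: Pbe => [/fintype.subsetP/(_ i) Pbe _]; apply/esym/eqP.
by apply: contraNT iS => ?; apply: Pbe.
Qed.

Hypotheses (h_gt0 : 0 < h) (h_lt1 : h < 1).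
Hypothesis W_col : forall b, \sum_(i in S) W i b <= K * ((1 - 2 * h) * (class_size b)%:R).

(** An exponential Markov inequality: under independent colours the mean number
of sites of colour [b] stays a factor [1 - 2 h] below the size of the class. *)
Lemma overfull_patterns_le b :
  \sum_(be | patterns be && (class_size b < #|[set i in S | be i == b]|)%N)
     \prod_(i in S) W i (be i) <=
  K ^+ #|S| * expR (- (h ^+ 2 * (class_size b)%:R)).
Proof.
pose N := class_size b.
have hne : 1 - h != 0 by rewrite gt_eqF// subr_gt0.
have kne : K != 0 by rewrite gt_eqF.
pose V i b' := W i b' * expR (h * (b' == b)%:R).
have V_ge0 i b' : 0 <= V i b' by rewrite mulr_ge0// expR_ge0.
have step1 : \sum_(be | patterns be && (N < #|[set i in S | be i == b]|)%N)
     \prod_(i in S) W i (be i) <=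
   expR (- (h * N%:R)) * \sum_(be | patterns be) \prod_(i in S) V i (be i).
  rewrite big_mkcondr mulr_sumr/=; apply: ler_sum => be _.
  case: ifP => [Nb|_]; last by rewrite mulr_ge0 ?expR_ge0//; exact: prodr_ge0.
  rewrite big_split/= mulrCA ler_peMr//; first exact: prodr_ge0.
  rewrite -expR_sum -expRD -[leLHS]expR0 ler_expR -mulr_sumr addrC subr_ge0.
  rewrite ler_wpM2l ?(ltW h_gt0)//.
  rewrite -natr_sum ler_nat (leq_trans (ltnW Nb))//.
  rewrite -sum1_card (eq_bigl (fun i => (i \in S) && (be i == b))); last by move=> i; rewrite !inE.
  by rewrite big_mkcondr/=; apply: leq_sum => i _; case: eqP.
apply: (le_trans step1); rewrite sum_patterns.
have rowV i : \sum_b' V i b' <= K * expR (h / (1 - h) * (W i b / K)).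
  have -> : \sum_b' V i b' = K + (expR h - 1) * W i b.
    rewrite -(W_row i) (bigD1 b)//= [in RHS](bigD1 b)//= /V eqxx mulr1.
    rewrite (eq_bigr (W i)); first by ring.
    by move=> b' /negbTE ->; rewrite mulr0 expR0 mulr1.
  have eh : expR h - 1 <= h / (1 - h).
    have h1 : 0 < 1 - h by rewrite subr_gt0.
    rewrite ler_pdivlMr//.
    have := expR_ge1Dx (- h); rewrite expRN => H.
    have : (1 - h) * expR h <= 1.
      by rewrite -ler_pdivlMr ?expR_gt0// mul1r.
    nra.
  have := expR_ge1Dx (h / (1 - h) * (W i b / K)).
  rewrite -(ler_pM2l K_gt0) => /(le_trans _); apply.
  rewrite mulrDr mulr1 lerD2l mulrCA.
  by rewrite [leRHS](_ : _ = h / (1 - h) * W i b) ?ler_wpM2r//; field; rewrite ?hne ?kne.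
have : \prod_(i in S) \sum_b' V i b' <= K ^+ #|S| * expR (h / (1 - h) * ((1 - 2 * h) * N%:R)).
  rewrite (le_trans (y := \prod_(i in S) (K * expR (h / (1 - h) * (W i b / K)))))//.
    by apply: ler_prod => i _; rewrite rowV sumr_ge0.
  rewrite big_split/= prodr_const ler_wpM2l ?exprn_ge0 ?(ltW K_gt0)// -expR_sum ler_expR.
  rewrite -mulr_sumr ler_wpM2l ?divr_ge0 ?(ltW h_gt0) ?subr_ge0 ?(ltW h_lt1)//.
  by rewrite -mulr_suml ler_pdivrMr// mulrC.
rewrite -(ler_pM2l (expR_gt0 (- (h * N%:R)))) => /le_trans; apply.
rewrite mulrCA ler_wpM2l ?exprn_ge0 ?(ltW K_gt0)// -expRD ler_expR.
rewrite [leLHS](_ : _ = - (h ^+ 2 / (1 - h) * N%:R)); last by field; rewrite ?hne.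
rewrite lerN2 ler_wpM2r// ler_pdivlMr ?subr_gt0// ler_piMr ?exprn_ge0 ?(ltW h_gt0)//.
by rewrite gerBl ltW.
Qed.

Hypotheses (c_ge0 : 0 <= c) (W_ge : forall i b, c <= W i b).
Variable t : nat.
Hypothesis class_ge : forall b, (t <= class_size b)%N.
Hypothesis small : k%:R * expR (- (h ^+ 2 * t%:R)) <= 2^-1.

(** Half of the mass of the independent colourings of [S] fits the classes; the
sites outside [S] only cost their smallest weight. Together with the upper bound
this replaces asymptotics of multinomial coefficients: [#|col_stab|] will cancel
between two permanents. *)
Lemma coloured_permanent_ge :
  c ^+ #|~: S| * (#|col_stab|%:R * (K ^+ #|S| / 2)) <=
  \sum_(p : 'S_n) \prod_i W i (col (p i)).
Proof.
have step1 : c ^+ #|~: S| * \sum_(p : 'S_n) \prod_(i in S) W i (col (p i)) <=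
    \sum_(p : 'S_n) \prod_i W i (col (p i)).
  rewrite mulr_sumr; apply: ler_sum => p _.
  rewrite [leRHS](bigID (mem S))/= mulrC ler_wpM2l ?prodr_ge0//.
  rewrite -prodr_const (eq_bigl (fun i => i \notin S)); last by move=> i; rewrite inE.
  by apply: ler_prod => i _; rewrite c_ge0 W_ge.
apply: le_trans step1; apply: ler_wpM2l; first exact: exprn_ge0.
apply: le_trans coloured_permanent_ge_fits; apply: ler_wpM2l; first exact: ler0n.
have total : \sum_(be | patterns be) \prod_(i in S) W i (be i) = K ^+ #|S|.
  by rewrite sum_patterns (eq_bigr (fun=> K)) ?prodr_const.
move: total; rewrite (bigID (fun be : {ffun _ -> _} => fits S be))/= => total.
have bad : \sum_(be | patterns be && ~~ fits S be) \prod_(i in S) W i (be i) <= K ^+ #|S| / 2.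
  rewrite (@le_trans _ _ (\sum_b \sum_(be | patterns be && (class_size b < #|[set i in S | be i == b]|)%N)
     \prod_(i in S) W i (be i)))//.
    under [leRHS]eq_bigr do rewrite big_mkcondr/=.
    rewrite exchange_big/= big_mkcondr/=; apply: ler_sum => be _.
    case: ifPn => [|_]; last first.
      by apply: sumr_ge0 => b _; case: ifP => // _; exact: prodr_ge0.
    move=> /forallPn[b]; rewrite -ltnNge => Nb.
    rewrite (bigD1 b)//= Nb lerDl; apply: sumr_ge0 => b' _.
    by case: ifP => // _; exact: prodr_ge0.
  rewrite (@le_trans _ _ (\sum_(b : 'I_k) K ^+ #|S| * expR (- (h ^+ 2 * t%:R))))//.
    apply: ler_sum => b _; apply: (le_trans (overfull_patterns_le b)).
    rewrite ler_wpM2l ?exprn_ge0 ?(ltW K_gt0)// ler_expR lerN2.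
    by rewrite ler_wpM2l ?exprn_ge0 ?(ltW h_gt0)// ler_nat.
  rewrite sumr_const card_ord -[leLHS]mulr_natl mulrCA ler_wpM2l ?exprn_ge0 ?(ltW K_gt0)//.
lra.
Qed.

End ColouredPermutations.

(** * Blocks of columns *)

Lemma nat_above (R : realType) (x : R) : exists N : nat, x <= N%:R.
Proof. by exists (Num.truncn x).+1; rewrite ltW// truncnS_gt. Qed.

Section Blocks.
Variables (n k : nat).

(** The colour of a column is the index of the block of [0, 1] that contains it. *)
Definition block (j : 'I_n) : 'I_k.+1 := inord ((j * k.+1) %/ n)%N.

Lemma blockE (j : 'I_n) : block j = ((j * k.+1) %/ n)%N :> nat.
Proof.
have n0 : (0 < n)%N by rewrite (leq_ltn_trans _ (ltn_ord j)).
by rewrite inordK// ltn_divLR// mulnC ltn_pmul2l.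
Qed.

Lemma class_size_block (b : 'I_k.+1) : (n %/ k.+1 <= class_size block b)%N.
Proof.
have [n00|n0] := posnP n; first by rewrite [X in (X %/ _)%N]n00 div0n.
(* (b * n + k) %/ k.+1 is the smallest column of the block. *)
pose f (r : 'I_(n %/ k.+1)) : nat := ((b * n + k) %/ k.+1 + r)%N.
have f1 r : (b * n <= f r * k.+1)%N.
  rewrite mulnDl; apply: leq_trans (leq_addr _ _).
  by have := ltn_ceil (b * n + k) (ltn0Sn k); rewrite mulSn; clear; lia.
have f2 r : (f r * k.+1 < b.+1 * n)%N.
  rewrite mulnDl; have h1 := leq_trunc_div (b * n + k) k.+1.
  have h2 := leq_trunc_div n k.+1; have h3 : (r.+1 * k.+1 <= n %/ k.+1 * k.+1)%N by rewrite leq_mul.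
  by move: h3; rewrite mulSn; clear; lia.
have fn r : (f r < n)%N.
  rewrite -(ltn_pmul2r (ltn0Sn k)) (leq_trans (f2 r))// mulnC leq_mul//.
pose F r : 'I_n := Ordinal (fn r).
have injF : injective F by move=> r r' /(congr1 val)/=/addnI/val_inj.
rewrite -[X in (X <= _)%N]card_ord -(card_imset predT injF).
apply: subset_leq_card; apply/fintype.subsetP => _ /imsetP[r _ ->].
rewrite inE; apply/eqP/val_inj; rewrite /= blockE/=.
by apply/eqP; rewrite eqn_leq -ltnS ltn_divLR// f2 leq_divRL// f1.
Qed.

Context {R : realType}.

Lemma block_near (j : 'I_n) (y : R) :
  (block j)%:R / k.+1%:R <= y < (block j).+1%:R / k.+1%:R ->
  `|j.+1%:R / n%:R - y| <= k.+1%:R^-1 + n%:R^-1.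
Proof.
have n0 : (0 < n)%N by rewrite (leq_ltn_trans _ (ltn_ord j)).
have n0' : (0 : R) < n%:R by rewrite ltr0n.
have k0' : (0 : R) < k.+1%:R by rewrite ltr0n.
have L : (block j)%:R / k.+1%:R <= j%:R / n%:R :> R.
  rewrite ler_pdivrMr// mulrAC ler_pdivlMr// -!natrM ler_nat blockE.
  exact: leq_trunc_div.
have U : j%:R / n%:R < (block j).+1%:R / k.+1%:R :> R.
  rewrite ltr_pdivlMr// mulrAC ltr_pdivrMr// -!natrM ltr_nat blockE.
  exact: ltn_ceil.
move: L U; rewrite -![_.+1%:R]natr1 !mulrDl !mul1r natr1.
have : 0 < k.+1%:R^-1 :> R by rewrite invr_gt0.
have : 0 < n%:R^-1 :> R by rewrite invr_gt0.
set u := n%:R^-1; set v := k.+1%:R^-1; set a := _ * v; set b := _ * u.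
move=> u0 v0 L U /andP[y1 y2]; rewrite ler_norml; apply/andP; split; lra.
Qed.

End Blocks.

Section BlockWeights.
Context {R : realType}.
Variable g : R * R -> R.
Hypothesis bg : buc g.
Hypothesis g_row : forall x, avg (fun y => expR (g (x, y))) = 1.
Hypothesis g_col : forall y, avg (fun x => expR (g (x, y))) = 1.
Variable M : R.
Hypothesis gM : forall p, `|g p| <= M.

Let bm_row x : bm (fun y => expR (g (x, y))).
Proof. exact: buc_bm (buc_slice1 x (buc_expR bg)). Qed.

(** Averaging the density over the blocks of columns, rather than sampling it,
makes the row sums exact for every number of blocks. *)
Definition block_weight n k (i : 'I_n) (b : 'I_k.+1) : R :=
  k.+1%:R * avg (fun y => expR (g (i.+1%:R / n%:R, y)) * cell k.+1 b y).

Arguments block_weight [n] k i b.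

Lemma block_weight_row n k (i : 'I_n) : \sum_b block_weight k i b = k.+1%:R.
Proof. by rewrite -mulr_sumr -avg_cells// g_row mulr1. Qed.

Lemma block_weight_ge n k (i : 'I_n) b : expR (- M) <= block_weight k i b.
Proof.
rewrite /block_weight mulrC -ler_pdivrMr ?ltr0n//; apply: avg_cell_ge => // y _.
by rewrite ler_expR lerNl; have := gM (i.+1%:R / n%:R, y); rewrite ler_norml; lra.
Qed.

Lemma block_weight_near n k d eta (i j : 'I_n) :
  (forall x y y', `|y - y'| < d -> `|g (x, y) - g (x, y')| <= eta) ->
  k.+1%:R^-1 + n%:R^-1 < d ->
  expR (g (i.+1%:R / n%:R, j.+1%:R / n%:R)) <= expR eta * block_weight k i (block k j) /\
  block_weight k i (block k j) <= expR eta * expR (g (i.+1%:R / n%:R, j.+1%:R / n%:R)).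
Proof.
move=> geta knd; rewrite /block_weight; set b := block k j; set x := _ / _; set y := j.+1%:R / _.
have k0 : (0 : R) < k.+1%:R by rewrite ltr0n.
have near y' : b%:R / k.+1%:R <= y' < b.+1%:R / k.+1%:R -> `|g (x, y) - g (x, y')| <= eta.
  by move=> /block_near H; apply: geta; exact: le_lt_trans H knd.
split.
  rewrite mulrCA [leRHS]mulrC -ler_pdivrMr// -ler_pdivrMl ?expR_gt0// mulrA.
  apply: avg_cell_ge => // y' /near; rewrite -expRN -expRD ler_expR ler_norml.
  by move=> /andP[]; lra.
rewrite mulrC -ler_pdivlMr//; apply: avg_cell_le => // y' /near.
by rewrite -expRD ler_expR ler_norml => /andP[]; lra.
Qed.

Lemma block_weight_col n k (S : {set 'I_n}) (b : 'I_k.+1) (C : R) :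
  (forall y, \sum_(i in S) expR (g (i.+1%:R / n%:R, y)) <= C) ->
  \sum_(i in S) block_weight k i b <= C.
Proof.
move=> SC; rewrite -mulr_sumr -ler_pdivlMl ?ltr0n// mulrC -big_enum/= -avg_sum; last first.
  by move=> i; apply: bmM => //; exact: bm_cell.
rewrite (@eq_avg _ _ (fun y => (\sum_(i in S) expR (g (i.+1%:R / n%:R, y))) * cell k.+1 b y)).
  apply: avg_cell_le => //; under eq_fun do rewrite -big_enum.
  exact: bm_sum.
by move=> y; rewrite -mulr_suml big_enum.
Qed.

(** Removing a proportion of the sites costs every column a fixed proportion of
its mass, which makes room for the fluctuations of independent colours. *)
Lemma block_permanent_ge q k : (0 < q)%N -> 0 <= M ->
  exists N : nat, forall n, (N <= n)%N ->
    expR (- M) ^+ (n %/ q) *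
      (#|col_stab (block (n := n) k)|%:R * (k.+1%:R ^+ (n - n %/ q) / 2)) <=
    \sum_(p : 'S_n) \prod_i block_weight k i (block k (p i)).
Proof.
move=> q0 M0; set c := expR (- M).
have c0 : 0 < c by exact: expR_gt0.
have c1 : c <= 1 by rewrite -expR0 ler_expR oppr_le0.
have q0' : (0 : R) < q%:R by rewrite ltr0n.
have q1 : (1 : R) <= q%:R by rewrite ler1n.
have qne : q%:R != 0 :> R by rewrite gt_eqF.
(* A proportion 1 / q of the sites is removed, which takes the mass r from a
   column of mass 1; half of it absorbs the rounding errors. *)
pose r := c / q%:R.
have r0 : 0 < r by rewrite divr_gt0.
have r1 : r <= 1 by rewrite ler_pdivrMr// mul1r (le_trans c1).
pose h := r / 8.
have h0 : 0 < h by rewrite divr_gt0.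
have h1 : h < 1 by rewrite /h; lra.
have r4 : 0 < r / 4 by rewrite divr_gt0.
have [N1 N1P] := riemann_sum_unif (buc_expR bg) r4.
have [N2 N2P] : exists N2 : nat, 2 * k.+1%:R / h ^+ 2 <= N2%:R :> R.
  exact: nat_above.
have [N3 N3P] : exists N3 : nat, 2 * (c + k.+1%:R) / r <= N3%:R :> R.
  exact: nat_above.
exists (N1 + N2 * k.+1 + N3 + 1)%N => n Nn.
have n0 : (0 < n)%N by clear -Nn; lia.
have n0' : (0 : R) < n%:R by rewrite ltr0n.
pose S : {set 'I_n} := [set i : 'I_n | (i < n - n %/ q)%N]%SET.
have cS : #|S| = (n - n %/ q)%N.
  have le_n : (n - n %/ q <= n)%N by exact: leq_subr.
  have inj_w : injective (widen_ord le_n) by move=> i j /(congr1 val)/= /val_inj.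
  rewrite -[RHS]card_ord -(card_imset predT inj_w).
  apply: eq_card => i; rewrite inE; apply/idP/imsetP => [iS|[j _ ->]//].
    by exists (Ordinal iS) => //; exact: val_inj.
  exact: (ltn_ord j).
have cSC : #|~: S| = (n %/ q)%N.
  by rewrite cardsCs finset.setCK cS card_ord subKn// leq_div.
have nq : n%:R / q%:R - 1 <= (n %/ q)%:R :> R.
  rewrite lerBlDr ler_pdivrMr// natr1 -natrM ler_nat ltnW//.
  exact: ltn_ceil.
have nk : n%:R - k.+1%:R <= k.+1%:R * (n %/ k.+1)%:R :> R.
  rewrite lerBlDr -natrM -natrD ler_nat.
  by have := ltn_ceil n (ltn0Sn k); rewrite mulSn; clear; lia.
rewrite -cS -cSC.
apply: (@coloured_permanent_ge n k.+1 (block k) R (@block_weight n k) _ S c k.+1%:R h ord0 _ _ h0 h1 _ _ _ (n %/ k.+1)%N).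
- by move=> i b; rewrite (le_trans _ (block_weight_ge _ _))// ltW.
- by rewrite ltr0n.
- exact: block_weight_row.
- move=> b; apply: block_weight_col => y.
  have tot : \sum_(i < n) expR (g (i.+1%:R / n%:R, y)) <= n%:R * (1 + r / 4).
    have /N1P/(_ y) : (N1 <= n)%N by clear -Nn; lia.
    rewrite g_col ler_norml => /andP[_]; rewrite lerBlDr addrC => H.
    by rewrite -ler_pdivrMl.
  have out : (n %/ q)%:R * c <= \sum_(i in ~: S) expR (g (i.+1%:R / n%:R, y)).
    rewrite mulr_natl -cSC -sumr_const; apply: ler_sum => i _.
    by rewrite ler_expR lerNl; have := gM (i.+1%:R / n%:R, y); rewrite ler_norml; lra.
  move: tot; rewrite (bigID (mem S))/= => tot.
  rewrite (eq_bigl (fun i => i \notin S)) in out; last by move=> i; rewrite inE.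
  have out' : n%:R * r - c <= (n %/ q)%:R * c.
    rewrite (_ : n%:R * r - c = (n%:R / q%:R - 1) * c); last by rewrite /r; field; rewrite ?qne.
    by rewrite ler_wpM2r// ltW.
  have big_n : c + k.+1%:R <= n%:R * (r / 2).
    have : N3%:R <= n%:R :> R by rewrite ler_nat; clear -Nn; lia.
    move=> /(le_trans N3P); rewrite ler_pdivrMr//; lra.
  have cl : (1 - 2 * h) * (n%:R - k.+1%:R) <= k.+1%:R * ((1 - 2 * h) * (class_size (block (n := n) k) b)%:R).
    rewrite [leRHS]mulrCA; apply: ler_wpM2l; first by rewrite /h; lra.
    by apply: (le_trans nk); rewrite ler_wpM2l// ler_nat; exact: class_size_block.
  have : (1 - 2 * h) * (n%:R - k.+1%:R) >= n%:R - k.+1%:R - n%:R * (r / 4).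
    have : 0 <= h * k.+1%:R by rewrite mulr_ge0// ltW.
    by rewrite /h; lra.
  lra.
- exact: ltW.
- by move=> i b; exact: block_weight_ge.
- by move=> b; exact: class_size_block.
set t := (n %/ k.+1)%N.
have tN : 2 * k.+1%:R / h ^+ 2 <= t%:R :> R.
  by apply: (le_trans N2P); rewrite ler_nat leq_divRL//; clear -Nn; lia.
have h2 : 0 < h ^+ 2 by rewrite exprn_gt0.
rewrite expRN -[leRHS]mul1r ler_pdivrMr ?expR_gt0//.
rewrite (@le_trans _ _ (2^-1 * (h ^+ 2 * t%:R)))//.
  by move: tN; rewrite ler_pdivrMr//; lra.
rewrite mul1r ler_wpM2l// (le_trans _ (expR_ge1Dx _))//.
by rewrite lerDr.
Qed.

End BlockWeights.

(** * Growth of permanents of sampled densities *)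

Section PermanentLimit.
Context {R : realType}.

Definition grid_permanent (g : R * R -> R) n : R :=
  \sum_(p : 'S_n) \prod_(i < n) expR (g (i.+1%:R / n%:R, (p i).+1%:R / n%:R)).

Lemma grid_permanent_gt0 g n : 0 < grid_permanent g n.
Proof.
rewrite /grid_permanent (bigD1 1%g)//= ltr_pwDl//.
  by apply: prodr_gt0 => i _; exact: expR_gt0.
by apply: sumr_ge0 => p _; apply: prodr_ge0 => i _; exact: expR_ge0.
Qed.

Lemma block_weight0 n k (i : 'I_n) (b : 'I_k.+1) : block_weight (fun=> 0 : R) i b = 1.
Proof.
rewrite /block_weight (@eq_avg _ _ (cell k.+1 b)) ?avg_cell ?divff//.
by move=> y; rewrite expR0 mul1r.
Qed.

(** For a density with uniform marginals the permanent behaves like that of the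
constant density: both are compared with the number of permutations that respect
the blocks of columns. *)
Lemma grid_permanent_limit (g : R * R -> R) : buc g ->
  (forall x, avg (fun y => expR (g (x, y))) = 1) ->
  (forall y, avg (fun x => expR (g (x, y))) = 1) ->
  n%:R^-1 * (ln (grid_permanent g n) - ln (n`!%:R)) @[n --> \oo] --> (0 : R).
Proof.
move=> bg g_row g_col; have [M M0 gM] := buc_bound bg.
apply/cvgrPdist_le => /= e e0.
(* First the number of blocks is chosen from the modulus of continuity, then
   the proportion 1 / q of removed sites, whose cost grows with the number of
   blocks, and n last. *)
pose eta := e / 3; have eta0 : 0 < eta by rewrite divr_gt0.
have [_ /(_ _ eta0)[d d0 gd]] := bg.
have geta x y y' : `|y - y'| < d -> `|g (x, y) - g (x, y')| <= eta.
  by move=> yd; apply: gd; split => //=; exact: ballxx.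
have d2 : 0 < d / 2 by rewrite divr_gt0.
have [k kd] : exists k, k.+1%:R^-1 < d / 2.
  by have [k] := @ltr_add_invr R 0 _ d2; rewrite add0r => ?; exists k.
pose L := ln (k.+1%:R : R).
have L0 : 0 <= L by rewrite ln_ge0// ler1n.
have [q0 q0P] := nat_above ((M + L) / eta).
pose q := q0.+1.
have qP : (M + L) <= eta * q%:R.
  move: q0P; rewrite ler_pdivrMr// mulrC => /le_trans; apply.
  by rewrite ler_wpM2l ?(ltW eta0)// ler_nat.
have [N1 N1P] := block_permanent_ge bg g_row g_col gM k (ltn0Sn q0) (ltW M0).
have z_row (x : R) : avg (fun y : R => expR ((fun=> 0 : R) (x, y))) = 1.
  by rewrite expR0 avg_cst.
have z_col (y : R) : avg (fun x : R => expR ((fun=> 0 : R) (x, y))) = 1.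
  by rewrite expR0 avg_cst.
have z0 (p : R * R) : `|(fun=> 0 : R) p| <= 0 by rewrite normr0.
have [N2 N2P] := block_permanent_ge (buc_cst 0) z_row z_col z0 k (ltn0Sn q0) (lexx 0).
have [N3 N3P] := nat_above (ln 2 / eta + 2 / d + 1).
exists (N1 + N2 + N3 + 1)%N => // n /= Nn.
have n0 : (0 < n)%N by clear -Nn; lia.
have n0' : (0 : R) < n%:R by rewrite ltr0n.
have nN3 : ln 2 / eta + 2 / d + 1 <= n%:R.
  by apply: (le_trans N3P); rewrite ler_nat; clear -Nn; lia.
have ln20 : 0 <= ln 2 :> R by rewrite ln_ge0// ler1n.
have knd : k.+1%:R^-1 + n%:R^-1 < d.
  rewrite [ltRHS](splitr d) ltrD//.
  rewrite -[ltRHS]invrK ltf_pV2 ?posrE ?invr_gt0// invf_div.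
  by have : 0 <= ln 2 / eta by [rewrite divr_ge0// ltW]; move: nN3; clear; lra.
pose s : R := #|col_stab (block (n := n) k)|%:R.
pose P := \sum_(p : 'S_n) \prod_i block_weight g i (block k (p i)).
have wge0 i b : 0 <= block_weight g (n := n) (k := k) i b.
  by rewrite (le_trans _ (block_weight_ge bg gM _ _))// expR_ge0.
have s0 : 0 < s.
  rewrite ltr0n; apply/card_gt0P; exists 1%g; apply/followsP => i _.
  by rewrite perm1.
set m := (n %/ q)%N.
have mq : m%:R * (M + L) <= n%:R * eta.
  rewrite (le_trans (ler_wpM2l _ qP))// mulrCA mulrC ler_wpM2r ?(ltW eta0)//.
  by rewrite -natrM ler_nat leq_trunc_div.
have Pn0 : 0 < n`!%:R :> R by rewrite ltr0n fact_gt0.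
have K0 : (0 : R) < k.+1%:R by rewrite ltr0n.
have lnX j (x : R) : 0 < x -> ln (x ^+ j) = j%:R * ln x by move=> x0; rewrite lnXn// mulr_natl.
have facE : n`!%:R = \sum_(p : 'S_n) \prod_i block_weight (fun=> 0 : R) i (block k (p i)).
  rewrite (eq_bigr (fun=> 1)); last first.
    by move=> p _; apply: big1 => i _; exact: block_weight0.
  by rewrite sumr_const card_Sn.
have fac_le : ln n`!%:R <= ln s + n%:R * L.
  rewrite -lnX// -lnM ?posrE ?exprn_gt0// ler_ln ?posrE ?mulr_gt0 ?exprn_gt0//.
  rewrite facE (le_trans (coloured_permanent_le _ _))//.
    by move=> i b; rewrite block_weight0.
  rewrite (eq_bigr (fun=> k.+1%:R)) ?prodr_const ?card_ord// => i _.
  exact: (block_weight_row (buc_cst 0) z_row).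
have fac_ge : ln s + (n%:R - m%:R) * L - ln 2 <= ln n`!%:R.
  have := N2P n (ltac:(clear -Nn; lia)); rewrite -facE oppr0 expR0 expr1n mul1r -/s -/m.
  rewrite -natrB ?leq_div// -lnX// -[ln _ + ln _]lnM ?posrE ?exprn_gt0//.
  rewrite -ln_div ?posrE ?mulr_gt0 ?exprn_gt0// ler_ln ?posrE ?divr_gt0 ?mulr_gt0 ?exprn_gt0//.
  by rewrite mulrA.
have P0 : 0 < P.
  apply: lt_le_trans (N1P n (ltac:(clear -Nn; lia))).
  by rewrite mulr_gt0 ?exprn_gt0 ?expR_gt0// mulr_gt0// divr_gt0// exprn_gt0.
have P_le : ln P <= ln s + n%:R * L.
  rewrite -lnX// -lnM ?posrE ?exprn_gt0// ler_ln ?posrE ?mulr_gt0 ?exprn_gt0//.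
  rewrite (le_trans (coloured_permanent_le _ wge0))//.
  rewrite (eq_bigr (fun=> k.+1%:R)) ?prodr_const ?card_ord// => i _.
  exact: (block_weight_row bg g_row).
have P_ge : ln s + (n%:R - m%:R) * L - ln 2 - m%:R * M <= ln P.
  have := N1P n (ltac:(clear -Nn; lia)); rewrite -/s -/m -/P.
  rewrite -ler_ln ?posrE//; last first.
    by rewrite mulr_gt0 ?exprn_gt0 ?expR_gt0// mulr_gt0// divr_gt0// exprn_gt0.
  rewrite lnM ?posrE ?exprn_gt0 ?expR_gt0//; last by rewrite mulr_gt0// divr_gt0// exprn_gt0.
  rewrite lnX ?expR_gt0// expRK lnM ?posrE ?divr_gt0 ?exprn_gt0//.
  rewrite ln_div ?posrE ?exprn_gt0// lnX// natrB ?leq_div//.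
  by move=> /(le_trans _); apply; rewrite -/L; clear; lra.
set G := grid_permanent g n.
have G0 : 0 < G by exact: grid_permanent_gt0.
have nearP i (p : 'S_n) := block_weight_near bg i (p i) geta knd.
have GP : ln G <= n%:R * eta + ln P.
  have -> : n%:R * eta = ln (expR eta ^+ n) by rewrite lnX ?expR_gt0// expRK.
  rewrite -lnM ?posrE ?exprn_gt0 ?expR_gt0// ler_ln ?posrE ?mulr_gt0 ?exprn_gt0 ?expR_gt0//.
  rewrite /P mulr_sumr; apply: ler_sum => p _.
  rewrite -[X in _ ^+ X]card_ord -prodr_const -big_split/=.
  by apply: ler_prod => i _; rewrite expR_ge0/=; have [] := nearP i p.
have PG : ln P <= n%:R * eta + ln G.
  have -> : n%:R * eta = ln (expR eta ^+ n) by rewrite lnX ?expR_gt0// expRK.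
  rewrite -lnM ?posrE ?exprn_gt0 ?expR_gt0// ler_ln ?posrE ?mulr_gt0 ?exprn_gt0 ?expR_gt0//.
  rewrite /G mulr_sumr; apply: ler_sum => p _.
  rewrite -[X in _ ^+ X]card_ord -prodr_const -big_split/=.
  by apply: ler_prod => i _; rewrite wge0/=; have [] := nearP i p.
have ln2n : ln 2 <= n%:R * eta.
  rewrite mulrC -ler_pdivrMl// mulrC.
  by have : 0 <= 2 / d by [rewrite divr_ge0// ltW]; move: nN3; clear; lra.
have mM : 0 <= m%:R * M by rewrite mulr_ge0// ltW.
have mL : 0 <= m%:R * L by rewrite mulr_ge0.
have en : n%:R * eta *+ 3 = n%:R * e by rewrite /eta; field.
rewrite sub0r normrN normrM gtr0_norm ?invr_gt0// mulrC ler_pdivrMr// mulrC.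
move: fac_le fac_ge P_le P_ge GP PG mq ln2n mM mL en; clear => *.
by rewrite ler_norml; apply/andP; split; lra.
Qed.

End PermanentLimit.

(** * Contraction of the alternating scalings *)

Section Inverses.
Context {R : realType} {T : pseudoMetricType R}.
Implicit Types (g h : T -> R) (m : R).

Lemma buc_inv h m : 0 < m -> (forall x, m <= h x) -> buc h -> buc (fun x => (h x)^-1).
Proof.
move=> m0 mh bh; have h0 x : 0 < h x by exact: lt_le_trans (mh x).
split.
  exists m^-1 => x; rewrite ger0_norm ?invr_ge0 ?(ltW (h0 x))//.
  by rewrite lef_pV2 ?posrE.
move=> e e0; have em : 0 < e * m ^+ 2 by rewrite mulr_gt0// exprn_gt0.
have [_ /(_ _ em)[d d0 hd]] := bh; exists d => // x y xy.
have -> : (h x)^-1 - (h y)^-1 = (h y - h x) / (h x * h y).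
  by field; rewrite !gt_eqF.
rewrite normrM normfV distrC ler_pdivrMr ?normr_gt0 ?mulf_neq0 ?gt_eqF//.
rewrite (le_trans (hd _ _ xy))// ler_wpM2l ?(ltW e0)//.
by rewrite gtr0_norm ?mulr_gt0// expr2 ler_pM// ltW.
Qed.

Lemma buc_ln h m : 0 < m -> (forall x, m <= h x) -> buc h -> buc (fun x => ln (h x)).
Proof.
move=> m0 mh bh; have h0 x : 0 < h x by exact: lt_le_trans (mh x).
have [M M0 hM] := buc_bound bh.
have hM' x : h x <= M by rewrite (le_trans (ler_norm _)).
split.
  exists (`|ln m| + `|ln M|) => x.
  have l1 : ln m <= ln (h x) by rewrite ler_ln ?posrE.
  have l2 : ln (h x) <= ln M by rewrite ler_ln ?posrE.
  have := ler_norm (ln M); have := ler_norm (- ln m); rewrite normrN.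
  have := normr_ge0 (ln M); have := normr_ge0 (ln m).
  by rewrite ler_norml => *; apply/andP; split; lra.
move=> e e0; have em : 0 < e * m by rewrite mulr_gt0.
have [_ /(_ _ em)[d d0 hd]] := bh; exists d => //.
have one_sided x y : ball x d y -> ln (h x) - ln (h y) <= e.
  move=> xy; rewrite -ln_div ?posrE//.
  have -> : h x / h y = 1 + (h x - h y) / h y by field; rewrite gt_eqF.
  have hxy : (h x - h y) / h y <= e.
    rewrite ler_pdivrMr// (le_trans (ler_norm _))// (le_trans (hd _ _ xy))//.
    by rewrite ler_wpM2l// ltW.
  rewrite (le_trans _ hxy)// le_ln1Dx// ltr_pdivlMr// mulN1r.
  by have := h0 x; lra.
move=> x y xy; rewrite ler_norml one_sided// andbT lerNl opprB.
by rewrite one_sided//; exact: ball_sym.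
Qed.

Lemma buc_limit g : (forall e : R, 0 < e -> exists2 h, buc h & forall x, `|h x - g x| <= e) ->
  buc g.
Proof.
move=> gl; split.
  have [h bh hg] := gl 1 ltr01; have [M M0 hM] := buc_bound bh.
  exists (M + 1) => x; have -> : g x = h x - (h x - g x) by ring.
  by rewrite (le_trans (ler_normB _ _))// lerD.
move=> e e0; have e3 : 0 < e / 3 by rewrite divr_gt0.
have [h bh hg] := gl _ e3; have [_ /(_ _ e3)[d d0 hd]] := bh.
exists d => // x y xy.
have -> : g x - g y = (h x - h y) - (h x - g x) + (h y - g y) by ring.
rewrite (le_trans (ler_normD _ _))// (_ : e = e / 3 + e / 3 + e / 3); last by field.
rewrite lerD// (le_trans (ler_normB _ _))// lerD//; exact: hd.
Qed.

End Inverses.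

Section GeometricSequences.
Context {R : realType}.

(** The sequences [u n + C * q ^+ n] and [u n - C * q ^+ n] are monotone and
enclose the limit. *)
Lemma geometric_limit (u : nat -> R) (C q : R) : 0 <= C -> 0 <= q < 1 ->
  (forall n, `|u n.+1 - u n| <= C * q ^+ n * (1 - q)) ->
  exists l, forall n, `|u n - l| <= C * q ^+ n.
Proof.
move=> C0 /andP[q0 q1] uC.
have qn n : 0 <= q ^+ n by exact: exprn_ge0.
pose v n := u n + C * q ^+ n; pose w n := u n - C * q ^+ n.
have step n : v n.+1 <= v n /\ w n <= w n.+1.
  have := uC n; rewrite ler_norml => /andP[H1 H2]; rewrite /v /w exprSr; split; lra.
have mon n m : v (n + m)%N <= v n /\ w n <= w (n + m)%N.
  elim: m => [|m [IH1 IH2]]; first by rewrite addn0.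
  rewrite addnS; have [S1 S2] := step (n + m)%N; split; [exact: le_trans S1 IH1|exact: le_trans IH2 S2].
have wv n m : w n <= v m.
  have [_ H1] := mon n m; have [H2 _] := mon m n.
  rewrite (le_trans H1)// (le_trans _ H2)// addnC /v /w.
  by have := mulr_ge0 C0 (qn (m + n)%N); lra.
pose A : set R := [set v n | n in setT].
exists (inf A) => n.
have l1 : inf A <= v n by apply: ge_inf; [exists (w 0%N) => _ [m _ <-]|exists n].
have l2 : w n <= inf A by apply: lb_le_inf; [exists (v 0%N), 0%N|move=> _ [m _ <-]].
by move: l1 l2; rewrite /v /w ler_norml => l1 l2; apply/andP; split; lra.
Qed.

Lemma le0_geometric (a C q : R) : 0 <= q < 1 -> (forall n, a <= C * q ^+ n) -> a <= 0.
Proof.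
move=> /andP[q0 q1] aC.
have : C * q ^+ n @[n --> \oo] --> C * 0.
  by apply: cvgMr; apply: cvg_expr; rewrite ger0_norm.
rewrite mulr0 => cv; apply: (ler_cvg_to (cvg_cst a) cv).
by near=> n; exact: aC.
Unshelve. all: end_near. Qed.

End GeometricSequences.

Section HalfScaling.
Context {R : realType}.
Implicit Types (G : R * R -> R) (phi : R -> R) (t m : R).

(** The scaling of the rows that gives the kernel [expR G], weighted by [phi],
unit row averages. *)
Definition row_scale G phi (x : R) : R := (avg (fun y => expR (G (x, y)) * phi y))^-1.

(** Closeness in Hilbert's projective metric: the quotient of the two functions
varies at most by the factor [1 + t]. *)
Definition near_proj t phi phi' : Prop :=
  exists2 c : R, 0 < c & forall x, c * phi x <= phi' x <= c * (1 + t) * phi x.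

Lemma near_projZ t (a b : R) phi phi' : 0 < a -> 0 < b -> near_proj t phi phi' ->
  near_proj t (fun x => a * phi x) (fun x => b * phi' x).
Proof.
move=> a0 b0 [c c0 H]; exists (b * c / a); first by rewrite divr_gt0// mulr_gt0.
move=> x; have /andP[H1 H2] := H x.
have -> : b * c / a * (a * phi x) = b * (c * phi x) by field; rewrite gt_eqF.
have -> : b * c / a * (1 + t) * (a * phi x) = b * (c * (1 + t) * phi x) by field; rewrite gt_eqF.
by rewrite !ler_pM2l// H1.
Qed.

(** Normalising at a point turns projective closeness into uniform closeness. *)
Lemma near_proj_normalised t phi phi' (x0 : R) : 0 <= t -> phi x0 = 1 -> phi' x0 = 1 ->
  (forall x, 0 < phi x) -> near_proj t phi phi' -> forall x, `|phi' x - phi x| <= t * phi x.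
Proof.
move=> t0 p1 p1' p0 [c c0 H] x.
have := H x0; rewrite p1 p1' !mulr1 => /andP[c1 c2].
have /andP[H1 H2] := H x; have px := p0 x.
have U : phi' x <= (1 + t) * phi x.
  by rewrite (le_trans H2)// ler_wpM2r ?(ltW px)// ler_piMl// addr_ge0.
have L : (1 - t) * phi x <= phi' x.
  rewrite (le_trans _ H1)// ler_wpM2r ?(ltW px)//.
  have : 0 <= t * t by rewrite mulr_ge0.
  nra.
by rewrite ler_norml; apply/andP; split; lra.
Qed.

Variable G : R * R -> R.
Variable M : R.
Hypothesis bG : buc G.
Hypothesis GM : forall p, `|G p| <= M.

Let KM p : expR (- M) <= expR (G p) <= expR M.
Proof. by rewrite !ler_expR; have := GM p; rewrite ler_norml. Qed.

Let bK phi x : buc phi -> bm (fun y => expR (G (x, y)) * phi y).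
Proof.
by move=> bp; apply: buc_bm; apply: bucM => //; exact: (buc_slice1 x (buc_expR bG)).
Qed.

Lemma kernel_avg_bounds phi x : buc phi -> (forall y, 0 <= phi y) ->
  expR (- M) * avg phi <= avg (fun y => expR (G (x, y)) * phi y) <= expR M * avg phi.
Proof.
move=> bp p0; have bmp := buc_bm bp; rewrite -!avgZ//.
by apply/andP; split; apply: le_avg => //; [exact: bmZ|exact: bK| |exact: bK|exact: bmZ|];
  move=> y; rewrite ler_wpM2r//; have /andP[] := KM (x, y).
Qed.

Lemma avg_gt0 phi m : buc phi -> 0 < m -> (forall x, m <= phi x) -> m <= avg phi.
Proof.
by move=> bp m0 mp; rewrite -(avg_cst m); apply: le_avg => //; [exact: bm_cst|exact: buc_bm].
Qed.

Lemma kernel_avg_ge phi m x : buc phi -> 0 < m -> (forall x, m <= phi x) ->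
  expR (- M) * m <= avg (fun y => expR (G (x, y)) * phi y).
Proof.
move=> bp m0 mp.
have /andP[H _] := kernel_avg_bounds x bp (fun y => le_trans (ltW m0) (mp y)).
by rewrite (le_trans _ H)// ler_wpM2l ?expR_ge0//; exact: avg_gt0.
Qed.

Lemma row_scale_gt0 phi m x : buc phi -> 0 < m -> (forall x, m <= phi x) -> 0 < row_scale G phi x.
Proof.
move=> bp m0 mp; rewrite invr_gt0 (lt_le_trans _ (kernel_avg_ge x bp m0 mp))//.
by rewrite mulr_gt0 ?expR_gt0.
Qed.

Lemma buc_row_scale phi m : buc phi -> 0 < m -> (forall x, m <= phi x) -> buc (row_scale G phi).
Proof.
move=> bp m0 mp; apply: (@buc_inv _ _ _ (expR (- M) * m)).
- by rewrite mulr_gt0 ?expR_gt0.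
- by move=> x; exact: kernel_avg_ge.
- apply: (@buc_avg _ (fun p => expR (G p) * phi p.2)).
  by apply: bucM; [exact: buc_expR|exact: buc_snd].
Qed.

Lemma row_scale_bounds phi m (B : R) x : buc phi -> 0 < m -> (forall x, m <= phi x <= B) ->
  expR (- M) / B <= row_scale G phi x <= expR M / m.
Proof.
move=> bp m0 mB; have mp y : m <= phi y by have /andP[] := mB y.
have B0 : 0 < B by have /andP[H1 H2] := mB 0; rewrite (lt_le_trans m0)// (le_trans H1).
have := kernel_avg_ge x bp m0 mp.
have /andP[_ +] := kernel_avg_bounds x bp (fun y => le_trans (ltW m0) (mp y)).
have aB : avg phi <= B.
  by rewrite -(avg_cst B); apply: le_avg => [||y]; [exact: buc_bm|exact: bm_cst|have /andP[] := mB y].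
rewrite /row_scale; set I := avg _ => H1 H2.
have I0 : 0 < I by rewrite (lt_le_trans _ H2)// mulr_gt0// expR_gt0.
have IB : I <= expR M * B by rewrite (le_trans H1)// ler_wpM2l// expR_ge0.
apply/andP; split.
  by rewrite expRN -invfM lef_pV2 ?posrE ?mulr_gt0 ?expR_gt0.
rewrite -[leRHS]invrK lef_pV2 ?posrE ?invr_gt0 ?divr_gt0 ?expR_gt0//.
by rewrite invf_div -expRN mulrC.
Qed.

(** All rows of the kernel are proportional up to the factor [expR (2 * M)], so
the averages of the quotient over two rows share a fraction of their mass. *)
Lemma row_scale_contracts t phi phi' m : buc phi -> buc phi' -> 0 < m ->
  (forall x, m <= phi x) -> 0 <= t -> near_proj t phi phi' ->
  near_proj ((1 - expR (- (2 * M))) * t) (row_scale G phi') (row_scale G phi).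
Proof.
move=> bp bp' m0 mp t0 [c c0 H].
set eps := expR (- (2 * M)).
have p0 x : 0 <= phi x by rewrite (le_trans _ (mp x))// ltW.
pose v y := phi' y - c * phi y.
pose z y := c * (1 + t) * phi y - phi' y.
have bv : buc v by apply: bucB => //; exact: bucZ.
have bz : buc z by apply: bucB => //; exact: bucZ.
have v0 y : 0 <= v y by have /andP[] := H y; rewrite /v; lra.
have z0 y : 0 <= z y by have /andP[] := H y; rewrite /z; lra.
have aphi0 : 0 < avg phi by rewrite (lt_le_trans m0)//; exact: avg_gt0.
pose A := avg v / avg phi.
have A0 : 0 <= A by rewrite divr_ge0 ?avg_ge0// ltW.
have az : avg z / avg phi = c * t - A.
  rewrite /A /z /v !avgB ?avgZ; try by [exact: buc_bm|apply: bmZ; exact: buc_bm].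
  by field; rewrite gt_eqF.
pose I psi x := avg (fun y => expR (G (x, y)) * psi y).
have I0 x : 0 < I phi x.
  by rewrite (lt_le_trans _ (kernel_avg_ge x bp m0 mp))// mulr_gt0// expR_gt0.
have low psi x : buc psi -> (forall y, 0 <= psi y) -> eps * (avg psi / avg phi) * I phi x <= I psi x.
  move=> bpsi psi0.
  have /andP[H1 _] := kernel_avg_bounds x bpsi psi0.
  have /andP[_ H2] := kernel_avg_bounds x bp p0.
  rewrite (le_trans _ H1)//.
  have -> : expR (- M) * avg psi = eps * (avg psi / avg phi) * (expR M * avg phi).
    rewrite (_ : eps * (avg psi / avg phi) * (expR M * avg phi) = (eps * expR M) * avg psi).
      by rewrite /eps -expRD; congr (expR _ * _); ring.
    by field; rewrite gt_eqF.
  by rewrite ler_wpM2l// mulr_ge0 ?expR_ge0// divr_ge0 ?avg_ge0// ltW.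
have Lv := fun x => low v x bv v0.
have Lz := fun x => low z x bz z0.
have Iv x : I v x = I phi' x - c * I phi x.
  rewrite /I -avgZ; last exact: bK.
  rewrite -avgB; [|exact: bK|apply: bmZ; exact: bK].
  by apply: eq_avg => y; rewrite /v; ring.
have Iz x : I z x = c * (1 + t) * I phi x - I phi' x.
  rewrite /I -avgZ; last exact: bK.
  rewrite -avgB; [|apply: bmZ; exact: bK|exact: bK].
  by apply: eq_avg => y; rewrite /z; ring.
exists (c + eps * A); first by rewrite ltr_pwDl// mulr_ge0// expR_ge0.
move=> x; rewrite /row_scale -/(I phi x) -/(I phi' x).
have eps0 : 0 < eps by exact: expR_gt0.
have M0 : 0 <= M by rewrite (le_trans _ (GM (0, 0))).
have eps1 : eps <= 1 by rewrite -expR0 ler_expR oppr_le0 mulr_ge0.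
have I'0 : 0 < I phi' x.
  have := Lv x; rewrite Iv -/A => Lx.
  have : 0 <= eps * A * I phi x by exact: mulr_ge0 (mulr_ge0 (ltW eps0) A0) (ltW (I0 x)).
  have : 0 < c * I phi x by rewrite mulr_gt0.
  lra.
have := Lv x; have := Lz x; rewrite az Iv Iz -/A => L1 L2.
have lowE a : (a * (I phi' x)^-1 <= (I phi x)^-1) = (a * I phi x <= I phi' x).
  by rewrite ler_pdivrMr// mulrC ler_pdivlMr.
have highE a : ((I phi x)^-1 <= a * (I phi' x)^-1) = (I phi' x <= a * I phi x).
  by rewrite ler_pdivlMr// mulrC ler_pdivrMr.
rewrite lowE highE.
apply/andP; split; first lra.
have : 0 <= eps * A * ((1 - eps) * t) * I phi x.
  have H1 : 0 <= (1 - eps) * t by rewrite mulr_ge0// subr_ge0.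
  exact: mulr_ge0 (mulr_ge0 (mulr_ge0 (ltW eps0) A0) H1) (ltW (I0 x)).
lra.
Qed.

Lemma row_scale_lipschitz phi phi' m (d : R) : buc phi -> buc phi' -> 0 < m ->
  (forall x, m <= phi x) -> (forall x, m <= phi' x) ->
  (forall x, `|phi x - phi' x| <= d) ->
  forall x, `|row_scale G phi x - row_scale G phi' x| <= expR M / (expR (- M) * m) ^+ 2 * d.
Proof.
move=> bp bp' m0 mp mp' dp x.
have := kernel_avg_ge x bp m0 mp; have := kernel_avg_ge x bp' m0 mp'.
rewrite /row_scale; set J := avg _; set I := avg _; set k := expR (- M) * m => kJ kI.
have k0 : 0 < k by rewrite mulr_gt0// expR_gt0.
have J0 : 0 < J by exact: lt_le_trans kJ.
have I0 : 0 < I by exact: lt_le_trans kI.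
have IJ : `|I - J| <= expR M * d.
  apply: norm_avgB_le => [||y]; [exact: bK..|].
  rewrite -mulrBr normrM ger0_norm ?expR_ge0// ler_pM ?expR_ge0//.
  by have /andP[] := KM (x, y).
have -> : I^-1 - J^-1 = (J - I) / (I * J) by field; rewrite !gt_eqF.
rewrite normrM normfV distrC ler_pdivrMr ?normr_gt0 ?mulf_neq0 ?gt_eqF//.
rewrite (gtr0_norm (mulr_gt0 I0 J0)) (le_trans IJ)//.
have -> : expR M / k ^+ 2 * d * (I * J) = (expR M * d) * ((I * J) / k ^+ 2).
  by field; rewrite gt_eqF.
rewrite ler_peMr ?(le_trans _ IJ)// ler_pdivlMr ?exprn_gt0// mul1r expr2.
by rewrite ler_pM// ltW.
Qed.

End HalfScaling.

(** * Schroedinger potentials *)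

Section Schroedinger.
Context {R : realType}.
Variables (G : R * R -> R) (M : R).
Hypothesis bG : buc G.
Hypothesis GM : forall p, `|G p| <= M.

Lemma row_scale_ratio (phi : R -> R) (m x x' : R) : buc phi -> 0 < m -> (forall y, m <= phi y) ->
  row_scale G phi x <= expR (2 * M) * row_scale G phi x'.
Proof.
move=> bp m0 mp.
have p0 y : 0 <= phi y by rewrite (le_trans (ltW m0)).
have /andP[H1 _] := kernel_avg_bounds bG GM x bp p0.
have /andP[_ H2] := kernel_avg_bounds bG GM x' bp p0.
have := kernel_avg_ge bG GM x bp m0 mp; have := kernel_avg_ge bG GM x' bp m0 mp.
rewrite /row_scale; move: H1 H2; set I := avg (fun y => expR (G (x, y)) * _).
set J := avg (fun y => expR (G (x', y)) * _) => H1 H2 J0 I0.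
have k0 : 0 < expR (- M) * m by rewrite mulr_gt0// expR_gt0.
have {}J0 : 0 < J by exact: lt_le_trans J0.
have {}I0 : 0 < I by exact: lt_le_trans I0.
rewrite ler_pdivlMr// mulrC ler_pdivrMr//.
rewrite (le_trans H2)// (le_trans _ (ler_wpM2l (expR_ge0 _) H1))//.
by rewrite mulrA -expRD le_eqVlt; apply/orP; left; apply/eqP; congr (expR _ * _); ring.
Qed.

End Schroedinger.

Section SchroedingerExistence.
Context {R : realType}.
Variables (G : R * R -> R) (M : R).
Hypothesis bG : buc G.
Hypothesis GM : forall p, `|G p| <= M.

Let Gt (p : R * R) : R := G (p.2, p.1).
Let bGt : buc Gt. Proof. exact: buc_swap. Qed.
Let GtM p : `|Gt p| <= M. Proof. exact: GM. Qed.
Let M0 : 0 <= M. Proof. by rewrite (le_trans _ (GM (0, 0))). Qed.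
Let eps := expR (- (2 * M)).
Let eps0 : 0 < eps. Proof. exact: expR_gt0. Qed.
Let eps1 : eps <= 1. Proof. by rewrite -expR0 ler_expR oppr_le0 mulr_ge0. Qed.
Let epsV : expR (2 * M) = eps^-1. Proof. by rewrite /eps -expRN opprK. Qed.
Let q := 1 - eps.
Let q01 : 0 <= q < 1. Proof. by rewrite /q subr_ge0 eps1/= gtrBl. Qed.

Let good (phi : R -> R) := buc phi /\ forall x, eps <= phi x <= eps^-1.
(* One round of alternating scaling. It is homogeneous of degree one, so that the
   normalisation N at the point 0 loses nothing. *)
Let Q (phi : R -> R) := row_scale Gt (row_scale G phi).
Let N (phi : R -> R) x := (Q phi 0)^-1 * Q phi x.

Let k := expR (- M) / eps^-1.
Let k_gt0 : 0 < k. Proof. by rewrite divr_gt0 ?expR_gt0// invr_gt0. Qed.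

Let good_row_scale phi : good phi -> buc (row_scale G phi) /\ forall x, k <= row_scale G phi x.
Proof.
move=> [bp bnd]; have lo x : eps <= phi x by have /andP[] := bnd x.
split; first exact: buc_row_scale lo.
by move=> x; have /andP[] := row_scale_bounds bG GM x bp eps0 bnd.
Qed.

Let good_Q phi : good phi -> buc (Q phi) /\ forall x, 0 < Q phi x.
Proof.
move=> /good_row_scale[bh hk]; split; first exact: buc_row_scale hk.
by move=> x; exact: row_scale_gt0 hk.
Qed.

Let good_N phi : good phi -> good (N phi).
Proof.
move=> gp; have [bQ Q0] := good_Q gp; split; first exact: bucZ.
have [bh hk] := good_row_scale gp.
have ratio x y : Q phi x <= eps^-1 * Q phi y.
  by rewrite -epsV; exact: (row_scale_ratio bGt GtM _ _ bh k_gt0 hk).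
move=> x; rewrite /N; apply/andP; split.
  rewrite mulrC ler_pdivlMr//; have := ratio 0 x.
  by rewrite ler_pdivlMl.
by rewrite mulrC ler_pdivrMr.
Qed.

Let near_N t phi phi' : good phi -> good phi' -> 0 <= t -> near_proj t phi phi' ->
  near_proj (q * t) (N phi) (N phi').
Proof.
move=> gp gp' t0 H; have [bp bnd] := gp; have [bp' bnd'] := gp'.
have lo x : eps <= phi x by have /andP[] := bnd x.
have [bh hk] := good_row_scale gp; have [bh' hk'] := good_row_scale gp'.
have H1 := row_scale_contracts bG GM bp bp' eps0 lo t0 H.
have qt0 : 0 <= q * t by rewrite mulr_ge0//; case/andP: q01.
have [c c0 H2] := row_scale_contracts bGt GtM bh' bh k_gt0 hk' qt0 H1.
have [_ Q0] := good_Q gp; have [_ Q0'] := good_Q gp'.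
have iQ ph : good ph -> 0 < (Q ph 0)^-1.
  by move=> /good_Q[_ H0]; have := H0 0; rewrite -(invr_gt0 (Q ph 0)).
apply: (near_projZ (phi := Q phi) (phi' := Q phi') (iQ _ gp) (iQ _ gp')).
exists c => // x; have /andP[H3 H4] := H2 x.
rewrite H3/= (le_trans H4)// ler_wpM2r ?(ltW (Q0 x))// ler_wpM2l ?(ltW c0)//.
by rewrite lerD2l -/q -/eps ler_piMl// gerBl ltW.
Qed.

Let phi_ n : R -> R := iter n N (fun=> 1).

Let good_phi n : good (phi_ n).
Proof.
elim: n => [|n IH]; last exact: good_N.
split; first exact: buc_cst.
by move=> x; rewrite eps1 invf_ge1.
Qed.

Let phi0 n : phi_ n 0 = 1.
Proof.
case: n => [//|n]; rewrite /phi_ /= /N mulVf// gt_eqF//.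
by have [_] := good_Q (good_phi n).
Qed.

Let near_phi n : near_proj (q ^+ n * (eps^-1 * eps^-1)) (phi_ n) (phi_ n.+1).
Proof.
have q0 : 0 <= q by case/andP: q01.
elim: n => [|n IH]; last first.
  rewrite exprS -mulrA; apply: (near_N (good_phi n) (good_phi n.+1) _ IH).
  by rewrite !mulr_ge0 ?exprn_ge0 ?invr_ge0// ltW.
exists eps => // x; have [_ /(_ x)/andP[H1 H2]] := good_phi 1.
rewrite [phi_ 0]/phi_ /= !mulr1 H1/= (le_trans H2)//.
by rewrite mul1r mulrDr mulr1 mulrA divff ?gt_eqF// mul1r lerDr ltW.
Qed.

Let C := eps^-1 * eps^-1 * eps^-1 * eps^-1.

Let phi_lim : exists phi : R -> R, forall x n, `|phi_ n x - phi x| <= C * q ^+ n.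
Proof.
have q0 : 0 <= q by case/andP: q01.
have H x : exists l : R, forall n, `|phi_ n x - l| <= C * q ^+ n.
  apply: geometric_limit => //; first by rewrite !mulr_ge0// invr_ge0 ltW.
  move=> n; have [bp bnd] := good_phi n.
  have p0 y : 0 < phi_ n y by have /andP[H _] := bnd y; exact: lt_le_trans H.
  have t0 : 0 <= q ^+ n * (eps^-1 * eps^-1).
    by rewrite !mulr_ge0 ?exprn_ge0// invr_ge0 ltW.
  have := near_proj_normalised t0 (phi0 n) (phi0 n.+1) p0 (near_phi n) x.
  move=> /le_trans; apply.
  have -> : C * q ^+ n * (1 - q) = q ^+ n * (eps^-1 * eps^-1) * eps^-1.
    by rewrite /C /q; field; rewrite gt_eqF.
  by rewrite ler_wpM2l//; have /andP[] := bnd x.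
by have [phi phiP] := choice H; exists phi.
Qed.

(** The normalised iterates converge geometrically, and the limit is fixed by a
round of scaling up to a factor [lam]. Both ways of integrating the scaled kernel
give [lam = 1]. *)
Lemma schroedinger_scaling : exists2 phi : R -> R,
  buc phi /\ (exists2 m : R, 0 < m & forall x, m <= phi x) &
  (forall y, phi y * avg (fun x => expR (G (x, y)) * row_scale G phi x) = 1).
Proof.
have q0 : 0 <= q by case/andP: q01.
have C0 : 0 <= C by rewrite !mulr_ge0// invr_ge0 ltW.
have [phi phiP] := phi_lim.
have gphi : good phi.
  split.
    apply: buc_limit => e e0.
    have [n nP] : exists n, C * q ^+ n <= e.
      apply: contrapT => /forallNP H; have : e <= 0.
        by apply: (le0_geometric q01 (C := C)) => n; have := H n => /negP; rewrite -ltNge => /ltW.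
      by rewrite leNgt e0.
    by exists (phi_ n); [case: (good_phi n)|move=> x; exact: le_trans (phiP x n) nP].
  move=> x; apply/andP; split; rewrite -subr_le0; apply: (le0_geometric q01 (C := C)) => n;
    have := phiP x n; have [_ /(_ x)/andP[]] := good_phi n;
    rewrite ler_norml => H1 H2 /andP[]; lra.
have [bp bnd] := gphi.
have lo x : eps <= phi x by have /andP[] := bnd x.
have [bh hk] := good_row_scale gphi.
pose L1 := expR M / (expR (- M) * eps) ^+ 2.
pose L2 := expR M / (expR (- M) * k) ^+ 2.
have lipQ n x : `|Q (phi_ n) x - Q phi x| <= L2 * (L1 * (C * q ^+ n)).
  have [bpn bndn] := good_phi n.
  have lon y : eps <= phi_ n y by have /andP[] := bndn y.
  have [bhn hkn] := good_row_scale (good_phi n).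
  apply: (row_scale_lipschitz bGt GtM bhn bh k_gt0 hkn hk) => y.
  by apply: (row_scale_lipschitz bG GM bpn bp eps0 lon lo) => z; exact: phiP.
have L10 : 0 <= L1 by rewrite divr_ge0 ?expR_ge0 ?sqr_ge0.
have L20 : 0 <= L2 by rewrite divr_ge0 ?expR_ge0 ?sqr_ge0.
have [bQ Q0] := good_Q gphi.
pose lam := Q phi 0.
have fixed x : phi x * lam = Q phi x.
  apply/eqP; rewrite -subr_eq0 -normr_le0.
  apply: (le0_geometric q01 (C := C * lam + eps^-1 * (L2 * (L1 * C)) + L2 * (L1 * C))) => n.
  have E : phi_ n.+1 x * Q (phi_ n) 0 = Q (phi_ n) x.
    rewrite /phi_ /= /N mulrC mulrA divff ?mul1r// gt_eqF//.
    by have [_] := good_Q (good_phi n).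
  have -> : phi x * lam - Q phi x = - ((phi_ n.+1 x - phi x) * lam)
     - phi_ n.+1 x * (Q (phi_ n) 0 - lam) + (Q (phi_ n) x - Q phi x) by rewrite -E; ring.
  have lam0 : 0 < lam by exact: Q0.
  have A1 : `|(phi_ n.+1 x - phi x) * lam| <= C * q ^+ n * lam.
    rewrite normrM (gtr0_norm lam0) ler_wpM2r ?(ltW lam0)// (le_trans (phiP _ _))//.
    by rewrite ler_wpM2l// exprS ler_piMl ?exprn_ge0// ltW//; case/andP: q01.
  have A2 : `|phi_ n.+1 x * (Q (phi_ n) 0 - lam)| <= eps^-1 * (L2 * (L1 * (C * q ^+ n))).
    rewrite normrM ler_pM//; have [_ /(_ x)/andP[H1 H2]] := good_phi n.+1.
    have p0 : 0 <= phi_ n.+1 x := le_trans (ltW eps0) H1.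
    by rewrite (ger0_norm p0); exact: H2.
  rewrite (le_trans (ler_normD _ _))// (le_trans (lerD (ler_normD _ _) (lipQ n x)))//.
  rewrite !normrN; move: A1 A2; set a1 := `|_|; set a2 := `|_| => A1 A2; lra.
have lam0 : 0 < lam by exact: Q0.
pose psi := row_scale G phi.
have rowE x : psi x * avg (fun y => expR (G (x, y)) * phi y) = 1.
  have := row_scale_gt0 bG GM x bp eps0 lo.
  by rewrite invr_gt0 => I0; rewrite /psi /row_scale mulVf// gt_eqF.
have colE y : phi y * avg (fun x => expR (G (x, y)) * psi x) = lam^-1.
  have := row_scale_gt0 bGt GtM y bh k_gt0 hk; rewrite invr_gt0 => I0.
  have := fixed y; rewrite /Q /row_scale -/psi => Ey.
  move: I0 Ey; rewrite /Gt/=; set J := avg _ => J0 Ey.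
  apply: (mulIf (lt0r_neq0 lam0)); rewrite mulVf ?gt_eqF// mulrAC.
  by rewrite Ey mulVf// gt_eqF.
have lam1 : lam = 1.
  apply: invr_inj; rewrite invr1.
  pose W (p : R * R) := expR (G p) * psi p.1 * phi p.2.
  have bW : buc W.
    by apply: bucM; [apply: bucM; [exact: buc_expR|exact: buc_fst]|exact: buc_snd].
  have := avg_swap bW.
  rewrite (@eq_avg _ _ (fun=> 1)) ?avg_cst => [|x]; last first.
    rewrite -(rowE x) -avgZ.
      by apply: eq_avg => y; rewrite /W/=; ring.
    apply: buc_bm; apply: bucM => //; exact: (buc_slice1 x (buc_expR bG)).
  rewrite (@eq_avg _ _ (fun=> lam^-1)) ?avg_cst => [//|y].
  rewrite -(colE y) -avgZ.
    by apply: eq_avg => x; rewrite /W/=; ring.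
  apply: buc_bm; apply: bucM => //; exact: (buc_slice2 y (buc_expR bG)).
exists phi; first by split => //; exists eps.
by move=> y; rewrite colE lam1 invr1.
Qed.

(** The logarithms of the scaling functions, with a bound on the density that
only depends on the bound [M] of the kernel: rows of a density with unit row
averages cannot differ by more than the factor [expR (4 * M)]. *)
Theorem schroedinger_potentials : exists ab : (R -> R) * (R -> R),
  [/\ buc ab.1, buc ab.2,
      forall x, avg (fun y => expR (G (x, y) + ab.1 x + ab.2 y)) = 1,
      forall y, avg (fun x => expR (G (x, y) + ab.1 x + ab.2 y)) = 1 &
      forall x y, `|G (x, y) + ab.1 x + ab.2 y| <= 4 * M].
Proof.
have [phi [bp [m m0 mp]] colE] := schroedinger_scaling.
pose psi := row_scale G phi.
have psi0 x : 0 < psi x by exact: row_scale_gt0 mp.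
have bpsi : buc psi by exact: buc_row_scale mp.
have [B B0 pB] := buc_bound bp.
have pmB x : m <= phi x <= B by rewrite mp (le_trans (ler_norm _)).
have kpsi x : expR (- M) / B <= psi x by have /andP[] := row_scale_bounds bG GM x bp m0 pmB.
have k0' : 0 < expR (- M) / B by rewrite divr_gt0// expR_gt0.
have phi0' y : 0 < phi y by exact: lt_le_trans (mp y).
pose w (p : R * R) := expR (G p) * psi p.1 * phi p.2.
have wE x y : expR (G (x, y) + ln (psi x) + ln (phi y)) = w (x, y).
  by rewrite !expRD !lnK ?posrE.
have bw : buc w.
  by apply: bucM; [apply: bucM; [exact: buc_expR|exact: buc_fst]|exact: buc_snd].
have rowE x : avg (fun y => w (x, y)) = 1.
  have := row_scale_gt0 bG GM x bp m0 mp; rewrite invr_gt0 => I0.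
  rewrite (@eq_avg _ _ (fun y => psi x * (expR (G (x, y)) * phi y))); last by move=> y; rewrite /w/=; ring.
  rewrite avgZ; first by rewrite /psi /row_scale mulVf// gt_eqF.
  by apply: buc_bm; apply: bucM => //; exact: (buc_slice1 x (buc_expR bG)).
have colE' y : avg (fun x => w (x, y)) = 1.
  rewrite -(colE y) -avgZ; first by apply: eq_avg => x; rewrite /w /psi/=; ring.
  by apply: buc_bm; apply: bucM => //; exact: (buc_slice2 y (buc_expR bG)).
have psi_ratio x x' : psi x <= expR (2 * M) * psi x' by exact: row_scale_ratio mp.
have w_ratio x x' y : w (x, y) <= expR (4 * M) * w (x', y).
  have -> : expR (4 * M) * w (x', y) = expR (2 * M + G (x', y)) * (expR (2 * M) * psi x') * phi y.
    rewrite /w/= expRD; have -> : 4 * M = 2 * M + 2 * M by ring.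
    by rewrite expRD; ring.
  rewrite /w/= ler_wpM2r ?(ltW (phi0' y))// ler_pM ?expR_ge0 ?(ltW (psi0 x))// ler_expR.
  by have := GM (x, y); have := GM (x', y); rewrite !ler_norml; lra.
have bmw y : bm (fun x => w (x, y)) by exact: buc_bm (buc_slice2 y bw).
have w_le x y : w (x, y) <= expR (4 * M).
  rewrite -[leRHS]mulr1 -[X in _ * X](colE' y) -avgZ// -[leLHS]avg_cst.
  by apply: le_avg => [||x']; [exact: bm_cst|exact: bmZ|exact: w_ratio].
have w_ge x y : expR (- (4 * M)) <= w (x, y).
  rewrite expRN -[leLHS]mulr1 ler_pdivrMl ?expR_gt0// -[leLHS](colE' y).
  by rewrite -[leRHS]avg_cst; apply: le_avg => [||x']; [exact: bmw|exact: bm_cst|exact: w_ratio].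
exists (fun x => ln (psi x), fun y => ln (phi y)); split => /=.
- exact: buc_ln k0' kpsi bpsi.
- exact: buc_ln m0 mp bp.
- by move=> x; rewrite -(rowE x); apply: eq_avg => y; rewrite wE.
- by move=> y; rewrite -(colE' y); apply: eq_avg => x; rewrite wE.
- by move=> x y; rewrite ler_norml -ler_expR -[X in _ && X]ler_expR wE w_ge w_le.
Qed.

End SchroedingerExistence.

(** * Gibbs' inequality *)

(** The convention [+oo - +oo = -oo] keeps the subtraction of the negative parts
monotone between infinite values. *)
Lemma le_integral_measurable d (T : measurableType d) (R : realType)
    (mu : {measure set T -> \bar R}) (g h : T -> \bar R) :
  measurable_fun setT g -> measurable_fun setT h -> (forall x, g x <= h x)%E ->
  (\int[mu]_x g x <= \int[mu]_x h x)%E.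
Proof.
move=> mg mh gh; rewrite integralE [leRHS]integralE leeB//; apply: ge0_le_integral => //;
  try exact: measurable_funepos; try exact: measurable_funeneg.
- by move=> x _; apply: (@funepos_le _ _ setT) => [y _|]; rewrite ?in_setT.
- by move=> x _; apply: (@funeneg_le _ _ setT) => [y _|]; rewrite ?in_setT.
Qed.

Section RelativeEntropy.
Local Open Scope charge_scope.
Context d (T : measurableType d) (R : realType).
Variables (mu nu : probability T R).
Hypothesis munu : mu `<< nu.

Let rho := Radon_Nikodym_SigmaFinite.f mu nu.
Let r x := fine (rho x).

Let rhoE x : rho x = (r x)%:E.
Proof. by rewrite /r fineK//; exact: Radon_Nikodym_SigmaFinite.f_fin_num. Qed.

Let r_ge0 x : 0 <= r x.
Proof. by rewrite fine_ge0//; exact: Radon_Nikodym_SigmaFinite.f_ge0. Qed.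

Let mr : measurable_fun setT r.
Proof.
apply: measurableT_comp => //.
by have /measurable_int := Radon_Nikodym_SigmaFinite.f_integrable munu.
Qed.

Let null_r : mu [set x | r x = 0] = 0%E.
Proof.
have mN : measurable [set x | r x = 0].
  by rewrite -[X in measurable X]setTI; exact: (mr measurableT (measurable_set1 0)).
rewrite (Radon_Nikodym_SigmaFinite.f_integral munu)//.
by apply: integral0_eq => x; rewrite -/rho rhoE /= => ->.
Qed.

Variable w : T -> R.
Hypotheses (mw : measurable_fun setT w) (w_gt0 : forall x, 0 < w x).
Hypothesis w_mass : (\int[nu]_x (w x)%:E <= 1)%E.
Hypothesis ilnw : mu.-integrable setT (fun x => (ln (w x))%:E).

(* The density of mu, made positive on the null set where it vanishes so that its
   logarithm and the quotient by it behave. *)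
Let s x := if r x == 0 then w x else r x.

Let s_gt0 x : 0 < s x.
Proof. by rewrite /s; case: eqVneq => // rx; rewrite lt0r rx r_ge0. Qed.

Let ms : measurable_fun setT s.
Proof.
apply: measurable_fun_ifT => //.
by apply: measurable_fun_eqr.
Qed.

Let mquot : measurable_fun setT (fun x => w x / s x).
Proof.
rewrite (_ : (fun x => w x / s x) = fun x => expR (ln (w x) - ln (s x))).
  apply: measurableT_comp => //; apply: measurable_funB;
    by apply: measurableT_comp => //; exact: measurable_ln.
by apply/funext => x; rewrite expRB !lnK ?posrE.
Qed.

(* The quotient integrates to the mass of w on the set where mu lives. *)
Let quot_mass : (\int[mu]_x (w x / s x)%:E <= 1)%E.
Proof.
have q0 x : (0 <= (w x / s x)%:E)%E by rewrite lee_fin divr_ge0// ltW.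
have mq : measurable_fun setT (fun x => (w x / s x)%:E).
  exact/measurable_EFinP.
rewrite -(Radon_Nikodym_SigmaFinite.change_of_variables munu)//.
apply: le_trans w_mass; apply: ge0_le_integral => //.
- by move=> x _; rewrite mule_ge0//; exact: Radon_Nikodym_SigmaFinite.f_ge0.
- apply: emeasurable_funM => //.
  by have /measurable_int := Radon_Nikodym_SigmaFinite.f_integrable munu.
- exact/measurable_EFinP.
move=> x _; rewrite -/rho rhoE -EFinM lee_fin /s; case: eqVneq => [->|rx].
  by rewrite mulr0 ltW.
by rewrite mulfVK.
Qed.

(** Gibbs' inequality. It follows from [ln t >= 1 - 1 / t] applied to the quotient
of the two densities. *)
Lemma relative_entropy_ge :
  (\int[mu]_x (ln (w x))%:E <= KL_div mu nu)%E.
Proof.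
rewrite /KL_div; case: asboolP => [_|]; last by rewrite leey.
have mlns : measurable_fun setT (fun x => (ln (s x))%:E).
  by apply/measurable_EFinP; exact: measurableT_comp.
have -> : (\int[mu]_x (ln (fine ('d (charge_of_finite_measure mu) '/d nu x)))%:E =
           \int[mu]_x (ln (s x))%:E)%E.
  apply: ae_eq_integral => //.
    apply/measurable_EFinP; apply: measurableT_comp => //; apply: measurableT_comp => //.
  have ae1 : ae_eq mu setT ('d (charge_of_finite_measure mu) '/d nu) rho.
    apply: null_dominates_ae_eq munu _ => //; apply: ae_eq_sym.
    exact: ae_eq_Radon_Nikodym_SigmaFinite.
  have ae2 : {ae mu, forall x, r x != 0}.
    exists [set x | r x = 0]; split => //.
      by rewrite -[X in measurable X]setTI; exact: (mr measurableT (measurable_set1 0)).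
    by move=> x /= /negP; rewrite negbK => /eqP.
  apply: filterS2 ae1 ae2 => x RN_rho rx _.
  by rewrite RN_rho// /s (negbTE rx).
pose q x := w x / s x.
have mq : measurable_fun setT q by exact: mquot.
have q0 x : 0 <= q x by rewrite divr_ge0// ltW.
have iq : mu.-integrable setT (EFin \o q).
  apply/integrableP; split; first exact/measurable_EFinP.
  under eq_integral do rewrite /= ger0_norm//.
  exact: le_lt_trans quot_mass (ltry 1).
have i1 : mu.-integrable setT (fun=> 1%:E : \bar R).
  by apply: finite_measure_integrable_cst.
apply: (@le_trans _ _ (\int[mu]_x ((ln (w x))%:E + (1%:E - (q x)%:E)))%E).
  rewrite integralD//; last exact: integrableB.
  rewrite integralB// integral_cst// mul1e.
  rewrite [X in (_ <= _ + (X - _))%E](_ : _ = 1%E); last exact: probability_setT.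
  rewrite leeDl// sube_ge0 ?quot_mass//.
  by rewrite orbC (integrable_fin_num measurableT iq).
apply: le_integral_measurable => //.
  apply: emeasurable_funD; first exact: measurable_int ilnw.
  by apply: emeasurable_funB => //; exact/measurable_EFinP.
move=> x; rewrite -EFinB -EFinD lee_fin.
have sx := s_gt0 x; have wx := w_gt0 x.
have : ln (q x) <= q x - 1.
  rewrite (_ : ln (q x) = ln (1 + (q x - 1))); last by congr ln; ring.
  apply: le_ln1Dx.
  by have : 0 < q x by [rewrite divr_gt0]; lra.
by rewrite /q ln_div ?posrE//; lra.
Qed.

End RelativeEntropy.

(** * Measures with an exponential density *)

Section TiltedMeasure.
Local Open Scope charge_scope.
Context {R : realType}.
Variable g : R * R -> R.
Hypothesis bg : buc g.
Hypothesis mass : avg (fun x => avg (fun y => expR (g (x, y)))) = 1.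
Local Notation u := (@unif_square R).

(** The proofs are arguments so that the structures of measure and of
probability can be attached to it. *)
Definition tilted (_ : buc g) (_ : avg (fun x => avg (fun y => expR (g (x, y)))) = 1) :
    set (plane R) -> \bar R :=
  fun A => (\int[u]_(z in A) (expR (g z))%:E)%E.

Let P := tilted bg mass.

Let m_dens : measurable_fun setT (fun z : plane R => (expR (g z))%:E).
Proof. by apply/measurable_EFinP; apply: buc_measurable2; exact: buc_expR. Qed.

Let dens_ge0 (z : plane R) : (0 <= (expR (g z))%:E)%E.
Proof. by rewrite lee_fin expR_ge0. Qed.

Let tilted0 : P set0 = 0%E.
Proof. by rewrite /P /tilted integral_set0. Qed.

Let tilted_ge0 A : (0 <= P A)%E.
Proof. by apply: integral_ge0 => z _. Qed.

Let tilted_sigma_additive : semi_sigma_additive P.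
Proof.
move=> A mA tA mUA; rewrite /P /tilted; apply: cvg_toP.
  apply: ereal_nondecreasing_is_cvgn => m n mn.
  by apply: lee_sum_nneg_natr => // k _ _; exact: tilted_ge0.
by rewrite ge0_integral_bigcup//; exact: measurable_funTS.
Qed.

HB.instance Definition _ := isMeasure.Build _ _ _ (tilted bg mass)
  tilted0 tilted_ge0 tilted_sigma_additive.

Let tilted_setT : P setT = 1%E.
Proof.
by rewrite /P /tilted integral_unif_square12 ?mass//; exact: buc_expR.
Qed.

HB.instance Definition _ := @Measure_isProbability.Build _ _ R (tilted bg mass) tilted_setT.

Definition tilted_prob : probability (plane R) R := tilted bg mass.

Lemma tilted_dominates : tilted_prob `<< u.
Proof.
apply/null_content_dominatesP => A mA uA0.
rewrite /tilted_prob/= /tilted; apply: null_set_integral => //.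
exact: measurable_funTS.
Qed.

Lemma tilted_density :
  ae_eq u setT ('d (charge_of_finite_measure tilted_prob) '/d u) (fun z => (expR (g z))%:E).
Proof.
apply: integral_ae_eq => //.
  by apply: Radon_Nikodym_integrable; exact: tilted_dominates.
move=> A _ mA; rewrite -Radon_Nikodym_integral//; exact: tilted_dominates.
Qed.

Lemma integral_tilted h : buc h ->
  (\int[tilted_prob]_z (h z)%:E =
   (avg (fun x => avg (fun y => h (x, y) * expR (g (x, y)))))%:E)%E.
Proof.
move=> bh; have ih := buc_integrable tilted_prob bh.
rewrite -(Radon_Nikodym_change_of_variables tilted_dominates measurableT ih).
rewrite -(integral_unif_square12 (h := fun z => h z * expR (g z))); last first.
  by apply: bucM => //; exact: buc_expR.
have mh : measurable_fun setT (EFin \o h : plane R -> \bar R) := measurable_int _ ih.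
apply: ae_eq_integral => //.
- apply: emeasurable_funM => //; apply: (measurable_int u).
  by apply: Radon_Nikodym_integrable; exact: tilted_dominates.
- by apply: (emeasurable_funM mh m_dens).
apply: filterS tilted_density => z H _ /=; rewrite H//.
Qed.

Lemma KL_tilted :
  KL_div tilted_prob u = (avg (fun x => avg (fun y => g (x, y) * expR (g (x, y)))))%:E.
Proof.
rewrite -integral_tilted// /KL_div; case: asboolP => [dom|]; last by case; exact: tilted_dominates.
apply: ae_eq_integral => //.
- apply/measurable_EFinP; apply: measurableT_comp => //; apply: measurableT_comp => //.
- by apply/measurable_EFinP; exact: buc_measurable2.
apply: (null_dominates_ae_eq measurableT dom).
by apply: filterS tilted_density => z H _; rewrite H// /= expRK.
Qed.

End TiltedMeasure.

(** * Permutons *)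

Section Extension.
Context {R : realType}.

Definition clip (x : R) : R := Num.max 0 (Num.min x 1).

Lemma clip_itv x : 0 <= clip x <= 1.
Proof. by rewrite /clip le_max lexx/= ge_max ler01 ge_min lexx orbT. Qed.

Lemma clip_id x : 0 <= x <= 1 -> clip x = x.
Proof. by move=> /andP[x0 x1]; rewrite /clip min_l// max_r. Qed.

Lemma clip_lipschitz (x y : R) : `|clip x - clip y| <= `|x - y|.
Proof.
have le_side a b : clip a - clip b <= `|a - b|.
  have := ler_norm (a - b); have := normr_ge0 (a - b); move: `|a - b| => c.
  rewrite /clip; case: (leP a 1) => ?; case: (leP b 1) => ?; rewrite ?(max_r ler01);
    case: (leP 0 a) => ?; case: (leP 0 b) => ?; lra.
by rewrite ler_norml le_side andbT lerNl opprB distrC le_side.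
Qed.

Lemma unit_squareE (z : R * R) : unit_square R z <-> (0 <= z.1 <= 1) && (0 <= z.2 <= 1).
Proof.
case: z => x y; rewrite /unit_square /=; split; first by case=> /=; rewrite !in_itv/= => -> ->.
by move=> /andP[? ?]; split; rewrite /= in_itv.
Qed.

Lemma compact_unit_square : compact (unit_square R).
Proof. by apply: compact_setX; exact: segment_compact. Qed.

Lemma square_unif_continuous (f : R * R -> R) (e : R) :
  {within unit_square R, continuous f} -> 0 < e ->
  exists2 d : R, 0 < d & forall p q, unit_square R p -> unit_square R q ->
    ball p d q -> `|f p - f q| <= e.
Proof.
move=> /subspace_continuousP fc e0.
have /compact_near_coveringP/near_covering_withinP cov := compact_unit_square.
have e2 : 0 < e / 2 by rewrite divr_gt0.
have := cov _ (0^'+ : set_system R)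
  (fun d p => forall q, unit_square R q -> ball p d q -> `|f p - f q| <= e) _.
case.
  move=> x Kx; have /cvgrPdist_lt/(_ _ e2) := fc x Kx.
  rewrite near_withinE => /nbhs_ballP[r /= r0 rP].
  have r2 : 0 < r / 2 by rewrite divr_gt0.
  exists (ball x (r / 2), [set d | d < r / 2]).
    by split; [exact: nbhsx_ballx|exact: nbhs_right_lt].
  move=> [p d] [/= xp dr] Kp q Kq pq.
  have xq : ball x r q.
    by rewrite [r]splitr; apply: ball_triangle xp _; exact: le_ball (ltW dr) _ pq.
  have xp' : ball x r p by apply: le_ball xp; rewrite ler_pdivrMr// ler_peMr// ?ler1n// ltW.
  have := rP _ xp' Kp; have := rP _ xq Kq.
  have -> : f p - f q = (f x - f q) - (f x - f p) by ring.
  move=> h1 h2; rewrite (le_trans (ler_normB _ _))//.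
  by rewrite [leRHS]splitr lerD// ltW.
move=> d /= d0 dP; exists (d / 2); first by rewrite divr_gt0.
move=> p q Kp Kq; apply: (dP (d / 2)) => //=; last by rewrite divr_gt0.
rewrite /ball/= sub0r normrN gtr0_norm ?divr_gt0//.
by rewrite ltr_pdivrMr// ltr_pMr// ltr1n.
Qed.

(** Composition with the retraction extends a function from the square to the
plane and keeps its values on the square. *)
Lemma buc_clip (f : R * R -> R) : {within unit_square R, continuous f} ->
  buc (fun z => f (clip z.1, clip z.2)).
Proof.
move=> fc.
have sq z : unit_square R (clip z.1, clip z.2) by apply/unit_squareE; rewrite /= !clip_itv.
split.
  have /compact_bounded[M [_ MP]] := continuous_compact fc compact_unit_square.
  exists (M + 1) => z; apply: (MP (M + 1)); first by rewrite ltrDl.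
  by exists (clip z.1, clip z.2).
move=> e e0; have [d d0 dP] := square_unif_continuous fc e0.
exists d => // p q [pq1 pq2]; apply: dP => //.
by split => /=; rewrite /ball/= (le_lt_trans (clip_lipschitz _ _)).
Qed.

End Extension.

Section Permutons.
Context {R : realType}.
Variable mu : probability (plane R) R.
Hypothesis pmu : permuton R mu.

Lemma permuton_fst g : buc g -> (\int[mu]_z (g z.1)%:E = (avg g)%:E)%E.
Proof.
move=> bg; have bg1 := buc_fst bg.
have m1 : measurable_fun setT (fst : plane R -> measurableTypeR R) by exact: measurable_fst.
have mg : measurable_fun setT (EFin \o g : measurableTypeR R -> \bar R).
  by apply/measurable_EFinP; exact: buc_measurable.
rewrite -(@integral_pushforward _ _ _ _ R fst m1 mu setT (EFin \o g) mg)//; last first.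
  by rewrite preimage_setT; exact: (buc_integrable mu bg1).
rewrite (eq_measure_integral (unif01 R)).
  rewrite /avg /Rintegral fineK//; apply: integrable_fin_num => //.
  by apply: bm_integrable; exact: buc_bm.
move=> A mA _; have [E _] := pmu mA; transitivity (mu (A `*` setT)); last exact: E.
rewrite (_ : A `*` setT = fst @^-1` A)//.
by apply/seteqP; split => [[x y] []|[x y]].
Qed.

Lemma permuton_snd g : buc g -> (\int[mu]_z (g z.2)%:E = (avg g)%:E)%E.
Proof.
move=> bg; have bg1 := buc_snd bg.
have m1 : measurable_fun setT (snd : plane R -> measurableTypeR R) by exact: measurable_snd.
have mg : measurable_fun setT (EFin \o g : measurableTypeR R -> \bar R).
  by apply/measurable_EFinP; exact: buc_measurable.
rewrite -(@integral_pushforward _ _ _ _ R snd m1 mu setT (EFin \o g) mg)//; last first.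
  by rewrite preimage_setT; exact: (buc_integrable mu bg1).
rewrite (eq_measure_integral (unif01 R)).
  rewrite /avg /Rintegral fineK//; apply: integrable_fin_num => //.
  by apply: bm_integrable; exact: buc_bm.
move=> A mA _; have [_ E] := pmu mA; transitivity (mu (setT `*` A)); last exact: E.
rewrite (_ : setT `*` A = snd @^-1` A)//.
by apply/seteqP; split => [[x y] []|[x y]].
Qed.

Lemma unif01_itvC : unif01 R (~` `[0, 1]%classic) = 0%E.
Proof.
have m01 : measurable (`[0%R, 1%R]%classic : set (measurableTypeR R)) by exact: measurable_itv.
have -> : unif01 R (~` `[0%R, 1%R]%classic) = (1 - unif01 R (`[0%R, 1%R]%classic))%E.
  exact: probability_setC.
have -> : unif01 R `[0%R, 1%R]%classic = 1%E by exact: integral_uniform_pdf1.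
by rewrite subee.
Qed.

Lemma permuton_square : mu (~` unit_square R) = 0%E.
Proof.
have m01 : measurable (~` `[0%R, 1%R]%classic : set (measurableTypeR R)).
  by apply: measurableC; exact: measurable_itv.
have [H1 H2] := pmu m01.
apply/eqP; rewrite eq_le measure_ge0 andbT.
have -> : 0%E = (mu (~` `[0%R, 1%R] `*` setT) + mu (setT `*` ~` `[0%R, 1%R]))%E.
  by rewrite H1 H2 unif01_itvC adde0.
apply: le_trans (measureU2 _ _ _); last 2 first.
- exact: measurableX.
- exact: measurableX.
apply: le_measure; rewrite ?inE.
- by apply: measurableC; apply: measurableX; exact: measurable_itv.
- by apply: measurableU; exact: measurableX.
move=> [x y] /not_andP[H|H]; [left|right]; by split.
Qed.

Lemma mean_permuton (f F : R * R -> R) : buc F -> (forall z, unit_square R z -> F z = f z) ->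
  mean f mu = \int[mu]_z F z.
Proof.
move=> bF Ff; transitivity (\int[mu]_(z in unit_square R) F z).
  by apply: eq_Rintegral => z /set_mem/Ff.
rewrite /Rintegral; congr fine.
have msq : measurable (unit_square R : set (plane R)).
  by apply: measurableX; exact: measurable_itv.
rewrite [RHS](negligible_integral (measurableC msq) _ _ permuton_square)//.
  by rewrite setTD setCK.
exact: buc_integrable.
Qed.

End Permutons.

(** * The variational problem *)

Section TiltedPermuton.
Context {R : realType}.
Variable g : R * R -> R.
Hypothesis bg : buc g.
Hypothesis g_row : forall x, avg (fun y => expR (g (x, y))) = 1.
Hypothesis g_col : forall y, avg (fun x => expR (g (x, y))) = 1.

Lemma row_mass : avg (fun x => avg (fun y => expR (g (x, y)))) = 1.
Proof. by rewrite (eq_avg g_row) avg_cst. Qed.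

Let m_dens : measurable_fun setT (fun z : plane R => (expR (g z))%:E).
Proof. by apply/measurable_EFinP; apply: buc_measurable2; exact: buc_expR. Qed.

Let integral_row x : (\int[unif01 R]_y (expR (g (x, y)))%:E = 1)%E.
Proof.
rewrite -(g_row x) /avg /Rintegral fineK//; apply: integrable_fin_num => //.
by apply: bm_integrable; apply: buc_bm; exact: (buc_slice1 x (buc_expR bg)).
Qed.

Let integral_col y : (\int[unif01 R]_x (expR (g (x, y)))%:E = 1)%E.
Proof.
rewrite -(g_col y) /avg /Rintegral fineK//; apply: integrable_fin_num => //.
by apply: bm_integrable; apply: buc_bm; exact: (buc_slice2 y (buc_expR bg)).
Qed.

Lemma permuton_tilted : permuton R (tilted_prob bg row_mass).
Proof.
move=> A mA; split; rewrite /tilted_prob/= /tilted integral_mkcond.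
- have mAT : measurable (A `*` setT : set (plane R)) by exact: measurableX.
  have m1 : measurable_fun setT ((fun z : plane R => (expR (g z))%:E) \_ (A `*` setT)).
    by apply/(measurable_restrictT _ mAT); exact: measurable_funTS.
  have p0 z : (0 <= ((fun z : plane R => (expR (g z))%:E) \_ (A `*` setT)) z)%E.
    by rewrite patchE; case: ifP => _//; rewrite lee_fin expR_ge0.
  rewrite [LHS](@fubini_tonelli1 _ _ _ _ R (unif01 R) (unif01 R) _ m1 p0).
  transitivity (\int[unif01 R]_x (\1_A x)%:E)%E; last first.
    by rewrite integral_indic// setIT.
  apply: eq_integral => x _; rewrite /fubini_F indicE.
  have [xA|xA] := boolP (x \in A).
    rewrite -(integral_row x); apply: eq_integral => y _; rewrite patchE.
    by rewrite mem_set//; split => //; exact: set_mem.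
  apply: integral0_eq => y _; rewrite patchE memNset// => -[/mem_set].
  by rewrite /= (negbTE xA).
- have mTA : measurable (setT `*` A : set (plane R)) by exact: measurableX.
  have m1 : measurable_fun setT ((fun z : plane R => (expR (g z))%:E) \_ (setT `*` A)).
    by apply/(measurable_restrictT _ mTA); exact: measurable_funTS.
  have p0 z : (0 <= ((fun z : plane R => (expR (g z))%:E) \_ (setT `*` A)) z)%E.
    by rewrite patchE; case: ifP => _//; rewrite lee_fin expR_ge0.
  rewrite [LHS](@fubini_tonelli2 _ _ _ _ R (unif01 R) (unif01 R) _ m1 p0).
  transitivity (\int[unif01 R]_y (\1_A y)%:E)%E; last first.
    by rewrite integral_indic// setIT.
  apply: eq_integral => y _; rewrite /fubini_G indicE.
  have [yA|yA] := boolP (y \in A).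
    rewrite -(integral_col y); apply: eq_integral => x _; rewrite patchE.
    by rewrite mem_set//; split => //; exact: set_mem.
  apply: integral0_eq => x _; rewrite patchE memNset// => -[_ /mem_set].
  by rewrite /= (negbTE yA).
Qed.

End TiltedPermuton.

Section Pressure.
Context {R : realType}.
Variables (f F : R * R -> R).
Hypothesis bF : buc F.
Hypothesis Ff : forall z, unit_square R z -> F z = f z.
Local Notation u := (@unif_square R).

(* Potentials that turn expR (theta F) into a density with uniform marginals. *)
Variables (theta : R) (a b : R -> R).
Hypotheses (ba : buc a) (bb : buc b).
Definition tilt_exponent (z : R * R) : R := theta * F z + a z.1 + b z.2.
Let g := tilt_exponent.
Hypothesis g_row : forall x, avg (fun y => expR (g (x, y))) = 1.
Hypothesis g_col : forall y, avg (fun x => expR (g (x, y))) = 1.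

Lemma buc_tilt : buc g.
Proof. by apply: bucD; [apply: bucD; [exact: bucZ|exact: buc_fst]|exact: buc_snd]. Qed.

Let bg := buc_tilt.
Let mu0 := tilted_prob bg (row_mass g_row).

(* The potentials integrate to the same constant under all permutons. *)
Let integral_g mu : permuton R mu ->
  (\int[mu]_z (g z)%:E = (theta * mean f mu + avg a + avg b)%:E)%E.
Proof.
move=> pmu; rewrite (mean_permuton pmu bF Ff).
have iF := buc_integrable mu bF.
have i1 : mu.-integrable setT (fun z => (theta * F z)%:E) by exact: (buc_integrable mu (bucZ theta bF)).
have i2 := buc_integrable mu (buc_fst ba); have i3 := buc_integrable mu (buc_snd bb).
have E : (fun z => (g z)%:E) = ((fun z => (theta * F z)%:E) \+ (fun z => (a z.1)%:E) \+ (fun z => (b z.2)%:E))%E.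
  by apply/funext => z; rewrite /g /tilt_exponent !EFinD.
rewrite E integralD//; last exact: integrableD.
rewrite integralD// (permuton_fst pmu)// (permuton_snd pmu)// !EFinD.
congr (_ + _ + _)%E; under eq_integral do rewrite EFinM.
rewrite integralZl// /Rintegral EFinM fineK//; exact: integrable_fin_num iF.
Qed.

(** Gibbs' inequality for the density [expR g], whose logarithm differs from
[theta * F] by the potentials. *)
Lemma gibbs_objective_le mu : permuton R mu ->
  (gibbs_objective f theta mu <= (- (avg a + avg b))%:E)%E.
Proof.
move=> pmu; rewrite /gibbs_objective.
have [dom|ndom] := pselect (mu `<< u); last first.
  rewrite /KL_div; case: asboolP => // _.
  by rewrite (_ : (_ - +oo)%E = -oo%E) ?leNye.
have : (\int[mu]_z (ln (expR (g z)))%:E <= KL_div mu u)%E.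
  apply: relative_entropy_ge => //.
  - exact: buc_measurable2 (buc_expR bg).
  - by move=> z; exact: expR_gt0.
  - by rewrite (integral_unif_square12 (buc_expR bg)) row_mass.
  - under eq_fun do rewrite expRK; exact: buc_integrable.
under eq_integral do rewrite expRK.
rewrite integral_g//; case: (KL_div mu u) => [kl||]; last by rewrite leeNy_eq.
  by rewrite -EFinB !lee_fin; lra.
by move=> _; rewrite (_ : (_ - +oo)%E = -oo%E) ?leNye.
Qed.

Lemma mean_tilted : mean f mu0 = avg (fun x => avg (fun y => F (x, y) * expR (g (x, y)))).
Proof.
rewrite (mean_permuton (permuton_tilted bg g_row g_col) bF Ff).
by rewrite /Rintegral integral_tilted.
Qed.

Lemma gibbs_objective_tilted :
  gibbs_objective f theta mu0 = (- (avg a + avg b))%:E.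
Proof.
have pmu0 : permuton R mu0 := permuton_tilted bg g_row g_col.
rewrite /gibbs_objective KL_tilted -(integral_tilted bg (row_mass g_row) bg).
by rewrite (integral_g pmu0) -EFinB; congr _%:E; ring.
Qed.

Lemma Z_erealE : Z_ereal f theta = (- (avg a + avg b))%:E.
Proof.
apply/eqP; rewrite eq_le; apply/andP; split.
  by apply: ge_ereal_sup => _ [mu pmu <-]; exact: gibbs_objective_le.
rewrite -gibbs_objective_tilted; apply: ereal_sup_ubound.
by exists mu0 => //; exact: permuton_tilted.
Qed.

Lemma mu_gibbsP : permuton R (mu_gibbs f theta) /\
  gibbs_objective f theta (mu_gibbs f theta) = Z_ereal f theta.
Proof.
rewrite /mu_gibbs; case: xgetP => [_ -> //|H]; exfalso.
apply: (H mu0); split; first exact: permuton_tilted.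
by rewrite Z_erealE gibbs_objective_tilted.
Qed.

(** A maximiser at [theta] is a competitor at every other parameter, so its mean
is a subgradient. *)
Lemma Z_ereal_subgradient mu theta' : permuton R mu ->
  gibbs_objective f theta mu = Z_ereal f theta ->
  ((- (avg a + avg b) + (theta' - theta) * mean f mu)%:E <= Z_ereal f theta')%E.
Proof.
move=> pmu; rewrite Z_erealE => opt.
suff -> : (- (avg a + avg b) + (theta' - theta) * mean f mu)%:E = gibbs_objective f theta' mu.
  by apply: ereal_sup_ubound; exists mu.
move: opt; rewrite /gibbs_objective; case: (KL_div mu u) => [kl||] //=.
by rewrite -!EFinB => -[<-]; congr _%:E; ring.
Qed.

End Pressure.

(** * Dependence of the optimal mean on the parameter *)

Section DoubleAverageAlgebra.
Context {R : realType}.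
Implicit Types (g h : R * R -> R).

Definition avg2 h : R := avg (fun x => avg (fun y => h (x, y))).

Let bm1 h x : buc h -> bm (fun y => h (x, y)).
Proof. by move=> bh; exact: buc_bm (buc_slice1 x bh). Qed.

Lemma avg2D g h : buc g -> buc h -> avg2 (fun z => g z + h z) = avg2 g + avg2 h.
Proof.
move=> bg bh; rewrite /avg2 -avgD; try by [apply: buc_bm; exact: buc_avg].
by apply: eq_avg => x; rewrite avgD//; exact: bm1.
Qed.

Lemma avg2Z (c : R) h : buc h -> avg2 (fun z => c * h z) = c * avg2 h.
Proof.
move=> bh; rewrite /avg2 -avgZ; last by apply: buc_bm; exact: buc_avg.
by apply: eq_avg => x; rewrite avgZ//; exact: bm1.
Qed.

Lemma le_avg2 g h : buc g -> buc h -> (forall z, g z <= h z) -> avg2 g <= avg2 h.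
Proof.
move=> bg bh gh; apply: le_avg => [||x]; try by [apply: buc_bm; exact: buc_avg].
by apply: le_avg => [||y]; [exact: bm1..|exact: gh].
Qed.

Lemma eq_avg2 g h : g =1 h -> avg2 g = avg2 h.
Proof. by move=> /funext ->. Qed.

Lemma avg2_ge0 h : (forall z, 0 <= h z) -> 0 <= avg2 h.
Proof. by move=> h0; apply: avg_ge0 => x; exact: avg_ge0. Qed.

Lemma avg2_cst (c : R) : avg2 (fun=> c) = c.
Proof. by rewrite /avg2 (@eq_avg _ _ (fun=> c)) ?avg_cst// => x; rewrite avg_cst. Qed.

(** These two orthogonality relations discard the potentials from integrals
against [F] and against differences of densities with the same marginals. *)
Lemma avg2_row0 h (al : R -> R) : buc h -> (forall x, avg (fun y => h (x, y)) = 0) ->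
  avg2 (fun z => al z.1 * h z) = 0.
Proof.
move=> bh h0; rewrite /avg2 (@eq_avg _ _ (fun=> 0)) ?avg_cst// => x /=.
by rewrite avgZ ?h0 ?mulr0//; exact: bm1.
Qed.

Lemma avg2_col0 h (be : R -> R) : buc h -> buc be -> (forall y, avg (fun x => h (x, y)) = 0) ->
  avg2 (fun z => be z.2 * h z) = 0.
Proof.
move=> bh bb h0; rewrite /avg2 (avg_swap (h := fun z => be z.2 * h z)); last first.
  by apply: bucM => //; exact: buc_snd.
rewrite (@eq_avg _ _ (fun=> 0)) ?avg_cst// => y /=.
by rewrite avgZ ?h0 ?mulr0//; exact: buc_bm (buc_slice2 y bh).
Qed.

End DoubleAverageAlgebra.

Section ExpMonotone.
Context {R : realType}.

Lemma expR_diff_bounds (C s t : R) : `|s| <= C -> `|t| <= C ->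
  expR (- C) * (s - t) ^+ 2 <= (expR s - expR t) * (s - t) /\
  expR (- C) * (expR s - expR t) ^+ 2 <= (expR s - expR t) * (s - t).
Proof.
wlog ts : s t / t <= s => [wl|] sC tC.
  have [ts|st] := leP t s; first exact: wl.
  have [H1 H2] := wl t s (ltW st) tC sC.
  rewrite -[(s - t) ^+ 2]sqrrN -[(expR s - expR t) ^+ 2]sqrrN !opprB.
  by rewrite -[_ * (s - t)]mulrNN !opprB.
have d0 : 0 <= s - t by rewrite subr_ge0.
have e0 : 0 <= expR s - expR t by rewrite subr_ge0 ler_expR.
have low : expR (- C) * (s - t) <= expR s - expR t.
  have -> : expR s - expR t = expR t * (expR (s - t) - 1).
    by rewrite mulrBr mulr1 -expRD; congr (expR _ - _); ring.
  rewrite ler_pM ?expR_ge0//; last by have := expR_ge1Dx (s - t); lra.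
  by rewrite ler_expR; move: tC; rewrite ler_norml => /andP[].
have up : expR (- C) * (expR s - expR t) <= s - t.
  rewrite expRN ler_pdivrMl ?expR_gt0//.
  have -> : expR s - expR t = expR s * (1 - expR (- (s - t))).
    by rewrite mulrBr mulr1 -expRD; congr (_ - expR _); ring.
  rewrite ler_pM ?expR_ge0//; last by have := expR_ge1Dx (- (s - t)); lra.
    by rewrite subr_ge0 -expR0 ler_expR oppr_le0.
  by rewrite ler_expR (le_trans (ler_norm _)).
split; first by rewrite expr2 mulrA ler_wpM2r.
by rewrite expr2 mulrCA ler_wpM2l.
Qed.

End ExpMonotone.

Section Tilts.
Context {R : realType}.
Variables (F : R * R -> R) (B : R).
Hypothesis bF : buc F.
Hypothesis FB : forall z, `|F z| <= B.
Hypothesis F_row : forall x, avg (fun y => F (x, y)) = 0.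
Hypothesis F_col : forall y, avg (fun x => F (x, y)) = 0.

(** The pair [ab] solves the Schroedinger system of [expR (t * F)]. *)
Definition potentials (t : R) (ab : (R -> R) * (R -> R)) : Prop :=
  let g := tilt_exponent F t ab.1 ab.2 in
  [/\ buc ab.1, buc ab.2,
      forall x, avg (fun y => expR (g (x, y))) = 1,
      forall y, avg (fun x => expR (g (x, y))) = 1 &
      forall z, `|g z| <= 4 * (`|t| * B)].

Lemma potentials_exist : exists ab, forall t, potentials t (ab t).
Proof.
have H t : exists ab, potentials t ab.
  have GM z : `|t * F z| <= `|t| * B by rewrite normrM ler_wpM2l.
  have [ab [H1 H2 H3 H4 H5]] := schroedinger_potentials (bucZ t bF) GM.
  by exists ab; split => // -[x y]; exact: H5.
by have [ab abP] := choice H; exists ab.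
Qed.

Variables (ab : R -> (R -> R) * (R -> R)).
Hypothesis abP : forall t, potentials t (ab t).

Let g t := tilt_exponent F t (ab t).1 (ab t).2.
Let w t (z : R * R) := expR (g t z).

Let bg t : buc (g t).
Proof. by have [ba bb _ _ _] := abP t; exact: buc_tilt. Qed.

Let bw t : buc (w t). Proof. exact: buc_expR. Qed.

Definition tilt_mean (t : R) : R := avg2 (fun z => F z * expR (tilt_exponent F t (ab t).1 (ab t).2 z)).

Let mean_diff s t : tilt_mean s - tilt_mean t = avg2 (fun z => F z * (w s z - w t z)).
Proof.
have bs := bucM bF (bw s); have bt := bucM bF (bw t).
rewrite /tilt_mean -[X in _ - X]mul1r -mulNr -(avg2Z _ bt) -(avg2D bs (bucZ _ bt)).
by apply: eq_avg2 => z; rewrite /w /g; ring.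
Qed.

(** Both densities have the same marginals, so the potentials do not contribute
to the integral of the difference of the exponents. *)
Let mean_diffE s t : (s - t) * (tilt_mean s - tilt_mean t) =
  avg2 (fun z => (w s z - w t z) * (g s z - g t z)).
Proof.
have [ba bb rs cs _] := abP s; have [ba' bb' rt ct _] := abP t.
pose h z := w s z - w t z.
have bh : buc h by exact: bucB.
have h_row x : avg (fun y => h (x, y)) = 0.
  rewrite avgB; [by rewrite rs rt subrr|exact: buc_bm (buc_slice1 x (bw s))|
    exact: buc_bm (buc_slice1 x (bw t))].
have h_col y : avg (fun x => h (x, y)) = 0.
  rewrite avgB; [by rewrite cs ct subrr|exact: buc_bm (buc_slice2 y (bw s))|
    exact: buc_bm (buc_slice2 y (bw t))].
pose al x := (ab s).1 x - (ab t).1 x; pose be y := (ab s).2 y - (ab t).2 y.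
have bal : buc al by exact: bucB.
have bbe : buc be by exact: bucB.
have H1 := avg2_row0 al bh h_row; have H2 := avg2_col0 bh bbe h_col.
have bFh : buc (fun z => F z * h z) by exact: bucM.
have b1 : buc (fun z : R * R => al z.1 * h z) by apply: bucM => //; exact: buc_fst.
have b2 : buc (fun z : R * R => be z.2 * h z) by apply: bucM => //; exact: buc_snd.
have b0 := bucZ (s - t) bFh.
rewrite mean_diff -(avg2Z (s - t) bFh).
rewrite -[LHS]addr0 -{1}H1 -[LHS]addr0 -{1}H2.
rewrite -(avg2D b0 b1) -(avg2D (bucD b0 b1) b2).
by apply: eq_avg2 => z; rewrite /h /g /tilt_exponent /al /be /w; ring.
Qed.

Let g_bound (T t : R) z : `|t| <= T -> `|g t z| <= 4 * (T * B).
Proof.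
move=> tT; have [_ _ _ _ H] := abP t; apply: (le_trans (H z)).
by rewrite ler_wpM2l// ler_wpM2r// (le_trans _ (FB (0, 0))).
Qed.

(** The quadratic lower bound: [F] is orthogonal to the potentials, so the mean
square of the difference of the exponents is at least that of [(s - t) * F]. *)
Lemma tilt_mean_strict s t : 0 < avg2 (fun z => F z ^+ 2) -> s < t ->
  tilt_mean s < tilt_mean t.
Proof.
move=> F2 st; pose T := `|s| + `|t|.
have sT : `|s| <= T by rewrite lerDl.
have tT : `|t| <= T by rewrite lerDr.
have ts0 : 0 < t - s by rewrite subr_gt0.
rewrite -subr_gt0 -(pmulr_rgt0 _ ts0) mean_diffE.
pose C := 4 * (T * B).
have [ba bb _ _ _] := abP s; have [ba' bb' _ _ _] := abP t.
have bgg : buc (fun z => g t z - g s z) by exact: bucB.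
have bgg2 : buc (fun z => (g t z - g s z) ^+ 2) by apply: bucM.
apply: (@lt_le_trans _ _ (expR (- C) * avg2 (fun z => (g t z - g s z) ^+ 2))); last first.
  rewrite -(avg2Z _ bgg2); apply: le_avg2 => [||z].
  - exact: bucZ.
  - by apply: bucM => //; exact: bucB.
  by have [] := expR_diff_bounds (g_bound z tT) (g_bound z sT).
apply: mulr_gt0; first exact: expR_gt0.
apply: (@lt_le_trans _ _ ((t - s) ^+ 2 * avg2 (fun z => F z ^+ 2))).
  by rewrite mulr_gt0// exprn_gt0.
pose al x := (ab t).1 x - (ab s).1 x; pose be y := (ab t).2 y - (ab s).2 y.
have bal : buc al by exact: bucB.
have bbe : buc be by exact: bucB.
have H1 := avg2_row0 (fun x => 2 * (t - s) * al x) bF F_row.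
have bbe' : buc (fun y => 2 * (t - s) * be y) by exact: bucZ.
have H2 := avg2_col0 bF bbe' F_col.
have b1 : buc (fun z : R * R => 2 * (t - s) * al z.1 * F z).
  by apply: bucM => //; apply: (@buc_fst _ (fun x => 2 * (t - s) * al x)); exact: bucZ.
have b2 : buc (fun z : R * R => 2 * (t - s) * be z.2 * F z).
  by apply: bucM => //; apply: (@buc_snd _ (fun x => 2 * (t - s) * be x)).
have bF2 : buc (fun z => F z ^+ 2) by exact: bucM.
have b3 := bucZ ((t - s) ^+ 2) bF2.
rewrite -(avg2Z _ bF2) -[leLHS]addr0 -{1}H1 -[leLHS]addr0 -{1}H2.
rewrite -(avg2D b3 b1) -(avg2D (bucD b3 b1) b2).
apply: le_avg2 => [||z]; [exact: bucD (bucD b3 b1) b2|exact: bgg2|].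
have -> : (g t z - g s z) ^+ 2 =
  (t - s) ^+ 2 * F z ^+ 2 + 2 * (t - s) * al z.1 * F z + 2 * (t - s) * be z.2 * F z +
  (al z.1 + be z.2) ^+ 2 by rewrite /g /tilt_exponent /al /be; ring.
by rewrite lerDl sqr_ge0.
Qed.

(** The difference of the means is controlled by the mean square of the difference
of the densities, which is in turn controlled by the difference of the means. *)
Lemma tilt_mean_lipschitz (T : R) : exists2 K : R, 0 <= K &
  forall s t, `|s| <= T -> `|t| <= T -> `|tilt_mean s - tilt_mean t| <= K * `|s - t|.
Proof.
have B0 : 0 <= B by rewrite (le_trans _ (FB (0, 0))).
pose C := 4 * (T * B); exists (expR C * B ^+ 2).
  by rewrite mulr_ge0 ?expR_ge0// sqr_ge0.
move=> s t sT tT.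
have [->|st] := eqVneq s t; first by rewrite !subrr !normr0 mulr0.
have d0 : 0 < `|s - t| by rewrite normr_gt0 subr_eq0.
pose eta := expR C * `|s - t| / 2.
have eta0 : 0 < eta by rewrite divr_gt0// mulr_gt0// expR_gt0.
have eta4 : 0 < 4 * eta by rewrite mulr_gt0.
have bww : buc (fun z => w s z - w t z) by exact: bucB.
have bww2 : buc (fun z => (w s z - w t z) ^+ 2) by exact: bucM.
have bF2 : buc (fun z => F z ^+ 2) by exact: bucM.
pose D := `|tilt_mean s - tilt_mean t|.
have W2 : avg2 (fun z => (w s z - w t z) ^+ 2) <= expR C * (`|s - t| * D).
  rewrite -ler_pdivrMl ?expR_gt0// -expRN -(avg2Z _ bww2).
  rewrite -normrM mean_diffE; apply: le_trans (ler_norm _).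
  apply: le_avg2 => [||z]; [exact: bucZ|by apply: bucM => //; exact: bucB|].
  by have [] := expR_diff_bounds (g_bound z sT) (g_bound z tT).
have F2B : avg2 (fun z => F z ^+ 2) <= B ^+ 2.
  rewrite -(avg2_cst (B ^+ 2)); apply: le_avg2 => [||z]; [by []|exact: buc_cst|].
  by rewrite -[F z ^+ 2]real_normK ?num_real// lerXn2r ?nnegrE.
have side (e : R) : `|e| = 1 ->
    e * (tilt_mean s - tilt_mean t) <= eta * B ^+ 2 + D / 2.
  move=> e1; rewrite mean_diff -avg2Z; last exact: bucM.
  have H : avg2 (fun z => e * (F z * (w s z - w t z))) <=
      avg2 (fun z => eta * F z ^+ 2 + (4 * eta)^-1 * (w s z - w t z) ^+ 2).
    apply: le_avg2 => [||z]; [by apply: bucZ; exact: bucM|by apply: bucD; exact: bucZ|].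
    have e2 : e ^+ 2 = 1 by rewrite -[e ^+ 2]real_normK ?num_real// e1 expr1n.
    have : 0 <= (2 * eta * F z - e * (w s z - w t z)) ^+ 2 by exact: sqr_ge0.
    set W := w s z - w t z => H; rewrite -(ler_pM2l eta4).
    have -> : 4 * eta * (eta * F z ^+ 2 + (4 * eta)^-1 * W ^+ 2) = 4 * eta ^+ 2 * F z ^+ 2 + W ^+ 2.
      by field; rewrite gt_eqF.
    have E : (2 * eta * F z - e * W) ^+ 2 =
        4 * eta ^+ 2 * F z ^+ 2 + e ^+ 2 * W ^+ 2 - 4 * eta * (e * (F z * W)) by ring.
    by move: H; rewrite E e2 mul1r subr_ge0.
  apply: (le_trans H); rewrite avg2D; [|exact: bucZ..].
  rewrite !avg2Z// lerD//; first by rewrite ler_wpM2l// ltW.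
  rewrite (ler_pdivrMl _ _ eta4) (le_trans W2)//.
  by rewrite /eta le_eqVlt; apply/orP; left; apply/eqP; field.
have DD : D <= eta * B ^+ 2 + D / 2.
  rewrite {1}/D; case: (ger0P (tilt_mean s - tilt_mean t)) => _.
    by rewrite -[leLHS]mul1r side// normr1.
  by rewrite -[leLHS]mulN1r side// normrN normr1.
rewrite -/D; move: DD; rewrite /eta; lra.
Qed.

End Tilts.

(** * Exponential families on finite sets *)

Section Subgradients.
Context {R : realType}.

(** The difference quotients of a convex function lie between two values of the
subgradient. *)
Lemma subgradient_derive (Z m : R -> R) (t : R) :
  (forall x y, Z x + (y - x) * m x <= Z y) -> {for t, continuous m} ->
  is_derive t 1 Z (m t).
Proof.
move=> sub mc.
have cv : (fun h : R => h^-1 *: ((Z \o shift t) (h *: 1) - Z t)) @ 0^' --> m t.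
  apply/cvgrPdist_le => /= e e0; move/cvgrPdist_le : mc => /(_ _ e0) /nbhs_ballP[d /= d0 dP].
  exists d => // h /=; rewrite sub0r normrN => hd hne.
  have h0 : 0 < `|h| by rewrite normr_gt0.
  have := dP (h + t); rewrite /ball/= opprD addrCA subrr addr0 normrN => /(_ hd) mm.
  rewrite -[X in X + t]/(h * 1) mulr1.
  have H1 := sub t (h + t); have H2 := sub (h + t) t.
  rewrite addrK in H1; rewrite opprD addrCA subrr addr0 in H2.
  have E : m t - h^-1 *: (Z (h + t) - Z t) = h^-1 * (h * m t - (Z (h + t) - Z t)).
    by rewrite /GRing.scale/=; field.
  rewrite E normrM normfV ler_pdivrMl//.
  apply: (@le_trans _ _ (`|h * (m (h + t) - m t)|)); last first.
    by rewrite normrM ler_wpM2l// distrC.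
  rewrite ler0_norm; last lra.
  by rewrite (le_trans _ (ler_norm _))//; lra.
apply: DeriveDef; last exact/cvg_lim.
by apply/cvg_ex; exists (m t).
Qed.

End Subgradients.

Lemma continuous_sum (R : realType) (I : Type) (r : seq I) (F : I -> R -> R) :
  (forall i, continuous (F i)) -> continuous (fun x => \sum_(i <- r) F i x).
Proof.
move=> Fc; elim: r => [|i r IH] x.
  by under eq_fun do rewrite big_nil; exact: cvg_cst.
by under eq_fun do rewrite big_cons; apply: cvgD; [exact: Fc|exact: IH].
Qed.

Section ExponentialFamily.
Context {R : realType} {I : finType} (i0 : I) (s : I -> R).
Implicit Types (t h c : R).

Definition lpart t : R := ln (\sum_i expR (t * s i)).
Definition weight t (i : I) : R := expR (t * s i - lpart t).
Definition emean t : R := \sum_i weight t i * s i.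

Let part t := \sum_i expR (t * s i).

Let part_gt0 t : 0 < part t.
Proof.
rewrite /part (bigD1 i0)//= ltr_pwDl ?expR_gt0//.
by apply: sumr_ge0 => i _; exact: expR_ge0.
Qed.

Let weightE t i : weight t i = expR (t * s i) / part t.
Proof. by rewrite /weight /lpart expRB lnK ?posrE//; exact: part_gt0. Qed.

Lemma weight_ge0 t i : 0 <= weight t i. Proof. exact: expR_ge0. Qed.

Lemma weight_sum t : \sum_i weight t i = 1.
Proof.
under eq_bigr do rewrite weightE.
by rewrite -mulr_suml divff ?gt_eqF ?part_gt0.
Qed.

(** Jensen's inequality for the exponential. *)
Lemma lpart_subgradient t t' : lpart t + (t' - t) * emean t <= lpart t'.
Proof.
have part0 x : 0 < \sum_i expR (x * s i) by exact: part_gt0.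
rewrite -ler_expR expRD [leRHS]lnK ?posrE// [X in X * _]lnK ?posrE//.
set h := t' - t; set E := emean t.
have -> : \sum_i expR (t' * s i) = part t * \sum_i weight t i * expR (h * s i).
  rewrite mulr_sumr; apply: eq_bigr => i _; rewrite weightE mulrA mulrCA divff ?gt_eqF ?part_gt0// mulr1.
  by rewrite -expRD; congr expR; rewrite /h; ring.
rewrite ler_wpM2l ?(ltW (part_gt0 t))//.
have -> : expR (h * E) = \sum_i weight t i * (expR (h * E) * (1 + (h * s i - h * E))).
  transitivity (\sum_i ((expR (h * E) * (1 - h * E)) * weight t i +
                        (expR (h * E) * h) * (weight t i * s i))).
    rewrite big_split/= -!mulr_sumr weight_sum -/(emean t) -/E; ring.
  by apply: eq_bigr => i _; ring.
apply: ler_sum => i _; apply: ler_wpM2l; first exact: weight_ge0.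
rewrite [leRHS](_ : _ = expR (h * E) * expR (h * s i - h * E)).
  by rewrite ler_wpM2l ?expR_ge0// expR_ge1Dx.
by rewrite -expRD; congr expR; ring.
Qed.

Lemma emean_continuous : continuous emean.
Proof.
move=> t.
have ce (i : I) : continuous (fun x : R => expR (x * s i)).
  move=> x; apply: (@continuous_comp _ _ _ (fun t => t * s i) expR); last exact: continuous_expR.
  by apply: cvgM; [exact: cvg_id|exact: cvg_cst].
have -> : emean = fun t => (\sum_i expR (t * s i) * s i) * (part t)^-1.
  by apply/funext => x; rewrite mulr_suml; apply: eq_bigr => i _; rewrite weightE mulrAC.
apply: cvgM.
  by apply: continuous_sum => i x; apply: cvgM; [exact: ce|exact: cvg_cst].
apply: cvgV; first by rewrite gt_eqF ?part_gt0.
exact: continuous_sum.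
Qed.

Lemma lpart_derive t : is_derive t 1 lpart (emean t).
Proof.
apply: subgradient_derive; last exact: emean_continuous.
by move=> x y; exact: lpart_subgradient.
Qed.

(** The bound multiplies each weight by [expR (h * (s i - c))], which is at least
one on the event; [h] may have either sign. *)
Lemma exponential_tail t h c :
  \sum_(i | 0 <= h * (s i - c)) weight t i <= expR (lpart (t + h) - lpart t - h * c).
Proof.
apply: (@le_trans _ _ (\sum_i weight t i * expR (h * (s i - c)))).
  rewrite big_mkcond/=; apply: ler_sum => i _; case: ifP => [hs|_].
    by rewrite ler_peMr ?weight_ge0// -expR0 ler_expR.
  exact: mulr_ge0 (weight_ge0 _ _) (expR_ge0 _).
have -> : \sum_i weight t i * expR (h * (s i - c)) =
    (\sum_i weight (t + h) i) * expR (lpart (t + h) - lpart t - h * c).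
  rewrite mulr_suml; apply: eq_bigr => i _; rewrite /weight -expRD -expRD; congr expR.
  by move: (lpart t) (lpart (t + h)) => u v; ring.
by rewrite weight_sum mul1r.
Qed.

(** If two parameters have the same mean then the symmetrised divergence of the two
laws vanishes, hence the laws coincide and the statistic is constant. *)
Lemma emean_inj a b : emean a < emean b -> injective emean.
Proof.
move=> ab t t' E; apply: contrapT => /eqP tt'.
have Z : \sum_i (weight t i - weight t' i) * ((t * s i - lpart t) - (t' * s i - lpart t')) = 0.
  transitivity ((t - t') * (emean t - emean t') -
    (lpart t - lpart t') * (\sum_i weight t i - \sum_i weight t' i)).
    rewrite /emean -!sumrB !mulr_sumr -sumrB; apply: eq_bigr => i _.
    by move: (weight t i) (weight t' i) (lpart t) (lpart t') => u v x y; ring.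
  by rewrite E (weight_sum t) (weight_sum t') subrr subrr mulr0 mulr0 subrr.
have term_ge0 i : true -> 0 <= (weight t i - weight t' i) *
    ((t * s i - lpart t) - (t' * s i - lpart t')).
  move=> _; rewrite /weight; set x := t * s i - _; set y := t' * s i - _.
  by have [xy|yx] := leP x y;
    [apply: mulr_le0; rewrite subr_le0 ?ler_expR|apply: mulr_ge0; rewrite subr_ge0 ?ler_expR ltW].
have := psumr_eq0P term_ge0 Z => zero.
have const i : s i = (lpart t - lpart t') / (t - t').
  have /eqP := zero i isT; rewrite mulf_eq0 !subr_eq0 => H.
  have {}H : t * s i - lpart t = t' * s i - lpart t'.
    by case/orP: H => /eqP; [exact: expR_inj|].
  have tt0 : t - t' != 0 by rewrite subr_eq0.
  apply: (mulIf tt0); rewrite (mulfVK tt0).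
  by move: (lpart t) (lpart t') (s i) H; clear => u v x H; lra.
have mean_const x : emean x = (lpart t - lpart t') / (t - t').
  rewrite /emean; under eq_bigr do rewrite const.
  by rewrite -mulr_suml weight_sum mul1r.
by move: ab; rewrite !mean_const ltxx.
Qed.

Lemma emean_le a b : a <= b -> emean a <= emean b.
Proof.
rewrite le_eqVlt => /predU1P[-> //|ab].
have ab0 : 0 < b - a by rewrite subr_gt0.
have := lpart_subgradient a b; have := lpart_subgradient b a.
move: (lpart a) (lpart b) (emean a) (emean b) => u v x y H1 H2.
rewrite -subr_ge0 -(pmulr_rge0 _ ab0); move: H1 H2; clear; lra.
Qed.

End ExponentialFamily.

(** * Concentration and consistency *)

Section PartitionLimit.
Context {R : realType}.
Variables (f F : R * R -> R) (theta : R) (a b : R -> R).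
Hypothesis bF : buc F.
Hypothesis Ff : forall z, unit_square R z -> F z = f z.
Hypotheses (ba : buc a) (bb : buc b).
Let g := tilt_exponent F theta a b.
Hypothesis g_row : forall x, avg (fun y => expR (g (x, y))) = 1.
Hypothesis g_col : forall y, avg (fun x => expR (g (x, y))) = 1.

(** The potentials contribute the same factor to every permutation. *)
Lemma ln_grid_permanent n : ln (grid_permanent g n) =
  log_partition f n theta + \sum_(i < n) a (i.+1%:R / n%:R) + \sum_(i < n) b (i.+1%:R / n%:R).
Proof.
rewrite /log_partition; set A := \sum_(i < n) a _; set C := \sum_(i < n) b _.
have -> : grid_permanent g n = (\sum_(p : 'S_n) expR (theta * perm_stat f p)) * expR (A + C).
  rewrite mulr_suml; apply: eq_bigr => p _; rewrite -expR_sum -expRD; congr expR.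
  rewrite /g /tilt_exponent/= !big_split/= -mulr_sumr.
  have -> : \sum_(i < n) b ((p i).+1%:R / n%:R) = C by rewrite /C [RHS](reindex_inj (@perm_inj _ p)).
  rewrite -addrA.
  congr (_ * _ + _); apply: eq_bigr => i _; apply: Ff; apply/unit_squareE => /=.
  have n0 : (0 < n)%N by rewrite (leq_ltn_trans _ (ltn_ord i)).
  have itv (j : 'I_n) : 0 <= (j.+1%:R / n%:R : R) <= 1.
    by apply/andP; split; [exact: divr_ge0|rewrite ler_pdivrMr ?ltr0n// mul1r ler_nat].
  by rewrite !itv.
rewrite lnM ?posrE ?expR_gt0//; first by rewrite expRK addrA.
rewrite (bigD1 1%g)//= ltr_pwDl ?expR_gt0//.
by apply: sumr_ge0 => p _; exact: expR_ge0.
Qed.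

Lemma log_partition_limit :
  n%:R^-1 * (log_partition f n theta - ln n`!%:R) @[n --> \oo] --> - (avg a + avg b).
Proof.
have bg : buc g by exact: buc_tilt.
have H1 := grid_permanent_limit bg g_row g_col.
have H2 := riemann_sum_cvg ba; have H3 := riemann_sum_cvg bb.
have H := cvgB (cvgB H1 H2) H3.
rewrite (_ : - (avg a + avg b) = 0 - avg a - avg b); last by ring.
rewrite (_ : (fun n => _) = fun n => n%:R^-1 * (ln (grid_permanent g n) - ln n`!%:R) -
    n%:R^-1 * (\sum_(i < n) a (i.+1%:R / n%:R)) - n%:R^-1 * (\sum_(i < n) b (i.+1%:R / n%:R))).
  exact: H.
by apply/funext => n; rewrite ln_grid_permanent; ring.
Qed.

End PartitionLimit.

Section FiniteProbability.
Context {R : realType}.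
Implicit Types (n : nat).

Lemma pmf_prob_le n (q : 'S_n -> R) (A : set 'S_n) (P : pred 'S_n) :
  (forall p, 0 <= q p) -> (forall p, A p -> P p) ->
  pmf_prob q A <= \sum_(p | P p) q p.
Proof.
move=> q0 AP; rewrite /pmf_prob big_mkcond [leRHS]big_mkcond/=; apply: ler_sum => p _.
by case: ifP => [/set_mem/AP ->//|_]; case: ifP.
Qed.

Lemma pmf_prob_sub n (q : 'S_n -> R) (A B : set 'S_n) :
  (forall p, 0 <= q p) -> A `<=` B -> pmf_prob q A <= pmf_prob q B.
Proof. by move=> q0 AB; apply: pmf_prob_le => // p /AB /mem_set. Qed.

Lemma pmf_prob_ge0 n (q : 'S_n -> R) (A : set 'S_n) : (forall p, 0 <= q p) -> 0 <= pmf_prob q A.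
Proof. by move=> q0; apply: sumr_ge0 => p _. Qed.

Lemma pmf_probC n (q : 'S_n -> R) (A : set 'S_n) : \sum_p q p = 1 ->
  pmf_prob q A = 1 - pmf_prob q (~` A).
Proof.
move=> q1; rewrite -q1 (bigID (fun p => p \in A))/= /pmf_prob.
have -> : \sum_(p | p \in ~` A) q p = \sum_(p | p \notin A) q p.
  by apply: eq_bigl => p; rewrite in_setC.
by rewrite addrK.
Qed.

Lemma pmf_prob_setU n (q : 'S_n -> R) (A B : set 'S_n) : (forall p, 0 <= q p) ->
  pmf_prob q (A `|` B) <= pmf_prob q A + pmf_prob q B.
Proof.
move=> q0; rewrite /pmf_prob !(big_mkcond (fun p => p \in _)) -big_split/=; apply: ler_sum => p _.
by rewrite in_setU; case: (p \in A); case: (p \in B) => /=; rewrite ?addr0 ?add0r// lerDl.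
Qed.

Lemma cvg0_dominated (p q : nat -> R) : (forall n, 0 <= p n) ->
  (\forall n \near \oo, p n <= q n) -> q n @[n --> \oo] --> (0 : R) ->
  p n @[n --> \oo] --> (0 : R).
Proof.
move=> p0 pq q0; apply: (squeeze_cvgr _ (cvg_cst 0) q0).
by near=> n; rewrite p0/=; near: n.
Unshelve. all: end_near. Qed.

Lemma cvg_expR_oppn (r : R) : 0 < r -> expR (- (n%:R * r)) @[n --> \oo] --> (0 : R).
Proof.
move=> r0; apply/cvgrPdist_le => /= e e0.
have [N NP] := nat_above ((e * r)^-1).
exists N.+1 => // n /= Nn; rewrite sub0r normrN gtr0_norm ?expR_gt0//.
have n0 : 0 < n%:R :> R by rewrite ltr0n (leq_trans _ Nn).
have er0 : 0 < e * r by rewrite mulr_gt0.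
rewrite expRN -[leRHS]invrK lef_pV2 ?posrE ?invr_gt0 ?expR_gt0//.
rewrite (@le_trans _ _ (n%:R * r))//; last first.
  by rewrite (le_trans _ (expR_ge1Dx _))// lerDr.
have : (e * r)^-1 <= n%:R.
  by rewrite (le_trans NP)// ler_nat (leq_trans _ Nn).
rewrite -(ler_pM2r r0) => /(le_trans _); apply.
by rewrite invfM mulrVK ?unitfE ?gt_eqF.
Qed.

End FiniteProbability.

Section UniqueRoots.
Context {R : realType}.

Lemma unique_root (M : R -> R) (v lo hi : R) : continuous M ->
  (forall x y, x <= y -> M x <= M y) -> injective M -> lo < hi -> M lo < v < M hi ->
  has_unique_root (fun t => v - M t) /\ (forall t, v - M t = 0 -> lo < t < hi).
Proof.
move=> Mc Mmon Minj lohi /andP[Mlo Mhi].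
have [t tI Mt] : exists2 t, t \in `[lo, hi] & M t = v.
  apply: IVT; [exact: ltW|exact: continuous_subspaceT|].
  have MM := Mmon _ _ (ltW lohi).
  by rewrite (min_l MM) (max_r MM) (ltW Mlo) (ltW Mhi).
split.
  exists t; split; first by rewrite Mt subrr.
  by move=> t' /eqP; rewrite subr_eq0 => /eqP; rewrite -Mt => /Minj.
move=> t' /eqP; rewrite subr_eq0 => /eqP vt; apply/andP; split.
  by rewrite ltNge; apply/negP => /Mmon; rewrite -vt leNgt Mlo.
by rewrite ltNge; apply/negP => /Mmon; rewrite -vt leNgt Mhi.
Qed.

End UniqueRoots.

Section Consistency.
Context {R : realType}.
Variables (f : R * R -> R) (Z m : R -> R) (c : nat -> R).
Hypothesis L_cvg : forall t, n%:R^-1 * (log_partition f n t - c n) @[n --> \oo] --> Z t.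
Hypothesis Z_sub : forall s t, Z s + (t - s) * m s <= Z t.
Hypothesis m_cont : continuous m.
Hypothesis m_incr : forall s t, s < t -> m s < m t.

Let stat n (p : 'S_n) : R := n%:R^-1 * perm_stat f p.
Let mean_n n t : R := n%:R^-1 * emean (@perm_stat R f n) t.

Lemma Q_ge0 t n (p : 'S_n) : 0 <= Q_pmf f t p.
Proof. exact: expR_ge0. Qed.

Lemma Q_sum t n : \sum_(p : 'S_n) Q_pmf f t p = 1.
Proof. exact: (weight_sum (1%g : 'S_n) (@perm_stat R f n) t). Qed.

Let L n t := n%:R^-1 * (log_partition f n t - c n).

(** The subgradient inequalities at [t + h] and [t - h] enclose the derivative
between difference quotients, whose limits are within [e] of [m t]. *)
Lemma mean_n_cvg t : mean_n n t @[n --> \oo] --> m t.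
Proof.
apply/cvgrPdist_le => /= e e0.
have e2 : 0 < e / 2 by rewrite divr_gt0.
have := @m_cont t; move=> /cvgrPdist_le/(_ _ e2)/nbhs_ballP[d /= d0 dP].
pose h := d / 2; have h0 : 0 < h by rewrite divr_gt0.
have hd : h < d by rewrite /h ltr_pdivrMr// ltr_pMr// ltr1n.
have m1 : m (t + h) <= m t + e / 2.
  have := dP (t + h); rewrite /ball/= opprD addrA subrr sub0r normrN gtr0_norm// => /(_ hd).
  by rewrite ler_norml => /andP[]; lra.
have m2 : m t - e / 2 <= m (t - h).
  have := dP (t - h); rewrite /ball/= opprB addrC subrK gtr0_norm// => /(_ hd).
  by rewrite ler_norml => /andP[]; lra.
have he : 0 < h * (e / 4) by rewrite mulr_gt0// divr_gt0.
have c1 := @L_cvg (t + h); have c2 := @L_cvg t; have c3 := @L_cvg (t - h).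
near=> n.
have n1 : `|Z (t + h) - L n (t + h)| <= h * (e / 4).
  by near: n; move/cvgrPdist_le : c1; exact.
have n2 : `|Z t - L n t| <= h * (e / 4).
  by near: n; move/cvgrPdist_le : c2; exact.
have n3 : `|Z (t - h) - L n (t - h)| <= h * (e / 4).
  by near: n; move/cvgrPdist_le : c3; exact.
have n_ge0 : 0 <= n%:R^-1 :> R by rewrite invr_ge0.
have subn x : L n t + (x - t) * mean_n n t <= L n x.
  have := lpart_subgradient (1%g : 'S_n) (@perm_stat R f n) t x.
  rewrite -(lerD2r (- c n)) => /(ler_wpM2l n_ge0).
  rewrite /L /mean_n -/(log_partition f n) => /(le_trans _); apply.
  by rewrite le_eqVlt; apply/orP; left; apply/eqP; rewrite /log_partition /lpart; ring.
have s1 := subn (t + h); have s2 := subn (t - h).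
have z1 := Z_sub (t + h) t; have z2 := Z_sub (t - h) t.
have hm1 : h * m (t + h) <= h * (m t + e / 2) by rewrite ler_wpM2l// ltW.
have hm2 : h * (m t - e / 2) <= h * m (t - h) by rewrite ler_wpM2l// ltW.
move: n1 n2 n3; rewrite !ler_norml => /andP[? ?] /andP[? ?] /andP[? ?].
move: s1 s2 z1 z2 hm1 hm2; set M := mean_n n t => s1 s2 z1 z2 hm1 hm2.
by apply/andP; split; rewrite -(ler_pM2l h0); lra.
Unshelve. all: end_near. Qed.

(** An exponential moment bound whose exponent is asymptotically linear in [n]. *)
Lemma large_deviation t h (x : R) : Z (t + h) - Z t - h * x < 0 ->
  pmf_prob (Q_pmf f t (n := n)) [set p | 0 <= h * (stat p - x)] @[n --> \oo] --> (0 : R).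
Proof.
set r := - (Z (t + h) - Z t - h * x) => rate.
have r0 : 0 < r / 3 by rewrite divr_gt0// /r oppr_gt0.
apply: cvg0_dominated (cvg_expR_oppn r0).
  by move=> n; apply: pmf_prob_ge0 => p; exact: Q_ge0.
have c1 := @L_cvg (t + h); have c2 := @L_cvg t.
near=> n.
have n0 : (0 < n)%N by near: n; exists 1%N.
have n0' : 0 < n%:R :> R by rewrite ltr0n.
have n1 : `|Z (t + h) - L n (t + h)| <= r / 3.
  by near: n; move/cvgrPdist_le : c1; exact.
have n2 : `|Z t - L n t| <= r / 3.
  by near: n; move/cvgrPdist_le : c2; exact.
have E : n%:R * (L n (t + h) - L n t - h * x) =
    log_partition f n (t + h) - log_partition f n t - h * (n%:R * x).
  by rewrite /L; field; rewrite gt_eqF.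
have ch : \sum_(p : 'S_n | 0 <= h * (perm_stat f p - n%:R * x)) Q_pmf f t p <=
    expR (n%:R * (L n (t + h) - L n t - h * x)).
  by rewrite E; exact: (exponential_tail (1%g : 'S_n) (@perm_stat R f n)).
apply: (le_trans (pmf_prob_le (P := fun p => 0 <= h * (perm_stat f p - n%:R * x)) _ _)).
- by move=> p; exact: Q_ge0.
- move=> p /=; rewrite /stat.
  have -> : h * (perm_stat f p - n%:R * x) = n%:R * (h * (n%:R^-1 * perm_stat f p - x)).
    by field; rewrite gt_eqF.
  by move=> H; rewrite mulr_ge0.
apply: (le_trans ch); rewrite ler_expR -[leRHS]mulrN ler_wpM2l ?(ltW n0')//.
have rE : Z (t + h) - Z t - h * x = - r by rewrite /r opprK.
by move: n1 n2 rE; clear; rewrite !ler_norml => /andP[? ?] /andP[? ?]; lra.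
Unshelve. all: end_near. Qed.

Lemma concentration t (e : R) : 0 < e ->
  pmf_prob (Q_pmf f t (n := n)) [set p | e <= `|stat p - m t|] @[n --> \oo] --> (0 : R).
Proof.
move=> e0; have := @m_cont t; move=> /cvgrPdist_lt/(_ _ e0)/nbhs_ballP[d /= d0 dP].
pose h := d / 2; have h0 : 0 < h by rewrite divr_gt0.
have hd : h < d by rewrite /h ltr_pdivrMr// ltr_pMr// ltr1n.
have m1 : m (t + h) < m t + e.
  have := dP (t + h); rewrite /ball/= opprD addrA subrr sub0r normrN gtr0_norm// => /(_ hd).
  by rewrite ltr_norml => /andP[]; lra.
have m2 : m t - e < m (t - h).
  have := dP (t - h); rewrite /ball/= opprB addrC subrK gtr0_norm// => /(_ hd).
  by rewrite ltr_norml => /andP[]; lra.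
have r1 : Z (t + h) - Z t - h * (m t + e) < 0.
  have z := Z_sub (t + h) t; have : h * m (t + h) < h * (m t + e) by rewrite ltr_pM2l.
  lra.
have r2 : Z (t - h) - Z t - - h * (m t - e) < 0.
  have z := Z_sub (t - h) t; have : h * (m t - e) < h * m (t - h) by rewrite ltr_pM2l.
  lra.
have tails : pmf_prob (Q_pmf f t (n := n)) [set p | 0 <= h * (stat p - (m t + e))] +
    pmf_prob (Q_pmf f t (n := n)) [set p | 0 <= - h * (stat p - (m t - e))] @[n --> \oo] --> (0 : R).
  by rewrite -[X in _ --> X]addr0; apply: cvgD; exact: large_deviation.
apply: cvg0_dominated tails.
  by move=> n; apply: pmf_prob_ge0 => p; exact: Q_ge0.
near=> n; apply: le_trans (pmf_prob_setU _ _ _); last by move=> p; exact: Q_ge0.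
apply: pmf_prob_sub => [p|p /=]; first exact: Q_ge0.
case: (ger0P (stat p - m t)) => _ H; [left|right] => /=.
  by rewrite mulr_ge0 ?(ltW h0)//; lra.
by rewrite mulNr -mulrN mulr_ge0 ?(ltW h0)//; lra.
Unshelve. all: end_near. Qed.

(** Both estimating equations have the form [stat p = M n t] with nondecreasing
functions [M n] that separate the neighbourhoods of [t0]; the limit and the exact
mean functions are treated together. *)
Section Estimators.
Variables (M : nat -> R -> R) (t0 : R).
Hypothesis M_cont : forall n, continuous (M n).
Hypothesis M_mono : forall n s t, s <= t -> M n s <= M n t.
Hypothesis M_inj : forall n s t, M n s < M n t -> injective (M n).
Hypothesis M_cvg : forall t, M n t @[n --> \oo] --> m t.

(** If the observed statistic is close to its limit [m t0], the unique root is
caught between [t0 - e] and [t0 + e] by monotonicity. *)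
Lemma root_event (e : R) : 0 < e -> exists2 d : R, 0 < d &
  \forall n \near \oo, forall p : 'S_n, `|stat p - m t0| < d ->
    has_unique_root (fun t => stat p - M n t) /\
    (forall t, stat p - M n t = 0 -> `|t - t0| < e).
Proof.
move=> e0.
have lo : m (t0 - e) < m t0 by apply: m_incr; rewrite gtrBl.
have hi : m t0 < m (t0 + e) by apply: m_incr; rewrite ltrDl.
pose d := Num.min (m t0 - m (t0 - e)) (m (t0 + e) - m t0) / 2.
have d0 : 0 < d by rewrite divr_gt0// lt_min !subr_gt0 lo.
have d1 : 2 * d <= m t0 - m (t0 - e).
  by rewrite /d mulrC divfK ?pnatr_eq0// ge_min lexx.
have d2 : 2 * d <= m (t0 + e) - m t0.
  by rewrite /d mulrC divfK ?pnatr_eq0// ge_min lexx orbT.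
exists d => //; have c1 := @M_cvg (t0 - e); have c2 := @M_cvg (t0 + e).
near=> n => p pd.
have n1 : `|m (t0 - e) - M n (t0 - e)| < d.
  by near: n; move/cvgrPdist_lt : c1; exact.
have n2 : `|m (t0 + e) - M n (t0 + e)| < d.
  by near: n; move/cvgrPdist_lt : c2; exact.
move: pd n1 n2; rewrite !ltr_norml => /andP[? ?] /andP[? ?] /andP[? ?].
have lohi : t0 - e < t0 + e by lra.
have between : M n (t0 - e) < stat p < M n (t0 + e) by apply/andP; split; lra.
have Minj : injective (M n).
  by case/andP: between => b1 b2; apply: M_inj (lt_trans b1 b2).
have [H1 H2] := unique_root (M_cont (n := n)) (@M_mono n) Minj lohi between.
by split=> // t /H2; rewrite ltr_norml => /andP[? ?]; apply/andP; split; lra.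
Unshelve. all: end_near. Qed.

Lemma unique_root_prob : pmf_prob (Q_pmf f t0 (n := n))
  [set p | has_unique_root (fun t => stat p - M n t)] @[n --> \oo] --> (1 : R).
Proof.
have [d d0 nP] := root_event ltr01.
have H : pmf_prob (Q_pmf f t0 (n := n))
    (~` [set p | has_unique_root (fun t => stat p - M n t)]) @[n --> \oo] --> (0 : R).
  apply: cvg0_dominated (concentration t0 d0).
    by move=> n; apply: pmf_prob_ge0 => p; exact: Q_ge0.
  apply: filterS nP => n nP; apply: pmf_prob_sub => [p|p /= nu]; first exact: Q_ge0.
  by rewrite leNgt; apply/negP => /nP[].
rewrite (_ : (fun n => _) = fun n => 1 - pmf_prob (Q_pmf f t0 (n := n))
    (~` [set p | has_unique_root (fun t => stat p - M n t)])); last first.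
  by apply/funext => n; rewrite -pmf_probC//; exact: Q_sum.
by rewrite -[X in _ --> X]subr0; apply: cvgB => //; exact: cvg_cst.
Qed.

Lemma estimator_consistent (hat : forall n, 'S_n -> R) :
  root_estimator (fun n (p : 'S_n) t => stat p - M n t) hat ->
  cvg_in_prob (Q_pmf f t0) hat t0.
Proof.
move=> hatP e e0; have [d d0 nP] := root_event e0.
apply: cvg0_dominated (concentration t0 d0).
  by move=> n; apply: pmf_prob_ge0 => p; exact: Q_ge0.
apply: filterS nP => n nP; apply: pmf_prob_sub => [p|p /= he]; first exact: Q_ge0.
rewrite leNgt; apply/negP => /nP[ur near_t0].
by have := near_t0 _ (hatP _ _ ur); rewrite ltNge ltW.
Qed.

End Estimators.
End Consistency.

(** * The corollary *)

Section Subdifferential.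
Context {R : realType}.

(** Letting [s] tend to [t] from each side bounds [k] from above and below by the
continuous subgradient. *)
Lemma subgradient_unique (Z m : R -> R) (t k : R) :
  (forall x y, Z x + (y - x) * m x <= Z y) -> {for t, continuous m} ->
  (forall s, Z t + (s - t) * k <= Z s) -> k = m t.
Proof.
move=> sub mc sk.
have cmp s : (s - t) * k <= (s - t) * m s by have := sub s t; have := sk s; lra.
apply/eqP; rewrite eq_le; apply/andP; split; rewrite leNgt; apply/negP => lt_km.
  have e0 : 0 < k - m t by rewrite subr_gt0.
  move/cvgrPdist_lt : mc => /(_ _ e0)/nbhs_ballP[d /= d0 dP].
  have h0 : 0 < d / 2 by rewrite divr_gt0.
  have := dP (t + d / 2); rewrite /ball/= opprD addrA subrr sub0r normrN gtr0_norm//.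
  rewrite ltr_pdivrMr// ltr_pMr// ltr1n => /(_ isT).
  have := cmp (t + d / 2); rewrite addrAC subrr add0r ler_pM2l//.
  by rewrite ltr_norml => ? /andP[? ?]; lra.
have e0 : 0 < m t - k by rewrite subr_gt0.
move/cvgrPdist_lt : mc => /(_ _ e0)/nbhs_ballP[d /= d0 dP].
have h0 : 0 < d / 2 by rewrite divr_gt0.
have := dP (t - d / 2); rewrite /ball/= opprB addrC subrK gtr0_norm//.
rewrite ltr_pdivrMr// ltr_pMr// ltr1n => /(_ isT).
have := cmp (t - d / 2); rewrite addrAC subrr add0r !mulNr lerN2 ler_pM2l//.
by rewrite ltr_norml => ? /andP[? ?]; lra.
Qed.

End Subdifferential.

Section GibbsFamily.
Context {R : realType}.
Variable f : R * R -> R.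
Hypothesis hf : class_C f.

Let F (z : R * R) : R := f (clip z.1, clip z.2).

Let bF : buc F. Proof. by have [fc _ _ _] := hf; exact: buc_clip. Qed.

Let Ff z : unit_square R z -> F z = f z.
Proof.
by case: z => x y /unit_squareE/andP[/= x01 y01]; rewrite /F/= !clip_id.
Qed.

Let F_row x : avg (fun y => F (x, y)) = 0.
Proof.
have [_ _ f_row _] := hf.
rewrite -avg_lebesgue; last exact: buc_bm (buc_slice1 x bF).
have cx : clip x \in `[0, 1] by rewrite in_itv/= clip_itv.
rewrite -[RHS](f_row _ cx); apply: eq_Rintegral => y /set_mem/=.
by rewrite in_itv/= /F/= => y01; rewrite (clip_id y01).
Qed.

Let F_col y : avg (fun x => F (x, y)) = 0.
Proof.
have [_ _ _ f_col] := hf.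
rewrite -avg_lebesgue; last exact: buc_bm (buc_slice2 y bF).
have cy : clip y \in `[0, 1] by rewrite in_itv/= clip_itv.
rewrite -[RHS](f_col _ cy); apply: eq_Rintegral => x /set_mem/=.
by rewrite in_itv/= /F/= => x01; rewrite (clip_id x01).
Qed.

Let F2_gt0 : 0 < avg2 (fun z => F z ^+ 2).
Proof.
have [_ [[x y] xy fxy] _ _] := hf.
have bF2 : buc (fun z => F z ^+ 2) by exact: bucM.
rewrite lt0r (avg2_ge0 (fun z => sqr_ge0 _)) andbT; apply/eqP => F20.
have /unit_squareE/andP[/= x01 y01] := xy.
have row0 := avg_eq0 (buc_avg bF2) (fun x => avg_ge0 (fun y => sqr_ge0 (F (x, y)))) F20 x01.
have := avg_eq0 (buc_slice1 x bF2) (fun y => sqr_ge0 (F (x, y))) row0 y01.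
by move/eqP; rewrite sqrf_eq0 Ff// (negbTE fxy).
Qed.

(** What the statistical part needs to know. The growth rate of the partition
functions and the supremum over permutons are identified through the potentials,
by which both are expressed. *)
Lemma limit_pressure : exists m : R -> R,
  [/\ forall t, n%:R^-1 * (log_partition f n t - ln n`!%:R) @[n --> \oo] --> Z_lim f t,
      forall s t, Z_lim f s + (t - s) * m s <= Z_lim f t,
      continuous m,
      forall s t, s < t -> m s < m t &
      forall t, mean f (mu_gibbs f t) = m t].
Proof.
have [B B0 FB] := buc_bound bF.
have [ab abP] := potentials_exist bF FB.
have ZE t : Z_ereal f t = (- (avg (ab t).1 + avg (ab t).2))%:E.
  by have [ba bb rt ct _] := abP t; exact: (Z_erealE bF Ff ba bb rt ct).
have ZlE t : Z_lim f t = - (avg (ab t).1 + avg (ab t).2) by rewrite /Z_lim ZE.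
pose m := tilt_mean F ab.
have sub s t : Z_lim f s + (t - s) * m s <= Z_lim f t.
  have [ba bb rs cs _] := abP s.
  have := Z_ereal_subgradient bF Ff ba bb rs cs t
    (permuton_tilted (buc_tilt bF s ba bb) rs cs) _.
  rewrite (mean_tilted bF Ff ba bb rs cs) !ZE lee_fin !ZlE; apply.
  by rewrite (gibbs_objective_tilted bF Ff ba bb rs cs).
have mc : continuous m.
  move=> t; apply/cvgrPdist_le => /= e e0.
  have [K K0 KP] := tilt_mean_lipschitz bF FB abP (`|t| + 1).
  have K1 : 0 < K + 1 by rewrite ltr_wpDl.
  have d0 : 0 < Num.min 1 (e / (K + 1)) by rewrite lt_min ltr01 divr_gt0.
  apply/nbhs_ballP; exists (Num.min 1 (e / (K + 1))) => // s; rewrite /ball/= lt_min => /andP[s1 sK].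
  have tT : `|t| <= `|t| + 1 by rewrite lerDl.
  have sT : `|s| <= `|t| + 1.
    have -> : s = t - (t - s) by ring.
    by rewrite (le_trans (ler_normB _ _))// lerD2l ltW.
  rewrite (le_trans (KP _ _ tT sT))//.
  rewrite (@le_trans _ _ ((K + 1) * `|t - s|))//; first by rewrite ler_wpM2r// lerDl.
  by rewrite mulrC -ler_pdivlMr// ltW.
have mi s t : s < t -> m s < m t by exact: (tilt_mean_strict bF FB F_row F_col abP F2_gt0).
exists m; split => // t; have [ba bb rt ct _] := abP t.
  by rewrite ZlE; exact: (log_partition_limit bF Ff ba bb rt ct).
have [pmu opt] := mu_gibbsP bF Ff ba bb rt ct.
apply: (subgradient_unique sub (@mc t)) => s.
have := Z_ereal_subgradient bF Ff ba bb rt ct s pmu opt.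
by rewrite ZE lee_fin !ZlE.
Qed.

End GibbsFamily.

Theorem corollary1p6 (R : realType) (f : R * R -> R) (hf : class_C f) :
  (* (a) *)
  (forall theta0 : R,
     [/\ derivable (Z_lim f) theta0 1,
         derive1 (Z_lim f) theta0 = mean f (mu_gibbs f theta0) &
         cvg_in_prob (Q_pmf f theta0)
           (fun n (pi : 'S_n) => n%:R^-1 * perm_stat f pi)
           (derive1 (Z_lim f) theta0)]) /\
  (* (b) *)
  (forall theta0 : R,
     [/\ pmf_prob (Q_pmf f theta0 (n:=n))
           [set pi | has_unique_root (ML f pi)] @[n --> \oo] --> (1 : R),
         pmf_prob (Q_pmf f theta0 (n:=n))
           [set pi | has_unique_root (LD f pi)] @[n --> \oo] --> (1 : R),
         forall hat_ML : (forall n, 'S_n -> R), root_estimator (ML f) hat_ML ->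
           cvg_in_prob (Q_pmf f theta0) hat_ML theta0 &
         forall hat_LD : (forall n, 'S_n -> R), root_estimator (LD f) hat_LD ->
           cvg_in_prob (Q_pmf f theta0) hat_LD theta0]) /\
  (* (c) *)
  (forall theta0 theta1 : R, theta0 < theta1 ->
   forall hat_LD : (forall n, 'S_n -> R), root_estimator (LD f) hat_LD ->
     let phi n (pi : 'S_n) : R := if (theta0 + theta1) / 2 < hat_LD n pi then 1 else 0 in
     pmf_expect (Q_pmf f theta0 (n:=n)) (phi n) @[n --> \oo] --> (0 : R) /\
     pmf_expect (Q_pmf f theta1 (n:=n)) (phi n) @[n --> \oo] --> (1 : R)).
Proof.
have [m [L_cvg sub mc mi meanE]] := limit_pressure hf.
have der (t : R) : is_derive t (1 : R) (Z_lim f) (m t) by exact: (subgradient_derive sub (@mc t)).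
have derE t : derive1 (Z_lim f) t = m t by rewrite derive1E; have [] := der t.
have LDE : LD f = fun n (p : 'S_n) t => n%:R^-1 * perm_stat f p - m t.
  by apply: functional_extensionality_dep => n; apply/funext => p; apply/funext => t; rewrite /LD derE.
pose M n t := n%:R^-1 * emean (@perm_stat R f n) t.
have MLE : ML f = fun n (p : 'S_n) t => n%:R^-1 * perm_stat f p - M n t.
  apply: functional_extensionality_dep => n; apply/funext => p; apply/funext => t; rewrite /ML /M derive1E.
  by have [_ ->] := lpart_derive (1%g : 'S_n) (@perm_stat R f n) t.
have m_mono (n : nat) s t : s <= t -> m s <= m t.
  by rewrite le_eqVlt => /predU1P[-> //|/mi/ltW].
have m_inj (n : nat) s t : m s < m t -> injective m.
  by move=> _ x y mxy; case: (ltgtP x y) => // /mi; rewrite mxy ltxx.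
have M_cont n : continuous (M n).
  by move=> t; apply: cvgM; [exact: cvg_cst|exact: (emean_continuous (1%g : 'S_n))].
have M_mono n s t : s <= t -> M n s <= M n t.
  move=> st; apply: ler_wpM2l; first by rewrite invr_ge0.
  exact: (emean_le (1%g : 'S_n)).
have M_inj n s t : M n s < M n t -> injective (M n).
  have [n0|n0] := posnP n.
    have z : n%:R^-1 = 0 :> R by rewrite n0 invr0.
    by rewrite /M z; move: (emean (@perm_stat R f n)) => mu; rewrite !mul0r ltxx.
  have n0' : 0 < n%:R^-1 :> R by rewrite invr_gt0 ltr0n.
  rewrite /M (ltr_pM2l n0') => /(emean_inj (1%g : 'S_n)) inj x y /(mulfI (lt0r_neq0 n0')).
  exact: inj.
have M_cvg t : M n t @[n --> \oo] --> m t by exact: (mean_n_cvg L_cvg sub mc).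
have m_cvg t : (fun _ : nat => m) n t @[n --> \oo] --> m t by exact: cvg_cst.
have LD_consistent t (hat : forall n, 'S_n -> R) : root_estimator (LD f) hat ->
    cvg_in_prob (Q_pmf f t) hat t.
  rewrite LDE => hatP.
  exact: (estimator_consistent (M := fun=> m) L_cvg sub mc mi t (fun=> mc) m_mono m_inj m_cvg hatP).
split; [|split].
- move=> t; rewrite derE meanE; split => //.
  move=> e e0; apply: cvg0_dominated (concentration L_cvg sub mc t e0).
    by move=> n; apply: pmf_prob_ge0 => p; exact: Q_ge0.
  near=> n; apply: pmf_prob_sub => [p|p /= /ltW //]; exact: Q_ge0.
- move=> t; split.
  + by rewrite MLE; exact: (unique_root_prob L_cvg sub mc mi t M_cont M_mono M_inj M_cvg).
  + by rewrite LDE; exact: (unique_root_prob (M := fun=> m) L_cvg sub mc mi t (fun=> mc) m_mono m_inj m_cvg).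
  + move=> hat; rewrite MLE => hatP.
    exact: (estimator_consistent L_cvg sub mc mi t M_cont M_mono M_inj M_cvg hatP).
  + exact: LD_consistent.
move=> t0 t1 t01 hat hatP phi.
pose e := (t1 - t0) / 4; have e0 : 0 < e by rewrite divr_gt0// subr_gt0.
have expE t n : pmf_expect (Q_pmf f t (n := n)) (phi n) =
    pmf_prob (Q_pmf f t (n := n)) [set p | (t0 + t1) / 2 < hat n p].
  rewrite /pmf_expect /pmf_prob [RHS]big_mkcond/=; apply: eq_bigr => p _; rewrite /phi.
  case: ifPn => H; first by rewrite mem_set// mulr1.
  by rewrite memNset/= ?mulr0//; exact/negP.
split.
  under eq_fun do rewrite expE.
  apply: cvg0_dominated (LD_consistent t0 hat hatP e e0).
    by move=> n; apply: pmf_prob_ge0 => p; exact: Q_ge0.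
  near=> n; apply: pmf_prob_sub => [p|p /= H]; first exact: Q_ge0.
  by rewrite (lt_le_trans _ (ler_norm _))//; move: e0 H; rewrite /e; clear; lra.
rewrite (_ : (fun n => _) = fun n => 1 - pmf_prob (Q_pmf f t1 (n := n))
    (~` [set p | (t0 + t1) / 2 < hat n p])); last first.
  by apply/funext => n; rewrite expE -pmf_probC//; exact: Q_sum.
rewrite -[X in _ --> X]subr0; apply: cvgB; first exact: cvg_cst.
apply: cvg0_dominated (LD_consistent t1 hat hatP e e0).
  by move=> n; apply: pmf_prob_ge0 => p; exact: Q_ge0.
near=> n; apply: pmf_prob_sub => [p|p /= /negP]; first exact: Q_ge0.
rewrite -leNgt => H; rewrite distrC (lt_le_trans _ (ler_norm _))//.
by move: e0 H; rewrite /e; clear; lra.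
Unshelve. all: end_near. Qed.
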